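(* Let $(M,g)$ be a finite-dimensional Riemannian manifold with Levi-Civita connection $\nabla$ and curvature $\mathcal R$, and let $\varepsilon_1,\varepsilon_2>0$ and $T>0$. Let $\mathcal C$ be the space of $C^3$, piecewise smooth curves $c:[0,T]\to M$ with fixed prescribed position $c$, velocity $\dot c$ and covariant acceleration $\nabla_{\dot c}\dot c$ at $t=0$ and at $t=T$. If $q\in\mathcal C$ minimizes $$c\mapsto\int_0^T\Big(\varepsilon_1^2\|\dot c\|^2+\varepsilon_2^2\|\nabla_{\dot c}\dot c\|^2+\|\nabla^2_{\dot c}\dot c\|^2\Big)\,dt$$ over $\mathcal C$, then $q$ satisfies $$\nabla_{\dot q}^5\dot q+\mathcal R(\nabla_{\dot q}\dot q,\nabla_{\dot q}^2\dot q)\dot q+\mathcal R(\nabla_{\dot q}^3\dot q,\dot q)\dot q=\varepsilon_2^2\nabla_{\dot q}^3\dot q+\varepsilon_2^2\mathcal R(\nabla_{\dot q}\dot q,\dot q)\dot q-\varepsilon_1^2\nabla_{\dot q}\dot q .$$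
   Context: $\mathcal R(X,Y)Z=\nabla_X\nabla_YZ-\nabla_Y\nabla_XZ-\nabla_{[X,Y]}Z$. $\nabla_{\dot q}^k\dot q$ denotes the $k$-th iterated covariant derivative along $q$ of its velocity $\dot q$. $\|\cdot\|$ is the norm of $g$. The functional arises, up to relabelling the positive weights and multiplying by a positive constant, by evaluating the energy of the weighted generalized Sasaki metric on the second-order tangent bundle $T^{(2)}M$ along second jet lifts $j^2c$ of curves $c$ on $M$. Solutions of the equation are called Riemannian quintics in tension. *)

(* Defs.v *)
From HB Require Import structures.
From mathcomp Require Import all_boot all_order all_algebra.
From mathcomp Require Import all_classical all_reals all_analysis.

Set Implicit Arguments.
Unset Strict Implicit.
Unset Printing Implicit Defensive.

Import Order.TTheory GRing.Theory Num.Theory.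
Import numFieldNormedType.Exports.

Local Open Scope classical_set_scope.
Local Open Scope ring_scope.

(* For [U] open and [V] finite-dimensional this is the usual class C^k:
   all iterated directional derivatives of order at most k exist and are
   continuous on [U]. *)
Fixpoint Ck_on (R : realType) (V W : normedModType R) (k : nat)
    (U : set V) (f : V -> W) : Prop :=
  (forall x, U x -> {for x, continuous f}) /\
  if k is k'.+1 then
    forall v, (forall x, U x -> derivable f x v) /\
              Ck_on k' U (fun x => 'D_v f x)
  else True.

Definition smooth_on (R : realType) (V W : normedModType R)
    (U : set V) (f : V -> W) : Prop :=
  forall k, Ck_on k U f.

(* Derivatives relative to [a, b]: two-sided at interior points, one-sided at
   the endpoints. *)
Definition diff_quot (R : realType) (V : normedModType R)
    (f : R -> V) (t u : R) : V := (u - t)^-1 *: (f u - f t).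

Definition derivable_within (R : realType) (V : normedModType R)
    (a b : R) (f : R -> V) (t : R) : Prop :=
  cvg (diff_quot f t u @[u --> within `[a, b] t^']).

Definition derive_within (R : realType) (V : normedModType R)
    (a b : R) (f : R -> V) (t : R) : V :=
  lim (diff_quot f t u @[u --> within `[a, b] t^']).

(* A manifold is given by an atlas, indexed by [chart].  The chart maps
   [phi a] and [psi a] are total functions, significant only on [dom a] and on
   the image of [dom a], where they are inverse homeomorphisms.  [chart_at]
   selects a chart around each point. *)
Record smoothManifold (R : realType) (n : nat) := SmoothManifold {
  carrier :> topologicalType;
  manifold_hausdorff : hausdorff_space carrier;
  manifold_second_countable : @second_countable carrier;
  chart : Type;
  dom : chart -> set carrier;
  phi : chart -> carrier -> 'rV[R]_n;
  psi : chart -> 'rV[R]_n -> carrier;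
  chart_at : carrier -> chart;
  chart_atP : forall p, dom (chart_at p) p;
  dom_open : forall a, open (dom a);
  phi_open : forall a, open (phi a @` dom a);
  phiK : forall a p, dom a p -> psi a (phi a p) = p;
  phi_continuous : forall a p, dom a p -> {for p, continuous (phi a)};
  psi_continuous : forall a x, (phi a @` dom a) x ->
    {for x, continuous (psi a)};
  transition_smooth : forall a b,
    smooth_on (phi a @` (dom a `&` dom b)) (phi b \o psi a) }.

Definition img (R : realType) (n : nat) (M : smoothManifold R n)
  (a : chart M) : set 'rV[R]_n := phi a @` dom a.

Definition overlap (R : realType) (n : nat) (M : smoothManifold R n)
  (a b : chart M) : set 'rV[R]_n := phi a @` (dom a `&` dom b).

Definition transition (R : realType) (n : nat) (M : smoothManifold R n)
  (a b : chart M) : 'rV[R]_n -> 'rV[R]_n := phi b \o psi a.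

(* A tangent vector at [p]: its components in every chart around [p], related
   by the differentials of the transition maps. *)
Record tangent (R : realType) (n : nat) (M : smoothManifold R n) (p : M) :=
  Tangent {
  component :> chart M -> 'rV[R]_n;
  component_transition : forall a b, dom a p -> dom b p ->
    component b = 'D_(component a) (transition a b) (phi a p) }.

Definition bilin (R : realType) (n : nat) (A : 'M[R]_n) (u v : 'rV[R]_n) : R :=
  (u *m A *m v^T) 0 0.

Record riemannianMetric (R : realType) (n : nat) (M : smoothManifold R n) :=
  RiemannianMetric {
  metric_mx : chart M -> 'rV[R]_n -> 'M[R]_n;
  metric_smooth : forall a i j, smooth_on (img a)
    (fun x => metric_mx a x i j : R^o);
  metric_sym : forall a x, img a x -> (metric_mx a x)^T = metric_mx a x;
  metric_posdef : forall a x v, img a x -> v != 0 ->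
    0 < bilin (metric_mx a x) v v;
  metric_transition : forall a b x u v, overlap a b x ->
    bilin (metric_mx a x) u v =
    bilin (metric_mx b (transition a b x))
      ('D_u (transition a b) x) ('D_v (transition a b) x) }.

(* The inner product and the norm of vectors given by their components in the
   chart [a], at the point of coordinates [x]. *)
Definition inner (R : realType) (n : nat) (M : smoothManifold R n)
    (g : riemannianMetric M) (a : chart M) (x u v : 'rV[R]_n) : R :=
  bilin (metric_mx g a x) u v.

Definition gnorm (R : realType) (n : nat) (M : smoothManifold R n)
    (g : riemannianMetric M) (a : chart M) (x u : 'rV[R]_n) : R :=
  Num.sqrt (inner g a x u u).

(* [Gamma^k_ij u^i v^j] for Christoffel symbols [Gamma k i j]. *)
Definition christoffel_apply (R : realType) (n : nat) (Gamma : 'I_n -> 'M[R]_n)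
    (u v : 'rV[R]_n) : 'rV[R]_n :=
  \row_k bilin (Gamma k) u v.

(* The last field is the classical transformation law of the Christoffel
   symbols: nabla is independent of the chart used to compute it. *)
Record affineConnection (R : realType) (n : nat) (M : smoothManifold R n) :=
  AffineConnection {
  christoffel : chart M -> 'rV[R]_n -> 'I_n -> 'M[R]_n;
  christoffel_smooth : forall a k i j, smooth_on (img a)
    (fun x => christoffel a x k i j : R^o);
  christoffel_transition : forall a b x u v, overlap a b x ->
    'D_(christoffel_apply (christoffel a x) u v) (transition a b) x =
    'D_u (fun y => 'D_v (transition a b) y) x +
    christoffel_apply (christoffel b (transition a b x))
      ('D_u (transition a b) x) ('D_v (transition a b) x) }.

(* [nabla_X Y] and [[X, Y]] for vector fields in the coordinates of [a]. *)
Definition cov_deriv (R : realType) (n : nat) (M : smoothManifold R n)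
    (nabla : affineConnection M) (a : chart M)
    (X Y : 'rV[R]_n -> 'rV[R]_n) (x : 'rV[R]_n) : 'rV[R]_n :=
  'D_(X x) Y x + christoffel_apply (christoffel nabla a x) (X x) (Y x).

Definition lie_bracket (R : realType) (n : nat)
    (X Y : 'rV[R]_n -> 'rV[R]_n) (x : 'rV[R]_n) : 'rV[R]_n :=
  'D_(X x) Y x - 'D_(Y x) X x.

Definition torsion_free (R : realType) (n : nat) (M : smoothManifold R n)
    (nabla : affineConnection M) : Prop :=
  forall (a : chart M) (X Y : 'rV[R]_n -> 'rV[R]_n),
    smooth_on (img a) X -> smooth_on (img a) Y ->
    forall x, img a x ->
      cov_deriv nabla a X Y x - cov_deriv nabla a Y X x = lie_bracket X Y x.

Definition metric_compatible (R : realType) (n : nat) (M : smoothManifold R n)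
    (g : riemannianMetric M) (nabla : affineConnection M) : Prop :=
  forall (a : chart M) (X Y Z : 'rV[R]_n -> 'rV[R]_n),
    smooth_on (img a) X -> smooth_on (img a) Y -> smooth_on (img a) Z ->
    forall x, img a x ->
      'D_(X x) (fun y => inner g a y (Y y) (Z y) : R^o) x =
      inner g a x (cov_deriv nabla a X Y x) (Z x) +
      inner g a x (Y x) (cov_deriv nabla a X Z x).

Definition levi_civita (R : realType) (n : nat) (M : smoothManifold R n)
    (g : riemannianMetric M) (nabla : affineConnection M) : Prop :=
  torsion_free nabla /\ metric_compatible g nabla.

Definition curvature_field (R : realType) (n : nat) (M : smoothManifold R n)
    (nabla : affineConnection M) (a : chart M)
    (X Y Z : 'rV[R]_n -> 'rV[R]_n) (x : 'rV[R]_n) : 'rV[R]_n :=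
  cov_deriv nabla a X (cov_deriv nabla a Y Z) x -
  cov_deriv nabla a Y (cov_deriv nabla a X Z) x -
  cov_deriv nabla a (lie_bracket X Y) Z x.

(* The curvature is a tensor, so its value on the vectors [u], [v], [w] at [x]
   may be computed with any extensions to vector fields; those with constant
   components are used. *)
Definition curvature (R : realType) (n : nat) (M : smoothManifold R n)
    (nabla : affineConnection M) (a : chart M) (x u v w : 'rV[R]_n) :
    'rV[R]_n :=
  curvature_field nabla a (fun=> u) (fun=> v) (fun=> w) x.

(* A curve on [a, b] is a function on the whole real line of which only the
   restriction to [a, b] matters.  [coord i c t] is significant only for
   [dom i (c t)], a relatively open condition on t when c is continuous. *)
Definition coord (R : realType) (n : nat) (M : smoothManifold R n)
    (i : chart M) (c : R -> M) : R -> 'rV[R]_n := phi i \o c.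

Definition Ck_curve (R : realType) (n : nat) (M : smoothManifold R n)
    (a b : R) (k : nat) (c : R -> M) : Prop :=
  {within `[a, b], continuous c} /\
  forall (i : chart M) (t : R), a <= t <= b -> dom i (c t) ->
    let D := fun j => iter j (derive_within a b) (coord i c) in
    (forall j, (j < k)%N -> derivable_within a b (D j) t) /\
    (forall j, (j <= k)%N -> D j u @[u --> within `[a, b] (nbhs t)] --> D j t).

Definition smooth_curve (R : realType) (n : nat) (M : smoothManifold R n)
    (a b : R) (c : R -> M) : Prop :=
  forall k, Ck_curve a b k c.

Definition piecewise_smooth (R : realType) (n : nat) (M : smoothManifold R n)
    (a b : R) (c : R -> M) : Prop :=
  exists2 s : seq R, itv_partition a b s &
    forall j, (j < size s)%N ->
      smooth_curve (nth b (a :: s) j) (nth b s j) c.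

(* Components in the chart [i] of the velocity of c : [0, T] -> M, of the
   covariant derivative along c of a vector field with components [V], and of
   [nabla^k_{c'} c']. *)
Definition velocity (R : realType) (n : nat) (M : smoothManifold R n)
    (T : R) (c : R -> M) (i : chart M) : R -> 'rV[R]_n :=
  derive_within 0 T (coord i c).

Definition cov_along (R : realType) (n : nat) (M : smoothManifold R n)
    (nabla : affineConnection M) (T : R) (c : R -> M) (i : chart M)
    (V : R -> 'rV[R]_n) (t : R) : 'rV[R]_n :=
  derive_within 0 T V t +
  christoffel_apply (christoffel nabla i (coord i c t)) (velocity T c i t) (V t).

Definition cov_velocity (R : realType) (n : nat) (M : smoothManifold R n)
    (nabla : affineConnection M) (T : R) (c : R -> M) (k : nat)
    (i : chart M) : R -> 'rV[R]_n :=
  iter k (cov_along nabla T c i) (velocity T c i).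

(* [|nabla^k_{c'} c'|] at time t; by the transformation laws the choice of the
   chart around [c t] is irrelevant. *)
Definition cov_velocity_norm (R : realType) (n : nat) (M : smoothManifold R n)
    (g : riemannianMetric M) (nabla : affineConnection M) (T : R) (c : R -> M)
    (k : nat) (t : R) : R :=
  let i := chart_at (c t) in
  gnorm g i (coord i c t) (cov_velocity nabla T c k i t).

Record in_curve_space (R : realType) (n : nat) (M : smoothManifold R n)
    (nabla : affineConnection M) (T : R)
    (p0 : M) (v0 w0 : tangent p0) (p1 : M) (v1 w1 : tangent p1)
    (c : R -> M) : Prop := InCurveSpace {
  curve_C3 : Ck_curve 0 T 3 c;
  curve_piecewise_smooth : piecewise_smooth 0 T c;
  curve_start : c 0 = p0;
  curve_start_velocity : forall i, dom i p0 -> velocity T c i 0 = v0 i;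
  curve_start_acceleration : forall i, dom i p0 ->
    cov_velocity nabla T c 1 i 0 = w0 i;
  curve_end : c T = p1;
  curve_end_velocity : forall i, dom i p1 -> velocity T c i T = v1 i;
  curve_end_acceleration : forall i, dom i p1 ->
    cov_velocity nabla T c 1 i T = w1 i }.

Definition tension_energy (R : realType) (n : nat) (M : smoothManifold R n)
    (g : riemannianMetric M) (nabla : affineConnection M) (eps1 eps2 T : R)
    (c : R -> M) : R :=
  (\int[lebesgue_measure]_(t in `[0%R, T])
     (eps1 ^+ 2 * cov_velocity_norm g nabla T c 0 t ^+ 2 +
      eps2 ^+ 2 * cov_velocity_norm g nabla T c 1 t ^+ 2 +
      cov_velocity_norm g nabla T c 2 t ^+ 2))%R.

(* The equation involves six derivatives of q, whose existence (and continuity)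
   on [0, T] is part of the assertion that q solves it. *)
Definition quintic_in_tension (R : realType) (n : nat) (M : smoothManifold R n)
    (nabla : affineConnection M) (eps1 eps2 T : R) (q : R -> M) : Prop :=
  Ck_curve 0 T 6 q /\
  forall (i : chart M) (t : R), 0 <= t <= T -> dom i (q t) ->
    let D := fun k => cov_velocity nabla T q k i t in
    let Rm := curvature nabla i (coord i q t) in
    D 5 + Rm (D 1) (D 2) (D 0) + Rm (D 3) (D 0) (D 0) =
    eps2 ^+ 2 *: D 3 + eps2 ^+ 2 *: Rm (D 1) (D 0) (D 0) - eps1 ^+ 2 *: D 1.

(* Main.v *)
Require Import Defs.
From HB Require Import structures.
From mathcomp Require Import all_boot all_order all_algebra.
From mathcomp Require Import all_classical all_reals all_analysis.
From mathcomp Require Import ring lra.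

Set Implicit Arguments.
Unset Strict Implicit.
Unset Printing Implicit Defensive.

Import Order.TTheory GRing.Theory Num.Theory.
Import numFieldNormedType.Exports.

Local Open Scope classical_set_scope.
Local Open Scope ring_scope.

(** Everything is done in charts.  Near a time t0 the curve is a map x into an
open set of R^n, and x + s h, read in the chart, stays in the space of curves
when s is small and h is C^3, supported in a small interval I and smooth on I.
Hence the first variation of the energy vanishes.  Three integrations by parts, which use metric compatibility, the commutation
D_s D_t - D_t D_s = R(h, x') and the pair symmetry of the curvature, turn it
into the integral of <E, h>, where E is the difference of the two sides of the
equation, plus boundary terms at the corners of q.

Fields h supported in a smooth piece give E = 0 there.  At a corner tau only
the jump terms - <D_t h, [V_3]> + <h, [V_4]> remain, with V_k the k-th covariant
derivative of the velocity.  Prescribing h(tau) = 0 and D_t h(tau) arbitrary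
gives [V_3] = 0, then prescribing h(tau) gives [V_4] = 0, and the equation E = 0
on both sides gives [V_5] = 0.  So q is C^6 and solves the equation everywhere. *)

(** Adding [s *: h] to the coordinates avoids the exponential map, at the price of computing the
    covariant variations through Christoffel symbols. The integrand is expanded in [s] with a
    remainder quadratic in [s] and uniform in [t], which replaces differentiation under the integral
    sign. Pair symmetry is what frees [h]: commuting derivatives produces R(h, x') paired with
    derivatives of the velocity, whereas the equation needs curvature terms paired with [h].

    The equation takes six derivatives while q is only C^3 at its corners. So derivatives are
    relative to closed intervals, and each smooth piece has its own one-sided V_k. Continuity of
    V_0, ..., V_5 yields C^6 because x' = V_0 and V_k' = V_(k+1) - Gamma(x', V_k).

    Derivatives pass between intervals in two ways: they are unchanged on a relative neighbourhood,
    whether or not they exist, and those that exist restrict to any subinterval. The relation below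
    asserts existence and value together, since the [lim] in [derive_within] denotes something even
    when there is no limit. *)

Definition is_dw (R : realType) (V : normedModType R) (a b : R)
  (f : R -> V) (t : R) (l : V) : Prop :=
  diff_quot f t u @[u --> within `[a, b] t^'] --> l.

(** * One-sided calculus on a closed interval *)

Section Within.
Variable R : realType.
Implicit Types (V : normedModType R) (a b t : R).

(** Properness gives uniqueness of derivatives relative to [[a, b]]. A point of the interval close
    to [t] and distinct from it is found on the right of [t], or on the left when [t = b]. *)
Lemma within_dnbhs_proper a b t : a < b -> a <= t <= b ->
  ProperFilter (within `[a, b] t^').
Proof.
move=> ab /andP[at_ tb]; apply: Build_ProperFilter_ex.
- move=> P; rewrite /within/= => /nbhs_ballP[/= e e0 he].
  have [tb'|bt] := ltP t b.
  + exists (Num.min b (t + e/2)); apply: he => /=.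
    * rewrite /ball/= distrC ger0_norm ?subr_ge0 ?le_min ?tb ?lerDl ?divr_ge0 ?ltW//.
      by rewrite ltrBlDr gt_min (_ : t + e / 2 < e + t) ?orbT// addrC ltrD2r; lra.
    * by rewrite gt_eqF// lt_min tb' ltrDl divr_gt0.
    * rewrite in_itv/= ge_min lexx/= le_min (ltW ab)/= andbT.
      by rewrite (le_trans at_)// lerDl ltW// divr_gt0.
  + have eb : t = b by apply/le_anti; rewrite tb bt.
    subst b; exists (Num.max a (t - e/2)); apply: he => /=.
    * rewrite /ball/= ger0_norm ?subr_ge0 ?ge_max ?at_ ?gerBl ?divr_ge0 ?ltW//.
      by rewrite ltrBlDr -ltrBlDl lt_max (_ : t - e < t - e / 2) ?orbT//; lra.
    * by rewrite lt_eqF// gt_max ab gtrBl divr_gt0.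
    * by rewrite in_itv/= le_max lexx/= ge_max ltW//= gerBl ltW// divr_gt0.
Qed.

Lemma is_dw_unique V a b (f : R -> V) t l l' : a < b -> a <= t <= b ->
  is_dw a b f t l -> is_dw a b f t l' -> l = l'.
Proof.
move=> ab tab h h'; have := within_dnbhs_proper ab tab => ?.
by apply: (cvg_unique (@norm_hausdorff _ V) h h').
Qed.

Lemma is_dwE V a b (f : R -> V) t l : a < b -> a <= t <= b ->
  is_dw a b f t l -> derive_within a b f t = l.
Proof.
move=> ab tab h; have := within_dnbhs_proper ab tab => ?.
by apply: (cvg_lim (@norm_hausdorff _ V) h).
Qed.

Lemma is_dw_derivable V a b (f : R -> V) t l :
  is_dw a b f t l -> derivable_within a b f t.
Proof. by move=> h; apply/cvg_ex; exists l. Qed.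

Lemma is_dwP V a b (f : R -> V) t l : is_dw a b f t l <->
  forall e, 0 < e -> \forall u \near t, u \in `[a, b] -> u != t ->
    `|l - diff_quot f t u| <= e.
Proof.
split.
- move=> /cvgrPdist_le h e e0; have := h _ e0.
  rewrite /within /dnbhs/= !near_withinE => H.
  by apply: filterS H => u hu uab ut; apply: hu => //; exact/eqP.
- move=> h; apply/cvgrPdist_le => e e0; have := h _ e0.
  rewrite /within /dnbhs/= !near_withinE; apply: filterS => u hu ut uab; apply: hu => //; exact/eqP.
Unshelve. all: by end_near. Qed.

Lemma is_dw_cvg V a b (f : R -> V) t l : is_dw a b f t l ->
  f u @[u --> within `[a, b] (nbhs t)] --> f t.
Proof.
move=> /is_dwP /(_ 1 ltr01) h.
apply/cvgrPdist_le => e e0; rewrite near_withinE.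
have d0 : 0 < e / (`|l| + 1) by rewrite divr_gt0// ltr_wpDl.
near=> u => uab; have [->|ut] := eqVneq u t; first by rewrite subrr normr0 ltW.
have H0 : u \in `[a, b] -> u != t -> `|l - diff_quot f t u| <= 1 by near: u.
have H := H0 uab ut.
(* A quotient within 1 of its limit is bounded, so [f u - f t] is at most a constant times
   [u - t]. *)
have H1 : `|diff_quot f t u| <= `|l| + 1.
  by rewrite -[diff_quot _ _ _](subKr l) (le_trans (ler_normB _ _))// lerD2l.
have -> : f t - f u = - ((u - t) *: diff_quot f t u).
  by rewrite scalerA divff ?subr_eq0// scale1r opprB.
rewrite normrN normrZ.
have H2 : `|u - t| <= e / (`|l| + 1).
  by rewrite distrC; near: u; apply/nbhs_ballP; exists (e / (`|l| + 1)) => //= v /ltW.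
rewrite (le_trans (ler_pM _ _ H2 H1))//.
by rewrite divfK// gt_eqF// ltr_wpDl.
Unshelve. all: by end_near. Qed.

(** Containment and equality are asked only near [t], so a derivative can be carried to a larger
    interval as well as to a smaller one. *)
Lemma is_dw_local V a b a' b' (f g : R -> V) t l :
  a <= t <= b ->
  (\forall u \near t, u \in `[a, b] -> u \in `[a', b'] /\ f u = g u) ->
  is_dw a' b' f t l -> is_dw a b g t l.
Proof.
move=> tab h /is_dwP H; apply/is_dwP => e /H; apply: filterS2 (h) => u hu hf uab ut.
have [uab' fu] := hu uab.
have /nbhs_singleton/(_ _)[|_ ft] := h; first by rewrite in_itv.
by rewrite /diff_quot -fu -ft; exact: hf.
Qed.

Lemma is_dw_sub V a b a' b' (f : R -> V) t l : a <= a' -> b' <= b ->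
  is_dw a b f t l -> is_dw a' b' f t l.
Proof.
move=> aa bb /is_dwP H; apply/is_dwP => e /H; apply: filterS => u hu uab ut; apply: hu => //.
by move: uab; rewrite !in_itv/= => /andP[h1 h2]; rewrite (le_trans aa h1) (le_trans h2 bb).
Qed.

Lemma is_dw_eq V a b (f g : R -> V) t l : a <= t <= b ->
  {in `[a, b], f =1 g} -> is_dw a b f t l -> is_dw a b g t l.
Proof. by move=> tab h; apply: is_dw_local => //; near=> u => uab; rewrite h.
Unshelve. all: by end_near. Qed.

Lemma is_dwD V a b (f g : R -> V) t l m :
  is_dw a b f t l -> is_dw a b g t m -> is_dw a b (fun u => f u + g u) t (l + m).
Proof.
move=> h1 h2; rewrite /is_dw (@eq_cvg _ _ _ _ (diff_quot f t \+ diff_quot g t)).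
  exact: (cvgD h1 h2).
by move=> u; rewrite /= /diff_quot -scalerDr opprD addrACA.
Qed.

Lemma is_dwZ V a b (f : R -> V) t l (k : R) :
  is_dw a b f t l -> is_dw a b (fun u => k *: f u) t (k *: l).
Proof.
move=> h1; rewrite /is_dw (@eq_cvg _ _ _ _ (fun u => k *: diff_quot f t u)).
  exact: (cvgZl_tmp h1).
by move=> u; rewrite /= /diff_quot -scalerBr !scalerA mulrC.
Qed.

Lemma is_dwN V a b (f : R -> V) t l :
  is_dw a b f t l -> is_dw a b (fun u => - f u) t (- l).
Proof.
move=> h; rewrite -scaleN1r (_ : (fun u => - f u) = fun u => -1 *: f u).
  exact: is_dwZ.
by apply/funext => u; rewrite scaleN1r.
Qed.

Lemma is_dwB V a b (f g : R -> V) t l m :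
  is_dw a b f t l -> is_dw a b g t m -> is_dw a b (fun u => f u - g u) t (l - m).
Proof. by move=> h1 h2; apply: is_dwD => //; apply: is_dwN. Qed.

Lemma is_dw_cst V a b (v : V) t : is_dw a b (fun=> v) t 0.
Proof.
apply/is_dwP => e e0; near=> u => _ _.
by rewrite /diff_quot subrr scaler0 subr0 normr0 ltW.
Unshelve. all: by end_near. Qed.

Lemma is_dw_id a b t : is_dw a b (fun u : R => u : R^o) t 1.
Proof.
apply/is_dwP => e e0; near=> u => _ ut.
by rewrite /diff_quot -[_ *: _]/(_ * _) mulVf ?subr_eq0// subrr normr0 ltW.
Unshelve. all: by end_near. Qed.

Lemma is_dw_sum V a b (I : Type) (r : seq I) (P : pred I) (f : I -> R -> V) t l :
  (forall i, P i -> is_dw a b (f i) t (l i)) ->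
  is_dw a b (fun u => \sum_(i <- r | P i) f i u) t (\sum_(i <- r | P i) l i).
Proof.
move=> h; elim: r => [|i r IH].
  rewrite big_nil; under eq_fun do rewrite big_nil; exact: is_dw_cst.
rewrite big_cons; under eq_fun do rewrite big_cons.
by case: ifP => // Pi; apply: is_dwD => //; apply: h.
Qed.

Lemma is_dwM a b (f g : R -> R) t (l m : R) :
  is_dw a b (f : R -> R^o) t l -> is_dw a b (g : R -> R^o) t m ->
  is_dw a b (fun u => f u * g u : R^o) t (l * g t + f t * m).
Proof.
move=> h1 h2.
have c1 : f u @[u --> within `[a, b] t^'] --> f t.
  apply: cvg_trans (is_dw_cvg h1); apply: cvg_app => P.
  move=> H; rewrite /dnbhs; have : \forall u \near nbhs t, u \in `[a, b] -> P u by exact: H.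
  by apply: filterS => u hu _.
rewrite /is_dw (@eq_cvg _ _ _ _ ((fun u => diff_quot f t u * g t) \+
  (fun u => f u * diff_quot g t u))).
  exact: (cvgD (cvgM h1 (@cvg_cst _ (g t) _ _ _)) (cvgM c1 h2)).
move=> u; rewrite /= /diff_quot.
by rewrite -![_ *: _]/(_ * _) /=; ring.
Qed.

End Within.

(* Class C^k on [a, b], with one-sided derivatives at the endpoints; the
   derivatives are existentially quantified, so that k = 0 needs no a < b. *)
Fixpoint CkI (R : realType) (V : normedModType R) (a b : R) (k : nat)
    (f : R -> V) : Prop :=
  if k is k'.+1 then
    exists2 f', (forall t, a <= t <= b -> is_dw a b f t (f' t)) & CkI a b k' f'
  else forall t, a <= t <= b -> f u @[u --> within `[a, b] (nbhs t)] --> f t.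

Section CkI.
Variable R : realType.
Implicit Types (V : normedModType R) (a b t : R).

Lemma CkI_cont V a b k (f : R -> V) t : CkI a b k f -> a <= t <= b ->
  f u @[u --> within `[a, b] (nbhs t)] --> f t.
Proof. by case: k => [|k] /= => [|[f' h _] tab]; [exact|exact: is_dw_cvg (h _ tab)]. Qed.

Lemma CkI_le V a b k l (f : R -> V) : (k <= l)%N -> CkI a b l f -> CkI a b k f.
Proof.
elim: l k f => [|l IH] [|k] f //= kl.
  by move=> [f' h _] t tab; exact: is_dw_cvg (h _ tab).
by move=> [f' h hk]; exists f' => //; apply: IH.
Qed.

Lemma CkI_sub V a b a' b' k (f : R -> V) : a <= a' -> b' <= b ->
  CkI a b k f -> CkI a' b' k f.
Proof.
move=> aa bb.
have sub t : a' <= t <= b' -> a <= t <= b.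
  by move=> /andP[h1 h2]; rewrite (le_trans aa h1) (le_trans h2 bb).
elim: k f => [|k IH] f /=.
  move=> h t tab; apply: cvg_trans (h _ (sub _ tab)); apply: cvg_app => P H.
  have {H} : \forall u \near nbhs t, u \in `[a, b] -> P u by exact: H.
  by apply: filterS => u + uab; apply; move: uab; rewrite /= !in_itv/= => /sub.
by move=> [f' h hk]; exists f'; [move=> t /sub/h; exact: is_dw_sub|exact: IH].
Qed.

Lemma CkI_eq V a b k (f g : R -> V) : (forall t, a <= t <= b -> f t = g t) ->
  CkI a b k f -> CkI a b k g.
Proof.
move=> fg; case: k => [|k] /=.
  move=> h t tab; rewrite -fg//; apply: cvg_trans (h _ tab) => P H.
  have {}H : \forall u \near nbhs t, u \in `[a, b] -> P (f u) by exact: H.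
  suff : \forall u \near nbhs t, u \in `[a, b] -> P (g u) by [].
  apply: filterS H => u Hu uab; rewrite -fg; first exact: Hu.
  by move: uab; rewrite in_itv.
by move=> [f' h hk]; exists f' => // t tab; apply: is_dw_eq (h _ tab).
Qed.

Lemma CkI_cst V a b k (v : V) : CkI a b k (fun=> v).
Proof.
elim: k v => [|k IH] v /=; first by move=> t _; exact: cvg_cst.
by exists (fun=> 0) => // t _; exact: is_dw_cst.
Qed.

Lemma CkI_id a b k : CkI a b k (fun u : R => u : R^o).
Proof.
case: k => [|k] /=.
  by move=> t _; apply: cvg_within_filter; exact: cvg_id.
by exists (fun=> 1) => [t _|]; [exact: is_dw_id|exact: CkI_cst].
Qed.

Lemma CkID V a b k (f g : R -> V) : CkI a b k f -> CkI a b k g ->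
  CkI a b k (fun u => f u + g u).
Proof.
elim: k f g => [|k IH] f g /=.
  by move=> h1 h2 t tab; apply: cvgD; [exact: h1|exact: h2].
move=> [f' f1 f2] [g' g1 g2]; exists (fun u => f' u + g' u); last exact: IH.
by move=> t tab; apply: is_dwD; [exact: f1|exact: g1].
Qed.

Lemma CkIZ V a b k (c : R) (f : R -> V) : CkI a b k f ->
  CkI a b k (fun u => c *: f u).
Proof.
elim: k f => [|k IH] f /=.
  by move=> h1 t tab; apply: cvgZl_tmp; exact: h1.
move=> [f' f1 f2]; exists (fun u => c *: f' u); last exact: IH.
by move=> t tab; apply: is_dwZ; exact: f1.
Qed.

Lemma CkIB V a b k (f g : R -> V) : CkI a b k f -> CkI a b k g ->
  CkI a b k (fun u => f u - g u).
Proof.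
move=> hf hg; have := CkID hf (CkIZ (-1) hg); apply: CkI_eq => t _.
by rewrite scaleN1r.
Qed.

Lemma CkI_sum V a b k (I : Type) (r : seq I) (P : pred I) (f : I -> R -> V) :
  (forall i, P i -> CkI a b k (f i)) ->
  CkI a b k (fun u => \sum_(i <- r | P i) f i u).
Proof.
move=> h; elim: r => [|i r IH].
  by under eq_fun do rewrite big_nil; exact: CkI_cst.
under eq_fun do rewrite big_cons.
by case Pi : (P i) => //; apply: CkID => //; apply: h.
Qed.

Lemma CkIM a b k (f g : R -> R) : CkI a b k (f : R -> R^o) ->
  CkI a b k (g : R -> R^o) -> CkI a b k (fun u => f u * g u : R^o).
Proof.
elim: k f g => [|k IH] f g /=.
  by move=> h1 h2 t tab; apply: cvgM; [exact: h1|exact: h2].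
move=> [f' f1 f2] [g' g1 g2]; exists (fun u => f' u * g u + f u * g' u).
  by move=> t tab; apply: is_dwM; [exact: f1|exact: g1].
have hf : CkI a b k.+1 (f : R -> R^o) by exists f'.
have hg : CkI a b k.+1 (g : R -> R^o) by exists g'.
apply: (@CkID R^o); apply: IH => //.
  exact: CkI_le hg.
exact: CkI_le hf.
Qed.

Lemma cvg_sumr (T I : Type) (F : set_system T) (FF : Filter F) (r : seq I) (P : pred I)
    (f : I -> T -> R) (l : I -> R) :
  (forall i, P i -> f i u @[u --> F] --> l i) ->
  \sum_(i <- r | P i) f i u @[u --> F] --> \sum_(i <- r | P i) l i.
Proof.
move=> h; elim: r => [|i r IH].
  by rewrite big_nil; under eq_fun do rewrite big_nil; exact: cvg_cst.
rewrite big_cons; under eq_fun do rewrite big_cons.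
by case Pi : (P i) => //; apply: cvgD => //; apply: h.
Qed.

Lemma cvg_rVP (T : Type) (F : set_system T) (FF : Filter F) n
    (f : T -> 'rV[R]_n) (l : 'rV[R]_n) :
  f u @[u --> F] --> l <-> forall k, (f u 0 k : R^o) @[u --> F] --> (l 0 k : R^o).
Proof.
split=> [h k|h].
  have := @coord_continuous R^o 1 n 0 k l.
  exact: (cvg_comp _ _ h).
apply/cvgrPdist_le => e e0.
have H : \forall u \near F, forall k, `|l 0 k - f u 0 k| <= e.
  apply: filter_forall => k; have /cvgrPdist_le := h k; exact.
apply: filterS H => u hu.
rewrite /Num.Def.normr/= mx_normrE (bigmax_le _ (ltW e0))//= => -[i j] _ /=.
rewrite (ord1 i); have := hu j; by rewrite !mxE.
Qed.

Lemma is_dw_rVP n a b (f : R -> 'rV[R]_n) t l : is_dw a b f t l <->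
  forall k, is_dw a b (fun u => f u 0 k : R^o) t (l 0 k).
Proof.
have E k : (fun u => diff_quot f t u 0 k : R^o) = diff_quot (fun u => f u 0 k : R^o) t.
  by apply/funext => u; rewrite /diff_quot !mxE.
rewrite /is_dw cvg_rVP; split=> h k; have := h k; last by rewrite -E.
by rewrite -[X in _ -> X @ _ --> _]E.
Qed.

Lemma CkI_rVP n a b k (f : R -> 'rV[R]_n) : CkI a b k f <->
  forall j, CkI a b k (fun u => f u 0 j : R^o).
Proof.
elim: k f => [|k IH] f /=; split.
- by move=> h j t tab; have /cvg_rVP := h _ tab; exact.
- by move=> h t tab; apply/cvg_rVP => j; exact: h.
- move=> [f' h hk] j; exists (fun u => f' u 0 j); last by move/IH: hk; exact.
  by move=> t tab; have /is_dw_rVP := h _ tab; exact.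
(* Each coordinate comes with its own existential derivative; these are chosen and assembled into a
   row. *)
- move=> h; pose f' t : 'rV[R]_n := \row_j (sval (cid2 (h j)) t).
  exists f' => [t tab|].
    apply/is_dw_rVP => j; rewrite mxE; case: cid2 => /= g g1 g2; exact: g1.
  apply/IH => j; under eq_fun do rewrite mxE; case: cid2 => /= g g1 g2; exact: g2.
Qed.

(** The two image filters are equal, hence so are their [lim], even when the derivative does not
    exist. *)
Lemma derive_within_local V a b a' b' (f g : R -> V) t : a <= a' -> b' <= b ->
  a <= t <= b ->
  (\forall u \near t, a <= u <= b -> a' <= u <= b' /\ f u = g u) ->
  derive_within a b f t = derive_within a' b' g t.
Proof.
move=> aa bb tab h; rewrite /derive_within; congr (lim _).
have ft : f t = g t by have /nbhs_singleton/(_ tab)[] := h.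
rewrite eqEsubset; split => P H.
- have {H} : \forall u \near t, u != t -> u \in `[a, b] -> P (diff_quot f t u) by exact: H.
  move=> H; suff : \forall u \near t, u != t -> u \in `[a', b'] -> P (diff_quot g t u) by [].
  apply: filterS2 h H => u h1 h2 ut; rewrite in_itv/= => /andP[u1 u2].
  have uab : a <= u <= b by rewrite (le_trans aa u1) (le_trans u2 bb).
  by have [_ fu] := h1 uab; rewrite /diff_quot -fu -ft; apply: h2; rewrite ?in_itv.
- have {H} : \forall u \near t, u != t -> u \in `[a', b'] -> P (diff_quot g t u) by exact: H.
  move=> H; suff : \forall u \near t, u != t -> u \in `[a, b] -> P (diff_quot f t u) by [].
  apply: filterS2 h H => u h1 h2 ut; rewrite in_itv/= => uab.
  by have [u' fu] := h1 uab; rewrite /diff_quot fu ft; apply: h2; rewrite ?in_itv.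
Qed.

Lemma derive_within_eq V a b (f g : R -> V) t : a <= t <= b ->
  (forall u, a <= u <= b -> f u = g u) ->
  derive_within a b f t = derive_within a b g t.
Proof.
by move=> tab fg; apply: derive_within_local => //; near=> u => uab; split=> //; exact: fg.
Unshelve. all: by end_near. Qed.

Lemma iter_derive_within_eq V a b (f g : R -> V) j t : a <= t <= b ->
  (forall u, a <= u <= b -> f u = g u) ->
  iter j (derive_within a b) f t = iter j (derive_within a b) g t.
Proof.
move=> + fg; elim: j t => [|j IH] t tab /=; first exact: fg.
exact: derive_within_eq.
Qed.

Lemma CkI_derive V a b k (f : R -> V) : a < b -> CkI a b k.+1 f ->
  (forall t, a <= t <= b -> is_dw a b f t (derive_within a b f t)) /\
  CkI a b k (derive_within a b f).
Proof.
move=> ab [f' h hk]; have E t : a <= t <= b -> f' t = derive_within a b f t.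
  by move=> tab; rewrite (is_dwE ab tab (h _ tab)).
by split=> [t tab|]; [rewrite -E//; exact: h|exact: CkI_eq hk].
Qed.

Lemma CkI_iter V a b k j (f : R -> V) : a < b -> CkI a b (j + k) f ->
  CkI a b k (iter j (derive_within a b) f).
Proof.
move=> ab; elim: j k => [//|j IH] k; rewrite addSnnS => /IH/=.
by move=> /(CkI_derive ab)[].
Qed.

Lemma CkI_iter_dw V a b k j (f : R -> V) t : a < b -> CkI a b k f -> (j < k)%N ->
  a <= t <= b ->
  is_dw a b (iter j (derive_within a b) f) t (iter j.+1 (derive_within a b) f t).
Proof.
move=> ab h jk tab; have : CkI a b (j + (k - j)) f by rewrite subnKC// ltnW.
move=> /(CkI_iter ab); rewrite -(@prednK (k - j)) ?subn_gt0// => /(CkI_derive ab)[].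
by move=> H _; exact: H.
Qed.

(** Here [t] may be an end of the smaller interval and interior to the larger one. Existence of the
    derivatives on [[a, b]] is what makes the one-sided ones agree with them. *)
Lemma CkI_derive_sub V a b a' b' (f : R -> V) t j k : CkI a b k f -> a < b -> a' < b' ->
  a <= a' -> b' <= b -> (j <= k)%N -> a' <= t <= b' ->
  iter j (derive_within a' b') f t = iter j (derive_within a b) f t.
Proof.
move=> h ab ab' aa bb; have sub u : a' <= u <= b' -> a <= u <= b.
  by move=> /andP[h1 h2]; rewrite (le_trans aa h1) (le_trans h2 bb).
elim: j t => [//|j IH] t jk tab /=.
rewrite (@derive_within_eq _ _ _ _ (iter j (derive_within a b) f))//; last first.
  by move=> u; apply: IH; exact: ltnW.
by apply: is_dwE => //; apply: (is_dw_sub aa bb); apply: CkI_iter_dw jk _ => //; exact: sub.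
Qed.

(** Bridge from [Ck_curve], where regularity is known only at the times of [[a, b]] whose points lie
    in the chart, to [CkI] on a subinterval spent inside the chart. *)
Lemma CkI_of_derivable V a b a' b' k (f : R -> V) : a <= a' -> b' <= b ->
  (forall u j, a' <= u <= b' -> (j < k)%N ->
     derivable_within a b (iter j (derive_within a b) f) u) ->
  (forall u j, a' <= u <= b' -> (j <= k)%N ->
     iter j (derive_within a b) f v @[v --> within `[a, b] (nbhs u)] -->
     iter j (derive_within a b) f u) -> CkI a' b' k f.
Proof.
move=> aa bb; elim: k f => [|k IH] f h1 h2 /=.
  move=> t tab; apply: cvg_trans (h2 _ 0 tab isT); apply: cvg_app => P H.
  have {H} : \forall u \near nbhs t, u \in `[a, b] -> P u by exact: H.
  apply: filterS => u + uab; apply; move: uab; rewrite /= !in_itv/= => /andP[u1 u2].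
  by rewrite (le_trans aa u1) (le_trans u2 bb).
exists (derive_within a b f).
  by move=> t tab; apply: (is_dw_sub aa bb); exact: (h1 _ 0).
by apply: IH => u j uab jk; rewrite -iterSr; [exact: h1|exact: h2].
Qed.

(* [a', b'] is a neighbourhood of t relative to [a, b]. *)
Definition rnb a b a' b' t := [/\ a <= a', b' <= b, a' < b', a' <= t <= b' &
  \forall u \near t, a <= u <= b -> a' <= u <= b'].

Lemma rnb_in a b a' b' t : rnb a b a' b' t -> a <= t <= b.
Proof. by case=> aa bb _ /andP[h1 h2] _; rewrite (le_trans aa h1) (le_trans h2 bb). Qed.

Lemma rnb_near a b a' b' t : rnb a b a' b' t ->
  \forall u \near t, a <= u <= b -> rnb a b a' b' u.
Proof.
case=> aa bb ab' tab /near_join h; near=> u => uab.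
by split=> //; [apply: (nbhs_singleton (near h u _)) => //|]; near: u.
Unshelve. all: by end_near. Qed.

Lemma rnb_ex a b t (P : R -> Prop) : a < b -> a <= t <= b ->
  (\forall u \near t, a <= u <= b -> P u) ->
  exists a' b', rnb a b a' b' t /\ (forall u, a' <= u <= b' -> P u).
Proof.
move=> ab /andP[at_ tb] /nbhs_ballP[e /= e0 he].
have e2 : 0 < e / 2 by lra.
exists (Num.max a (t - e / 2)), (Num.min b (t + e / 2)); split.
  split.
  - by rewrite le_max lexx.
  - by rewrite ge_min lexx.
  - by rewrite gt_max !lt_min ab/=; apply/andP; split; [|apply/andP; split]; lra.
  - by rewrite ge_max at_/= le_min tb; lra.
  - apply/nbhs_ballP; exists (e / 2) => //= u; rewrite /ball/= ltr_norml => /andP[h1 h2].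
    by move=> /andP[u1 u2]; rewrite ge_max le_min u1 u2/=; lra.
move=> u; rewrite ge_max le_min => /andP[/andP[u1 u2] /andP[u3 u4]]; apply: he.
  by rewrite /ball/= ltr_norml; lra.
by rewrite u1.
Qed.

(** [rnb] persists at all points of [[a, b]] near [t], so the lower iterates agree near [t] and not
    just at [t], as the next derivative requires. *)
Lemma iter_derive_rnb V a b a' b' (f : R -> V) t j : rnb a b a' b' t ->
  iter j (derive_within a b) f t = iter j (derive_within a' b') f t.
Proof.
elim: j t => [//|j IH] t h /=; have [aa bb ab' tab near_t] := h.
apply: derive_within_local => //; first exact: rnb_in h.
have := rnb_near h; apply: filterS => u H uab; split; last by exact: IH (H uab).
by case: (H uab).
Qed.

Lemma is_dw_rnb V a b a' b' (f : R -> V) t l : rnb a b a' b' t ->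
  is_dw a' b' f t l -> is_dw a b f t l.
Proof.
move=> h; have [aa bb ab' tab near_t] := h; apply: is_dw_local; first exact: rnb_in h.
by apply: filterS near_t => u; rewrite !in_itv/= => H /H.
Qed.

Lemma CkI_rnb V a b a' b' (f : R -> V) t k : rnb a b a' b' t -> CkI a' b' k f ->
  (forall j, (j < k)%N -> derivable_within a b (iter j (derive_within a b) f) t) /\
  (forall j, (j <= k)%N ->
     iter j (derive_within a b) f v @[v --> within `[a, b] (nbhs t)] -->
     iter j (derive_within a b) f t).
Proof.
move=> h hk; have [aa bb ab' tab near_t] := h; split=> j jk.
  apply: (is_dw_derivable (l := iter j.+1 (derive_within a' b') f t)).
  apply: is_dw_local (CkI_iter_dw ab' hk jk tab); first exact: rnb_in h.
  have := rnb_near h; apply: filterS => u H; rewrite !in_itv/= => uab; split.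
    by case: (H uab).
  by apply/esym/iter_derive_rnb; exact: H.
rewrite (iter_derive_rnb _ _ h).
have hc : CkI a' b' 0 (iter j (derive_within a' b') f).
  by apply: CkI_iter => //; rewrite addn0; exact: CkI_le hk.
apply: cvg_trans (CkI_cont hc tab) => P H.
have {H} H : \forall u \near nbhs t, u \in `[a', b'] ->
  P (iter j (derive_within a' b') f u) by exact: H.
suff : \forall u \near nbhs t, u \in `[a, b] ->
  P (iter j (derive_within a b) f u) by [].
have := rnb_near h; apply: filterS2 H => u H1 H2; rewrite in_itv/= => uab.
rewrite (iter_derive_rnb _ _ (H2 uab)); apply: H1; rewrite in_itv/=.
by case: (H2 uab).
Qed.

Lemma is_dw_glue V a m b (f : R -> V) l : a < m -> m < b ->
  is_dw a m f m l -> is_dw m b f m l -> is_dw a b f m l.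
Proof.
move=> am mb /is_dwP h1 /is_dwP h2; apply/is_dwP => e e0.
have H1 := h1 _ e0; have H2 := h2 _ e0; apply: filterS2 H1 H2 => u H1 H2.
rewrite in_itv/= => /andP[u1 u2]; have [um|um] := leP u m.
  by apply: H1; rewrite in_itv/= u1.
by apply: H2; rewrite in_itv/= u2 ltW.
Qed.

(** The derivative is pieced together from the two sides, unambiguously at [m] by the case [j = 1]
    of the matching hypothesis; the remaining cases are the matching hypothesis of that
    derivative. *)
Lemma CkI_glue V a m b k (f : R -> V) : a < m -> m < b ->
  CkI a m k f -> CkI m b k f ->
  (forall j, (j <= k)%N ->
    iter j (derive_within a m) f m = iter j (derive_within m b) f m) ->
  CkI a b k f.
Proof.
move=> am mb; have ab := lt_trans am mb; elim: k f => [|k IH] f.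
  move=> /= h1 h2 _ t /andP[t1 t2]; have [tm|mt|tm] := ltgtP t m.
  - apply: cvg_trans (h1 t _) => [P H|]; last by rewrite t1 ltW.
    have {H} H : \forall u \near nbhs t, u \in `[a, m] -> P (f u) by exact: H.
    suff : \forall u \near nbhs t, u \in `[a, b] -> P (f u) by [].
    have : \forall u \near t, u < m by exact: lt_nbhsl.
    apply: filterS2 H => u H um; rewrite in_itv/= => /andP[u1 u2].
    by apply: H; rewrite in_itv/= u1 ltW.
  - apply: cvg_trans (h2 t _) => [P H|]; last by rewrite t2 ltW.
    have {H} H : \forall u \near nbhs t, u \in `[m, b] -> P (f u) by exact: H.
    suff : \forall u \near nbhs t, u \in `[a, b] -> P (f u) by [].
    have : \forall u \near t, m < u by exact: lt_nbhsr.
    apply: filterS2 H => u H um; rewrite in_itv/= => /andP[u1 u2].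
    by apply: H; rewrite in_itv/= u2 ltW.
  - subst t => P HP.
    have H1 : \forall u \near nbhs m, u \in `[a, m] -> P (f u).
      by apply: (h1 m) => //; rewrite lexx ltW.
    have H2 : \forall u \near nbhs m, u \in `[m, b] -> P (f u).
      by apply: (h2 m) => //; rewrite lexx ltW.
    suff : \forall u \near nbhs m, u \in `[a, b] -> P (f u) by [].
    apply: filterS2 H1 H2 => u H1 H2; rewrite in_itv/= => /andP[u1 u2].
    have [um|um] := leP u m; first by apply: H1; rewrite in_itv/= u1.
    by apply: H2; rewrite in_itv/= u2 ltW.
move=> h1 h2 hm; have [d1 c1] := CkI_derive am h1; have [d2 c2] := CkI_derive mb h2.
pose f' t := if t <= m then derive_within a m f t else derive_within m b f t.
have mE := hm 1 isT; rewrite /= in mE.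
have e1 u : a <= u <= m -> derive_within a m f u = f' u.
  by move=> /andP[_ um]; rewrite /f' um.
have e2 u : m <= u <= b -> derive_within m b f u = f' u.
  move=> /andP[um _]; rewrite /f'; case: leP => // um'.
  by have -> : u = m by apply/le_anti; rewrite um um'.
exists f'.
  move=> t /andP[t1 t2]; have [tm|mt|tm] := ltgtP t m.
  - apply: (@is_dw_rnb _ _ _ a m).
      split=> //; [exact: ltW|by rewrite t1 ltW|].
      have : \forall u \near t, u < m by exact: lt_nbhsl.
      by apply: filterS => u um /andP[-> _]; rewrite ltW.
    have tam : a <= t <= m by rewrite t1 ltW.
    by rewrite -e1//; exact: d1.
  - apply: (@is_dw_rnb _ _ _ m b).
      split=> //; [exact: ltW|by rewrite t2 ltW|].
      have : \forall u \near t, m < u by exact: lt_nbhsr.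
      by apply: filterS => u um /andP[_ ->]; rewrite ltW.
    have tam : m <= t <= b by rewrite t2 ltW.
    by rewrite -e2//; exact: d2.
  - subst t; apply: is_dw_glue => //.
      by rewrite -e1 ?lexx ?ltW//; apply: d1; rewrite lexx ltW.
    by rewrite -e2 ?lexx ?ltW//; apply: d2; rewrite lexx ltW.
apply: IH.
- exact: CkI_eq e1 c1.
- exact: CkI_eq e2 c2.
- move=> j jk.
  have E1 : iter j (derive_within a m) (derive_within a m f) m =
            iter j (derive_within a m) f' m.
    by apply: iter_derive_within_eq e1; rewrite lexx ltW.
  have E2 : iter j (derive_within m b) (derive_within m b f) m =
            iter j (derive_within m b) f' m.
    by apply: iter_derive_within_eq e2; rewrite lexx ltW.
  by rewrite -E1 -E2 -!iterSr; exact: hm.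
Qed.

End CkI.

(** * Functions of several variables *)

Section Multivariate.
Variable R : realType.

Lemma rV_norm_le n (v : 'rV[R]_n) e : 0 <= e -> (forall j, `|v 0 j| <= e) -> `|v| <= e.
Proof.
move=> e0 h; rewrite /Num.Def.normr/= mx_normrE (bigmax_le _ e0)//= => -[i j] _ /=.
by rewrite (ord1 i).
Qed.

Lemma coord_le_norm n (v : 'rV[R]_n) j : `|v 0 j| <= `|v|.
Proof.
rewrite [leRHS]/Num.Def.normr/= mx_normrE.
exact: (le_bigmax _ (fun ij : 'I_1 * 'I_n => `|v ij.1 ij.2|) (0, j)).
Qed.

Lemma derive_lineE (V W : normedModType R) (f : V -> W) (p v : V) (s : R) :
  (fun h : R => h^-1 *: ((f \o shift (p + s *: v)) (h *: v) - f (p + s *: v))) =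
  (fun h : R => h^-1 *: (((fun t : R => f (p + t *: v)) \o shift s) (h *: (1:R)) -
     f (p + s *: v))).
Proof.
apply/funext => h /=; congr (_ *: (f _ - _)).
by rewrite scalerDl [h *: 1]mulr1 addrCA.
Qed.

Lemma is_derive_line (V W : normedModType R) (f : V -> W) (p v : V) (s : R) :
  derivable f (p + s *: v) v ->
  is_derive s (1:R) (fun t : R => f (p + t *: v)) ('D_v f (p + s *: v)).
Proof.
move=> h; split; first by move: h; rewrite /derivable derive_lineE.
by rewrite /derive derive_lineE.
Qed.

Lemma line_is_derive (V W : normedModType R) (f : V -> W) (p v : V) l :
  is_derive 0 (1:R) (fun t : R => f (p + t *: v)) l -> is_derive p v f l.
Proof.
case=> h1 h2; have := derive_lineE f p v 0; rewrite scale0r addr0 => E.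
split; first by rewrite /derivable E; move: h1; rewrite /derivable scale0r addr0.
by rewrite /derive E; move: h2; rewrite /derive scale0r addr0.
Qed.

(** Derivability is known in the single direction [v], so homogeneity comes from the one-variable
    chain rule along the line through [p]. *)
Lemma is_deriveZdir (V : normedModType R) (f : V -> R^o) (p v : V) (c : R) :
  derivable f p v -> is_derive p (c *: v) f (c * 'D_v f p).
Proof.
move=> h; apply: line_is_derive.
have h' : derivable f (p + 0 *: v) v by rewrite scale0r addr0.
have := is_derive_line h'; rewrite scale0r addr0 => H.
pose F : R -> R := fun t => f (p + t *: v).
have -> : (fun t : R => f (p + t *: (c *: v))) = F \o (fun t : R => c * t).
  by apply/funext => t /=; rewrite /F scalerA mulrC.
have H2 : is_derive (0:R) (1:R) (fun t : R => c * t) c.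
  by apply: is_derive_eq; rewrite [_ *: _]mulr1.
have H' : is_derive (c * 0) (1:R) F ('D_v f p) by rewrite mulr0.
by rewrite mulrC; exact: (@is_derive1_comp R F (fun t : R => c * t)).
Qed.

Lemma MVT_line (V : normedModType R) (f : V -> R^o) (p v : V) :
  (forall s : R, 0 <= s <= 1 -> derivable f (p + s *: v) v) ->
  exists2 s : R, 0 <= s <= 1 & f (p + v) - f p = 'D_v f (p + s *: v).
Proof.
move=> h; pose F := fun t : R => f (p + t *: v) : R.
have hd (s : R) : 0 <= s <= 1 -> is_derive s (1:R) F ('D_v f (p + s *: v)).
  by move=> s01; apply: is_derive_line; exact: h.
have := @MVT_segment R F (fun s => 'D_v f (p + s *: v)) 0 1 ler01.
case.
- move=> s; rewrite in_itv/= => /andP[s0 s1]; apply: hd; by rewrite !ltW.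
- apply: derivable_within_continuous => s; rewrite in_itv/= => s01.
  by have [] := hd _ s01.
- move=> s; rewrite in_itv/= => s01; rewrite subr0 mulr1 /F scale1r scale0r addr0 => E.
  by exists s.
Qed.

Lemma smooth_cvg (V W : normedModType R) (U : set V) (f : V -> W) x :
  smooth_on U f -> U x -> {for x, continuous f}.
Proof. by move=> /(_ 0) [h _]; exact: h. Qed.

Lemma smooth_derivable (V W : normedModType R) (U : set V) (f : V -> W) x v :
  smooth_on U f -> U x -> derivable f x v.
Proof. by move=> /(_ 1) [_ /(_ v)[h _]]; exact: h. Qed.

Lemma smooth_derive (V W : normedModType R) (U : set V) (f : V -> W) v :
  smooth_on U f -> smooth_on U ('D_v f).
Proof. by move=> h k; have [_ /(_ v)[_]] := h k.+1. Qed.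

Lemma hadamard n (U : set 'rV[R]_n) (f : 'rV[R]_n -> R^o) x :
  open U -> smooth_on U f -> U x ->
  exists2 r : 'I_n -> 'rV[R]_n -> R,
    (forall k, r k y @[y --> x] --> 'D_(delta_mx 0 k) f x) &
    \forall y \near x, f y - f x = \sum_k (y 0 k - x 0 k) * r k y.
Proof.
move=> oU hf Ux.
have /nbhs_ballP[d /= d0 hd] : nbhs x U by apply: open_nbhs_nbhs.
have H (k : 'I_n) (y : 'rV[R]_n) : exists z : 'rV[R]_n, `|y - x| < d -> `|z - x| <= `|y - x| /\
    f (\row_j (if (j < k.+1)%N then y 0 j else x 0 j)) -
    f (\row_j (if (j < k)%N then y 0 j else x 0 j)) =
    (y 0 k - x 0 k) * 'D_(delta_mx 0 k) f z.
  (* Far from [x] nothing is claimed of the intermediate point, and [0] is a default. *)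
  have [yx|] := boolP (`|y - x| < d); last by exists 0.
  pose z : 'rV[R]_n := \row_j (if (j < k)%N then y 0 j else x 0 j).
  (* The norm is the supremum norm, and each coordinate of the intermediate point lies between those
     of [x] and [y]. *)
  have near_x (s : R) : 0 <= s <= 1 ->
      `|z + s *: ((y 0 k - x 0 k) *: delta_mx 0 k) - x| <= `|y - x|.
    move=> /andP[s0 s1]; apply: rV_norm_le => // j; rewrite !mxE.
    have [->|jk] := eqVneq j k.
      rewrite ltnn eqxx/= mulr1 addrAC subrr add0r normrM ger0_norm//.
      rewrite -[leRHS]mul1r ler_pM//.
      by have := coord_le_norm (y - x) k; rewrite !mxE.
    rewrite andbF !mulr0 addr0; case: ifP => _; last by rewrite subrr normr0.
    by have := coord_le_norm (y - x) j; rewrite !mxE.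
  have inU (s : R) : 0 <= s <= 1 -> U (z + s *: ((y 0 k - x 0 k) *: delta_mx 0 k)).
    move=> s01; apply: hd; rewrite -ball_normE /ball_/= distrC.
    by rewrite (le_lt_trans (near_x _ s01)).
  have hD (s : R) : 0 <= s <= 1 ->
      is_derive (z + s *: ((y 0 k - x 0 k) *: delta_mx 0 k))
      ((y 0 k - x 0 k) *: delta_mx 0 k) f
      ((y 0 k - x 0 k) * 'D_(delta_mx 0 k) f
        (z + s *: ((y 0 k - x 0 k) *: delta_mx 0 k))).
    by move=> s01; apply: is_deriveZdir; apply: smooth_derivable hf _; exact: inU.
  have [s s01 E] : exists2 s : R, 0 <= s <= 1 &
      f (z + (y 0 k - x 0 k) *: delta_mx 0 k) - f z =
      'D_((y 0 k - x 0 k) *: delta_mx 0 k) f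
        (z + s *: ((y 0 k - x 0 k) *: delta_mx 0 k)).
    by apply: MVT_line => s /hD[].
  exists (z + s *: ((y 0 k - x 0 k) *: delta_mx 0 k)) => _; split; first exact: near_x.
  have [_ <-] := hD _ s01; rewrite -E; congr (f _ - _).
  apply/rowP => j; rewrite !mxE ltnS leq_eqVlt.
  have [jk|jk] := eqVneq j k.
    by rewrite jk eqxx ltnn mulr1 addrC subrK.
  by rewrite (_ : (j == k :> nat) = false) ?andbF ?mulr0 ?addr0//; apply/eqP/eqP; rewrite -val_eqE in jk.
pose z (k : 'I_n) (y : 'rV[R]_n) := sval (cid (H k y)).
have zP k y : `|y - x| < d -> `|z k y - x| <= `|y - x| /\ _ := svalP (cid (H k y)).
exists (fun k y => 'D_(delta_mx 0 k) f (z k y)).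
  move=> k.
  have zx : z k y @[y --> x] --> x.
    move=> P /nbhs_ballP[e /= e0 hP]; suff : nbhs x [set y | P (z k y)] by [].
    apply/nbhs_ballP; exists (Num.min d e); first by rewrite /= lt_min d0.
    move=> y; rewrite -ball_normE /ball_/= lt_min ![`|x - _|]distrC => /andP[yd ye].
    apply: hP; rewrite -ball_normE /ball_/= distrC.
    by have [+ _] := zP k y yd; move=> /le_lt_trans; apply.
  have hk := smooth_cvg (smooth_derive (delta_mx 0 k) hf) Ux.
  exact: (cvg_comp _ _ zx hk).
apply/nbhs_ballP; exists d => //= y; rewrite -ball_normE /ball_/= distrC => yd.
(* [w k] is the value at the point with the first [k] coordinates of [y] and the others of [x], so
   its increments telescope from [f x] to [f y]. *)
pose w (k : nat) := f (\row_j (if (j < k)%N then y 0 j else x 0 j)).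
have -> : f y = w n.
  by rewrite /w; congr f; apply/rowP => j; rewrite !mxE ltn_ord.
have -> : f x = w 0.
  by rewrite /w; congr f; apply/rowP => j; rewrite !mxE.
rewrite -(telescope_sumr w (leq0n n)) big_mkord; apply: eq_bigr => k _.
by have [_] := zP k y yd.
Qed.

Lemma is_dw_is_derive (W : normedModType R) a b (f : R -> W) t l : a < t < b ->
  is_dw a b f t l <-> is_derive t (1:R) f l.
Proof.
move=> /andP[at_ tb].
have E : (is_dw a b f t l) <-> (h^-1 *: ((f \o shift t) (h *: (1:R)) - f t) @[h --> (0:R)^'] --> l).
  split.
  - move=> /is_dwP H; apply/cvgrPdist_le => e e0; have {H} := H _ e0.
    move=> /nbhs_ballP[d /= d0 hd].
    have : \forall u \near t, a < u < b.
      by near=> u; apply/andP; split; near: u; [exact: lt_nbhsr|exact: lt_nbhsl].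
    move=> /nbhs_ballP[d' /= d'0 hd'].
    apply/nbhs_ballP; exists (Num.min d d') => /=; first by rewrite lt_min d0.
    move=> h; rewrite /ball/= sub0r normrN lt_min => /andP[h1 h2] h0.
    have := hd (h + t); have := hd' (h + t).
    rewrite /ball/= opprD addrCA subrr addr0 normrN => /(_ h2)/andP[u1 u2] /(_ h1) H.
    have tab : h + t \in `[a, b] by rewrite in_itv/= !ltW.
    have ht : h + t != t by rewrite -subr_eq0 addrK.
    by have := H tab ht; rewrite /diff_quot addrK [h *: 1]mulr1.
  - move=> /cvgrPdist_le H; apply/is_dwP => e e0; have {H} := H _ e0.
    move=> /nbhs_ballP[d /= d0 hd]; apply/nbhs_ballP; exists d => // u /=.
    rewrite /ball/= distrC => ut _ u0; have := hd (u - t).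
    rewrite /ball/= sub0r normrN => /(_ ut).
    by rewrite subr_eq0 => /(_ u0); rewrite [_ *: 1]mulr1 /diff_quot subrK.
rewrite E; split=> [H|[H1 H2]].
  split; first by apply/cvg_ex; exists l.
  by apply/cvg_lim => //; exact: norm_hausdorff.
by rewrite -H2.
Unshelve. all: by end_near. Qed.

(** By [hadamard] the quotient of [f \o c] is a sum of quotients of the coordinates of [c] times
    [r k (c u)], and the limit of [r k] at [c t] is enough to conclude. *)
Lemma chain_sum n (U : set 'rV[R]_n) (f : 'rV[R]_n -> R^o) a b (c : R -> 'rV[R]_n) t l :
  open U -> smooth_on U f -> U (c t) -> is_dw a b c t l ->
  is_dw a b (f \o c) t (\sum_k l 0 k * 'D_(delta_mx 0 k) f (c t)).
Proof.
move=> oU hf Ux hc; have [r r1 r2] := hadamard oU hf Ux.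
have cc : c u @[u --> within `[a, b] t^'] --> c t.
  apply: cvg_trans (is_dw_cvg hc); apply: cvg_app => P H.
  have {}H : \forall u \near nbhs t, u \in `[a, b] -> P u by exact: H.
  suff : \forall u \near nbhs t, u != t -> u \in `[a, b] -> P u by [].
  by apply: filterS H => u hu _.
have key : (\sum_k (diff_quot c t u) 0 k * r k (c u)) @[u --> within `[a, b] t^'] -->
    \sum_k l 0 k * 'D_(delta_mx 0 k) f (c t).
  apply: cvg_sumr => k _; apply: cvgM.
    by have /cvg_rVP := hc; exact.
  exact: (cvg_comp _ _ cc (r1 k)).
have E : {near within `[a, b] t^',
    (fun u => \sum_k (diff_quot c t u) 0 k * r k (c u)) =1 diff_quot (f \o c) t}.
  have H : \forall u \near within `[a, b] t^',
    f (c u) - f (c t) = \sum_k (c u 0 k - c t 0 k) * r k (c u) := cc _ r2.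
  near=> u; rewrite /=.
  have E : f (c u) - f (c t) = \sum_k (c u 0 k - c t 0 k) * r k (c u) by near: u.
  rewrite /diff_quot E scaler_sumr; apply: eq_bigr => k _.
  by rewrite !mxE -mulrA.
exact: (cvg_trans (near_eq_cvg E) key).
Unshelve. all: by end_near. Qed.

(** Linearity in the direction is the chain rule along the line [x + s *: v], together with
    uniqueness of derivatives. *)
Lemma derive_sumE n (U : set 'rV[R]_n) (f : 'rV[R]_n -> R^o) x v :
  open U -> smooth_on U f -> U x ->
  'D_v f x = \sum_k v 0 k * 'D_(delta_mx 0 k) f x.
Proof.
move=> oU hf Ux.
pose c := fun s : R => x + s *: v.
have c0 : c 0 = x by rewrite /c scale0r addr0.
have hc : is_dw (-1) 1 c 0 v.
  have h1 : is_dw (-1) 1 (fun s : R => s *: v) 0 v.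
    apply/is_dwP => e e0; near=> u => _ u0; rewrite /diff_quot scale0r !subr0 scalerA.
    by rewrite mulVf// scale1r subrr normr0 ltW.
  by have := is_dwD (is_dw_cst (-1) 1 x 0) h1; rewrite add0r.
have Uc : U (c 0) by rewrite c0.
have := chain_sum oU hf Uc hc; rewrite c0.
have : is_dw (-1) 1 (f \o c) 0 ('D_v f x).
  apply/is_dw_is_derive; first by rewrite ltrN10 ltr01.
  have := @is_derive_line _ _ f x v 0; rewrite scale0r addr0; apply.
  exact: smooth_derivable hf Ux.
by apply: is_dw_unique; [lra|rewrite lerN10 ler01].
Unshelve. all: by end_near. Qed.

Lemma chain n (U : set 'rV[R]_n) (f : 'rV[R]_n -> R^o) a b (c : R -> 'rV[R]_n) t l :
  open U -> smooth_on U f -> U (c t) -> is_dw a b c t l ->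
  is_dw a b (f \o c) t ('D_l f (c t)).
Proof.
move=> oU hf Ux hc; have := chain_sum oU hf Ux hc.
by rewrite -(derive_sumE l oU hf Ux).
Qed.

Lemma schwarz n (U : set 'rV[R]_n) (f : 'rV[R]_n -> R^o) x u v :
  open U -> smooth_on U f -> U x ->
  'D_u ('D_v f) x = 'D_v ('D_u f) x.
Proof.
have arith (h P X Y : R) : h != 0 -> P = h * (h * X) -> P = h * (h * Y) -> X = Y.
  by move=> h0 -> /(mulfI h0)/(mulfI h0).
have fin (e p q r : R) : `|p - r| <= e / 2 -> `|q - r| <= e / 2 -> `|p - q| <= e.
  move=> k1 k2; have -> : p - q = (p - r) - (q - r) by ring.
  by rewrite (le_trans (ler_normB _ _))// (splitr e) lerD.
move=> oU hf Ux; set A := LHS; set B := RHS.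
suff /le_anti E : `|A - B| <= 0 <= `|A - B| by apply/eqP; rewrite -subr_eq0 -normr_eq0 E.
rewrite normr_ge0 andbT; apply/ler_addgt0Pl => e e0; rewrite addr0.
have hvu := smooth_cvg (smooth_derive u (smooth_derive v hf)) Ux.
have huv := smooth_cvg (smooth_derive v (smooth_derive u hf)) Ux.
have e2 : 0 < e / 2 by lra.
have /cvgrPdist_le/(_ _ e2) h1 := hvu.
have /cvgrPdist_le/(_ _ e2) h2 := huv.
have h3 : nbhs x U by apply: open_nbhs_nbhs.
have h4 : nbhs x (U `&` ([set y | `|A - 'D_u ('D_v f) y| <= e / 2] `&`
    [set y | `|B - 'D_v ('D_u f) y| <= e / 2])).
  by apply: filterI => //; apply: filterI; [exact: h1|exact: h2].
move/nbhs_ballP : h4 => [d /= d0 hd0].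
have hd y : ball x d y -> [/\ U y, `|A - 'D_u ('D_v f) y| <= e / 2 &
    `|B - 'D_v ('D_u f) y| <= e / 2] by move=> /hd0[h5 [h6 h7]]; split; [exact: h5|exact: h6|exact: h7].
have m0 : 0 < `|u| + `|v| + 1 by rewrite ltr_wpDl// addr_ge0.
(* At this scale the whole parallelogram spanned by [h *: u] and [h *: v] at [x] stays where both
   mixed derivatives are within [e / 2] of their values at [x]. *)
have [h h0 hm] : exists2 h : R, 0 < h & h * (`|u| + `|v| + 1) < d.
  exists (d / 2 / (`|u| + `|v| + 1)); first by rewrite !divr_gt0.
  by rewrite divfK ?gt_eqF//; lra.
have hin (s s' : R) : 0 <= s <= 1 -> 0 <= s' <= 1 ->
    [/\ U (x + s *: (h *: u) + s' *: (h *: v)),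
     `|A - 'D_u ('D_v f) (x + s *: (h *: u) + s' *: (h *: v))| <= e / 2 &
     `|B - 'D_v ('D_u f) (x + s *: (h *: u) + s' *: (h *: v))| <= e / 2].
  move=> /andP[s0 s1] /andP[s'0 s'1]; apply: hd; rewrite -ball_normE /ball_/=.
  rewrite -addrA opprD addrA subrr add0r normrN (le_lt_trans (ler_normD _ _))//.
  rewrite !normrZ (ger0_norm s0) (ger0_norm s'0) (ger0_norm (ltW h0)).
  have l1 : s * (h * `|u|) <= h * `|u| by rewrite ler_piMl// mulr_ge0// ltW.
  have l2 : s' * (h * `|v|) <= h * `|v| by rewrite ler_piMl// mulr_ge0// ltW.
  rewrite (le_lt_trans (lerD l1 l2))// -mulrDr.
  by apply: lt_trans hm; rewrite ltr_pM2l// ltrDl.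
have I0 : 0 <= (0 : R) <= 1 by rewrite lexx ler01.
have I1 : 0 <= (1 : R) <= 1 by rewrite lexx ler01.
(* one second-order difference quotient, computed by the mean value theorem in either order *)
have key (g1 g2 : 'rV[R]_n) :
   (forall s s' : R, 0 <= s <= 1 -> 0 <= s' <= 1 -> U (x + s *: (h *: g1) + s' *: (h *: g2))) ->
   exists s s' : R, [/\ 0 <= s <= 1, 0 <= s' <= 1 &
    f (x + h *: g1 + h *: g2) - f (x + h *: g1) - (f (x + h *: g2) - f x) =
    h * (h * 'D_g2 ('D_g1 f) (x + s *: (h *: g1) + s' *: (h *: g2)))].
  move=> hU; pose F := fun y => f (y + h *: g2) - f y : R^o.
  have hF (s : R) : 0 <= s <= 1 -> is_derive (x + s *: (h *: g1)) (h *: g1) F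
     (h * 'D_g1 f (x + s *: (h *: g1) + h *: g2) - h * 'D_g1 f (x + s *: (h *: g1))).
    move=> s01; apply: is_deriveB.
      apply: line_is_derive.
      have D1 : is_derive (x + s *: (h *: g1) + h *: g2) (h *: g1) f
           (h * 'D_g1 f (x + s *: (h *: g1) + h *: g2)).
        apply: is_deriveZdir; apply: smooth_derivable hf _.
        by have := hU s 1 s01 I1; rewrite scale1r.
      have [D2 D3] := D1.
      have := @is_derive_line _ _ f (x + s *: (h *: g1) + h *: g2) (h *: g1) 0.
      rewrite scale0r addr0 => /(_ D2); rewrite D3.
      by congr is_derive; apply/funext => w; rewrite addrAC.
    apply: is_deriveZdir; apply: smooth_derivable hf _.
    by have := hU s 0 s01 I0; rewrite scale0r addr0.
  have [s s01] : exists2 s : R, 0 <= s <= 1 &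
      F (x + h *: g1) - F x = 'D_(h *: g1) F (x + s *: (h *: g1)).
    by apply: MVT_line => s /hF[].
  have [_ ->] := hF _ s01; rewrite -mulrBr => EF.
  have hG (s' : R) : 0 <= s' <= 1 -> is_derive (x + s *: (h *: g1) + s' *: (h *: g2)) (h *: g2)
      ('D_g1 f) (h * 'D_g2 ('D_g1 f) (x + s *: (h *: g1) + s' *: (h *: g2))).
    move=> s'01; apply: is_deriveZdir; apply: smooth_derivable (smooth_derive _ hf) _.
    exact: hU.
  have [s' s'01] : exists2 s' : R, 0 <= s' <= 1 &
      'D_g1 f (x + s *: (h *: g1) + h *: g2) - 'D_g1 f (x + s *: (h *: g1)) =
      'D_(h *: g2) ('D_g1 f) (x + s *: (h *: g1) + s' *: (h *: g2)).
    apply: (@MVT_line _ ('D_g1 f) (x + s *: (h *: g1)) (h *: g2)) => r r01.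
    by have [D2 _] := hG r r01; exact: D2.
  have [_ ->] := hG _ s'01 => E; exists s, s'; split=> //.
  by rewrite -E -EF /F.
have [s1 [s1' [i1 i1' E1]]] := key u v (fun s s' i i' => let: And3 h _ _ := hin s s' i i' in h).
have hU2 (s s' : R) : 0 <= s <= 1 -> 0 <= s' <= 1 -> U (x + s *: (h *: v) + s' *: (h *: u)).
  by move=> i i'; rewrite addrAC; have [] := hin s' s i' i.
have [s2 [s2' [i2 i2' E2]]] := key v u hU2.
have E : 'D_v ('D_u f) (x + s1 *: (h *: u) + s1' *: (h *: v)) =
         'D_u ('D_v f) (x + s2 *: (h *: v) + s2' *: (h *: u)).
  have E2' : f (x + h *: u + h *: v) - f (x + h *: u) - (f (x + h *: v) - f x) =
    h * (h * 'D_u ('D_v f) (x + s2 *: (h *: v) + s2' *: (h *: u))).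
    rewrite -E2 [x + h *: u + h *: v]addrAC.
    by move: (f _) (f _) (f _) (f _) => p1 p2 p3 p4; ring.
  have hn0 : h != 0 by rewrite gt_eqF.
  exact: (arith _ _ _ _ hn0 E1 E2').
have [_ _ b1] := hin s1 s1' i1 i1'; have [_ b2 _] := hin s2' s2 i2' i2.
rewrite [x + s2 *: _ + _]addrAC in E; rewrite E in b1.
exact: (fin _ _ _ _ b2 b1).
Qed.

End Multivariate.

(** * Bilinear forms, Christoffel symbols and matrix fields along curves *)

Section Bilinear.
Variables (R : realType) (n : nat).
Implicit Types (A B : 'M[R]_n) (u v w : 'rV[R]_n).

Lemma bilinE A u v : bilin A u v = \sum_j (\sum_i u 0 i * A i j) * v 0 j.
Proof. by rewrite /bilin !mxE; apply: eq_bigr => j _; rewrite !mxE. Qed.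

Lemma bilinDl A u u' v : bilin A (u + u') v = bilin A u v + bilin A u' v.
Proof. by rewrite /bilin !mulmxDl mxE. Qed.
Lemma bilinDr A u v v' : bilin A u (v + v') = bilin A u v + bilin A u v'.
Proof. by rewrite /bilin linearD mulmxDr mxE. Qed.
Lemma bilinZl A c u v : bilin A (c *: u) v = c * bilin A u v.
Proof. by rewrite /bilin -!scalemxAl mxE. Qed.
Lemma bilinZr A c u v : bilin A u (c *: v) = c * bilin A u v.
Proof. by rewrite /bilin linearZ -scalemxAr mxE. Qed.
Lemma bilinNl A u v : bilin A (- u) v = - bilin A u v.
Proof. by rewrite -scaleN1r bilinZl mulN1r. Qed.
Lemma bilinNr A u v : bilin A u (- v) = - bilin A u v.
Proof. by rewrite -scaleN1r bilinZr mulN1r. Qed.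
Lemma bilin0l A v : bilin A 0 v = 0.
Proof. by rewrite -(scale0r 0) bilinZl mul0r. Qed.
Lemma bilin0r A u : bilin A u 0 = 0.
Proof. by rewrite -(scale0r 0) bilinZr mul0r. Qed.
Lemma bilinDm A B u v : bilin (A + B) u v = bilin A u v + bilin B u v.
Proof. by rewrite /bilin mulmxDr mulmxDl mxE. Qed.
Lemma bilinC A u v : A^T = A -> bilin A u v = bilin A v u.
Proof.
by move=> h; rewrite /bilin -[u *m A *m v^T]trmxK [LHS]mxE trmx_mul trmxK trmx_mul h mulmxA.
Qed.

Definition chr (G : 'I_n -> 'M[R]_n) u v : 'rV[R]_n := christoffel_apply G u v.

Lemma chrE (G : 'I_n -> 'M[R]_n) u v k : (chr G u v) 0 k = bilin (G k) u v.
Proof. by rewrite /chr mxE. Qed.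
Lemma chrDr G u v v' : chr G u (v + v') = chr G u v + chr G u v'.
Proof. by apply/rowP => k; rewrite chrE mxE !chrE bilinDr. Qed.
Lemma chrZl G c u v : chr G (c *: u) v = c *: chr G u v.
Proof. by apply/rowP => k; rewrite chrE mxE !chrE bilinZl. Qed.
Lemma chrZr G c u v : chr G u (c *: v) = c *: chr G u v.
Proof. by apply/rowP => k; rewrite chrE mxE !chrE bilinZr. Qed.
Lemma chr0l G v : chr G 0 v = 0.
Proof. by rewrite -(scale0r 0) chrZl !scale0r. Qed.
Lemma chr0r G u : chr G u 0 = 0.
Proof. by rewrite -(scale0r 0) chrZr !scale0r. Qed.
Lemma chrDm G H u v : chr (fun k => G k + H k) u v = chr G u v + chr H u v.
Proof. by apply/rowP => k; rewrite chrE mxE !chrE bilinDm. Qed.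

Lemma rowDE u v k : (u + v) 0 k = u 0 k + v 0 k. Proof. by rewrite mxE. Qed.
Lemma rowNE u k : (- u) 0 k = - u 0 k. Proof. by rewrite mxE. Qed.
Lemma rowZE c u k : (c *: u) 0 k = c * u 0 k. Proof. by rewrite mxE. Qed.
Lemma row0E k : (0 : 'rV[R]_n) 0 k = 0. Proof. by rewrite mxE. Qed.

End Bilinear.

Definition rv_entryE := (rowDE, rowNE, rowZE, row0E).

Section BilinCurve.
Variables (R : realType) (n : nat) (a b : R).

Lemma is_dw_bilin (A : R -> 'M[R]_n) (A' : 'M[R]_n) (u v : R -> 'rV[R]_n) t u' v' :
  (forall i j, is_dw a b (fun s => A s i j : R^o) t (A' i j)) ->
  is_dw a b u t u' -> is_dw a b v t v' ->
  is_dw a b (fun s => bilin (A s) (u s) (v s) : R^o) t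
    (bilin A' (u t) (v t) + bilin (A t) u' (v t) + bilin (A t) (u t) v').
Proof.
move=> hA /is_dw_rVP hu /is_dw_rVP hv.
under eq_fun do rewrite bilinE.
have -> : bilin A' (u t) (v t) + bilin (A t) u' (v t) + bilin (A t) (u t) v' =
  \sum_j ((\sum_i (u' 0 i * A t i j + u t 0 i * A' i j)) * v t 0 j +
    (\sum_i u t 0 i * A t i j) * v' 0 j).
  rewrite !bilinE -!big_split/=; apply: eq_bigr => j _.
  by rewrite big_split/=; ring.
apply: (@is_dw_sum _ R^o) => j _; apply: is_dwM => //.
by apply: (@is_dw_sum _ R^o) => i _; apply: is_dwM.
Qed.

Lemma is_dw_chr (A : R -> 'I_n -> 'M[R]_n) (A' : 'I_n -> 'M[R]_n) (u v : R -> 'rV[R]_n) t u' v' :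
  (forall k i j, is_dw a b (fun s => A s k i j : R^o) t (A' k i j)) ->
  is_dw a b u t u' -> is_dw a b v t v' ->
  is_dw a b (fun s => chr (A s) (u s) (v s)) t
    (chr A' (u t) (v t) + chr (A t) u' (v t) + chr (A t) (u t) v').
Proof.
move=> hA hu hv; apply/is_dw_rVP => k; rewrite !rv_entryE !chrE.
under eq_fun do rewrite chrE.
exact: is_dw_bilin.
Qed.

Lemma CkI_bilin m (A : R -> 'M[R]_n) (u v : R -> 'rV[R]_n) :
  (forall i j, CkI a b m (fun s => A s i j : R^o)) ->
  CkI a b m u -> CkI a b m v ->
  CkI a b m (fun s => bilin (A s) (u s) (v s) : R^o).
Proof.
move=> hA /CkI_rVP hu /CkI_rVP hv; under eq_fun do rewrite bilinE.
apply: (@CkI_sum _ R^o) => j _; apply: CkIM => //.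
by apply: (@CkI_sum _ R^o) => i _; apply: CkIM.
Qed.

Lemma CkI_chr m (A : R -> 'I_n -> 'M[R]_n) (u v : R -> 'rV[R]_n) :
  (forall k i j, CkI a b m (fun s => A s k i j : R^o)) ->
  CkI a b m u -> CkI a b m v ->
  CkI a b m (fun s => chr (A s) (u s) (v s)).
Proof.
move=> hA hu hv; apply/CkI_rVP => k; under eq_fun do rewrite chrE.
exact: CkI_bilin.
Qed.

Lemma CkI_comp (U : set 'rV[R]_n) m (f : 'rV[R]_n -> R^o) (c : R -> 'rV[R]_n) :
  open U -> smooth_on U f -> (forall t, a <= t <= b -> U (c t)) ->
  CkI a b m c -> CkI a b m (f \o c).
Proof.
move=> oU; elim: m f => [|m IH] f hf hU hc /=.
  by move=> t tab; exact: (cvg_comp _ _ (hc t tab) (smooth_cvg hf (hU t tab))).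
have hc' := CkI_le (leqnSn m) hc; case: hc => c' c1 c2.
exists (fun t => \sum_k c' t 0 k * 'D_(delta_mx 0 k) f (c t)).
  by move=> t tab; apply: chain_sum oU hf (hU _ tab) (c1 _ tab).
apply: (@CkI_sum _ R^o) => k _; apply: CkIM; first by move/CkI_rVP: c2; exact.
exact: (IH ('D_(delta_mx 0 k) f) (smooth_derive _ hf) hU hc').
Qed.

End BilinCurve.

(** Opened only by [dmxE], so that the nested derivatives of [G] and [g] behave as atoms. *)
HB.lock Definition dmx (R : realType) (n : nat) (A : 'rV[R]_n -> 'M[R]_n)
    (w x : 'rV[R]_n) : 'M[R]_n :=
  \matrix_(i, j) 'D_w (fun y => A y i j : R^o) x.

Section Dmx.
Variables (R : realType) (n : nat) (U : set 'rV[R]_n).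
Hypothesis oU : open U.
Implicit Types (A : 'rV[R]_n -> 'M[R]_n) (x u v w z : 'rV[R]_n).

Definition smooth_mx A := forall i j, smooth_on U (fun x => A x i j : R^o).

Lemma dmxE A w x i j : dmx A w x i j = 'D_w (fun y => A y i j : R^o) x.
Proof. by rewrite dmx.unlock mxE. Qed.

Lemma dmx_smooth A w : smooth_mx A -> smooth_mx (dmx A w).
Proof.
move=> h i j; have := smooth_derive w (h i j).
by congr smooth_on; apply/funext => x; rewrite dmxE.
Qed.

Lemma dmx_sum A w x i j : smooth_mx A -> U x ->
  dmx A w x i j = \sum_k w 0 k * dmx A (delta_mx 0 k) x i j.
Proof.
move=> h Ux; rewrite dmxE (derive_sumE _ oU (h i j) Ux).
by apply: eq_bigr => k _; rewrite dmxE.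
Qed.

Lemma dmxC A w w' x : smooth_mx A -> U x -> dmx (dmx A w) w' x = dmx (dmx A w') w x.
Proof.
move=> h Ux; apply/matrixP => i j; rewrite [LHS]dmxE [RHS]dmxE.
have E v : (fun y => dmx A v y i j : R^o) = 'D_v (fun y => A y i j : R^o).
  by apply/funext => y; rewrite dmxE.
rewrite (E w) (E w'); exact: schwarz (h i j) Ux.
Qed.

Lemma is_dw_mx a b A (c : R -> 'rV[R]_n) t c' i j : smooth_mx A -> U (c t) ->
  is_dw a b c t c' ->
  is_dw a b (fun s => A (c s) i j : R^o) t (dmx A c' (c t) i j).
Proof. by move=> h Ux hc; rewrite dmxE; exact: chain oU (h i j) Ux hc. Qed.

(** The direction moves along with the point. Expanding it in the basis leaves products with
    derivatives in fixed directions, and symmetry of second derivatives reassembles the sum. *)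
Lemma is_dw_dmx a b A (c w : R -> 'rV[R]_n) t c' w' i j : smooth_mx A ->
  a <= t <= b -> (forall t, a <= t <= b -> U (c t)) ->
  is_dw a b c t c' -> is_dw a b w t w' ->
  is_dw a b (fun s => dmx A (w s) (c s) i j : R^o) t
    ((dmx (dmx A (w t)) c' (c t) + dmx A w' (c t)) i j).
Proof.
move=> h tab hU hc /is_dw_rVP hw; have Ux := hU _ tab.
apply: (@is_dw_eq _ _ _ _ (fun s => \sum_k w s 0 k * dmx A (delta_mx 0 k) (c s) i j : R^o)) => //.
  by move=> s; rewrite in_itv/= => /hU Us; rewrite -dmx_sum.
have -> : (dmx (dmx A (w t)) c' (c t) + dmx A w' (c t)) i j =
  \sum_k (w' 0 k * dmx A (delta_mx 0 k) (c t) i j +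
          w t 0 k * dmx (dmx A (delta_mx 0 k)) c' (c t) i j).
  have E1 : dmx (dmx A (w t)) c' (c t) i j =
      \sum_k w t 0 k * dmx (dmx A (delta_mx 0 k)) c' (c t) i j.
    rewrite dmxC// dmx_sum//; last exact: dmx_smooth.
    by apply: eq_bigr => k _; rewrite (dmxC _ _ h Ux).
  by rewrite mxE addrC big_split/= -E1 -dmx_sum.
apply: (@is_dw_sum _ R^o) => k _; apply: is_dwM => //.
by apply: is_dw_mx => //; exact: dmx_smooth.
Qed.

Lemma CkI_mx a b m A (c : R -> 'rV[R]_n) i j : smooth_mx A ->
  (forall t, a <= t <= b -> U (c t)) -> CkI a b m c ->
  CkI a b m (fun s => A (c s) i j : R^o).
Proof. by move=> h hU hc; exact: CkI_comp oU (h i j) hU hc. Qed.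

Lemma CkI_dmx a b m A (c w : R -> 'rV[R]_n) i j : smooth_mx A ->
  (forall t, a <= t <= b -> U (c t)) -> CkI a b m c -> CkI a b m w ->
  CkI a b m (fun s => dmx A (w s) (c s) i j : R^o).
Proof.
move=> h hU hc /CkI_rVP hw.
apply: (@CkI_eq _ _ _ _ _ (fun s => \sum_k w s 0 k * dmx A (delta_mx 0 k) (c s) i j : R^o)).
  by move=> s /hU Us; rewrite -dmx_sum.
apply: (@CkI_sum _ R^o) => k _; apply: CkIM => //.
by apply: CkI_mx => //; exact: dmx_smooth.
Qed.

Lemma is_dw_line a b x v : is_dw a b (fun s : R => x + s *: v) 0 v.
Proof.
apply/is_dwP => e e0; near=> u => _ u0.
rewrite /diff_quot scale0r addr0 subr0 [x + _]addrC addrK scalerA mulVf// scale1r subrr.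
by rewrite normr0 ltW.
Unshelve. all: by end_near. Qed.

Lemma derive_bilin A w x u v : smooth_mx A -> U x ->
  is_derive x w (fun y => bilin (A y) u v : R^o) (bilin (dmx A w x) u v).
Proof.
move=> h Ux; apply: line_is_derive; apply/(@is_dw_is_derive _ _ (-1) 1).
  by apply/andP; split; lra.
have L : is_dw (-1) 1 (fun s : R => x + s *: w) 0 w by exact: is_dw_line.
have x0 : x + 0 *: w = x by rewrite scale0r addr0.
have hA i j : is_dw (-1) 1 (fun s : R => A (x + s *: w) i j : R^o) 0 (dmx A w x i j).
  by have := @is_dw_mx (-1) 1 A (fun s : R => x + s *: w) 0 w i j h; rewrite x0; apply.
have := is_dw_bilin hA (is_dw_cst (-1) 1 u 0) (is_dw_cst (-1) 1 v 0).
by rewrite bilin0l bilin0r !addr0.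
Qed.

End Dmx.

(** Four Bianchi identities, one for each choice of the last argument, combine to the claim after
    all terms are normalized by the two skew-symmetries. The conclusion is the exchange of pairs,
    [T w u v z = T v z w u], with both pairs on the right flipped, which costs two signs. *)
Lemma algebraic_pair_symmetry (R : realType) (V : Type) (T : V -> V -> V -> V -> R) :
  (forall p q r s, T p q r s = - T q p r s) ->
  (forall p q r s, T p q r s = - T p q s r) ->
  (forall p q r s, T p q r s + T q r p s + T r p q s = 0) ->
  forall w u v z, T w u v z = T z v u w.
Proof.
move=> s12 s34 b w u v z.
have := b w u v z; have := b u v z w; have := b v z w u; have := b z w u v.
rewrite (s34 u v z w) (s34 v z u w) (s12 z u v w) (s12 z w v u) (s34 w z v u).
rewrite (s12 w v z u) (s34 v w z u) (s12 z w u v) (s34 w u z v) (s34 u z w v).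
rewrite (s12 z v u w) (s34 v z u w); lra.
Qed.

(** * Curvature in a chart *)

Section Chart.
Variables (R : realType) (n : nat) (U : set 'rV[R]_n).
Variables (G : 'rV[R]_n -> 'I_n -> 'M[R]_n) (g : 'rV[R]_n -> 'M[R]_n).
Hypothesis oU : open U.
Hypothesis sG : forall k, smooth_mx U (fun x => G x k).
Hypothesis sg : smooth_mx U g.
Hypothesis Gsym : forall x u v, U x -> chr (G x) u v = chr (G x) v u.
Hypothesis gsym : forall x, U x -> (g x)^T = g x.
Hypothesis compat : forall x w u v, U x ->
  bilin (dmx g w x) u v = bilin (g x) (chr (G x) w u) v + bilin (g x) u (chr (G x) w v).

Definition dG w x k := dmx (fun y => G y k) w x.
(** R(u, v) w on fields with constant components, whose bracket vanishes. *)
Definition Rm x u v w := chr (dG u x) v w + chr (G x) u (chr (G x) v w)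
  - (chr (dG v x) u w + chr (G x) v (chr (G x) u w)).

Lemma dG_sym x w u v : U x -> chr (dG w x) u v = chr (dG w x) v u.
Proof.
move=> Ux; apply/rowP => k; rewrite !chrE.
have [_ <-] := derive_bilin oU w u v (sG k) Ux.
have [_ <-] := derive_bilin oU w v u (sG k) Ux.
apply: near_eq_derive; have : nbhs x U by apply: open_nbhs_nbhs.
by apply: filterS => y Uy; rewrite -!chrE Gsym.
Qed.

Lemma Rm_skew12 x u v w : Rm x u v w = - Rm x v u w.
Proof. by rewrite /Rm opprB. Qed.

(** The second derivatives of [g] commute, and the two orders of differentiating the compatibility
    identity differ exactly by the sum of the two curvature terms. *)
Lemma Rm_skew34 x u v w z : U x ->
  bilin (g x) (Rm x u v w) z = - bilin (g x) (Rm x u v z) w.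
Proof.
move=> Ux; rewrite [in RHS](bilinC _ _ (gsym Ux)).
(* differentiate the compatibility identity once more *)
have key d1 d2 : bilin (dmx (dmx g d1) d2 x) w z =
    bilin (dmx g d2 x) (chr (G x) d1 w) z + bilin (g x) (chr (dG d2 x) d1 w) z +
    (bilin (dmx g d2 x) w (chr (G x) d1 z) + bilin (g x) w (chr (dG d2 x) d1 z)).
  pose c := fun s : R => x + s *: d2.
  have c0 : c 0 = x by rewrite /c scale0r addr0.
  have L : is_dw (-1) 1 c 0 d2 by exact: is_dw_line.
  have Uc : U (c 0) by rewrite c0.
  have k1 i j := @is_dw_mx _ _ U oU (-1) 1 _ c 0 d2 i j (dmx_smooth d1 sg) Uc L.
  have k2 i j := @is_dw_mx _ _ U oU (-1) 1 _ c 0 d2 i j sg Uc L.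
  have k3 k i j := @is_dw_mx _ _ U oU (-1) 1 _ c 0 d2 i j (sG k) Uc L.
  have cst (v' : 'rV[R]_n) : is_dw (-1) 1 (fun=> v') (0:R) 0 by exact: is_dw_cst.
  have e1 := is_dw_bilin k1 (cst w) (cst z).
  have e2 := is_dw_bilin k2 (is_dw_chr k3 (cst d1) (cst w)) (cst z).
  have e3 := is_dw_bilin k2 (cst w) (is_dw_chr k3 (cst d1) (cst z)).
  have e4 := @is_dwD _ R^o _ _ _ _ _ _ _ e2 e3.
  have I : -1 <= (0:R) <= 1 by apply/andP; split; lra.
  have e5 : is_dw (-1) 1 (fun s => bilin (dmx g d1 (c s)) w z : R^o) 0
      (bilin (dmx g d2 x) (chr (G x) d1 w) z + bilin (g x) (chr (dG d2 x) d1 w) z +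
    (bilin (dmx g d2 x) w (chr (G x) d1 z) + bilin (g x) w (chr (dG d2 x) d1 z))).
    move: e4; rewrite c0 !(chr0l, chr0r, bilin0l, bilin0r, addr0).
    move=> e4'; apply: (is_dw_local I _ e4').
    have h : nbhs (c 0) U by rewrite c0; apply: open_nbhs_nbhs.
    have cc : {for 0, continuous c}.
      apply: continuousD; first exact: cst_continuous.
      by apply: scalel_continuous.
    have {}cc : \forall s \near (0:R), U (c s) := cc _ h.
    near=> s => sI; split => //; rewrite compat//.
    by near: s.
  move: e1; rewrite c0 !bilin0l !bilin0r !addr0 => e1.
  by apply: is_dw_unique e1 e5 => //; lra.
have := key u v; have := key v u; rewrite (dmxC oU u v sg Ux) => -> /eqP.
rewrite !compat// /Rm !(bilinDl, bilinDr, bilinNl, bilinNr) => /eqP h; lra.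
Unshelve. all: by end_near. Qed.

Lemma Rm_bianchi x u v w : U x -> Rm x u v w + Rm x v w u + Rm x w u v = 0.
Proof.
move=> Ux; rewrite /Rm.
rewrite (dG_sym u w v Ux) (dG_sym v w u Ux) (dG_sym w v u Ux).
rewrite (Gsym w v Ux) (Gsym w u Ux) (Gsym v u Ux).
apply/rowP => k; rewrite !rv_entryE; ring.
Qed.

(** In this form a vector paired with a curvature term becomes the first argument of the curvature,
    which is where the commutator of derivatives puts the variation field. *)
Lemma Rm_pair x w u v z : U x ->
  bilin (g x) (Rm x w u v) z = bilin (g x) (Rm x z v u) w.
Proof.
move=> Ux; apply: (algebraic_pair_symmetry (T := fun p q r s => bilin (g x) (Rm x p q r) s)).
- by move=> p q r s; rewrite Rm_skew12 bilinNl.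
- by move=> p q r s; exact: Rm_skew34.
- by move=> p q r s; rewrite -!bilinDl Rm_bianchi// bilin0l.
Qed.

End Chart.

(** All that the coordinate computations use of a chart, so that they do not mention the manifold;
    [chart_geometry] provides an instance. *)
Record metric_chart (R : realType) (n : nat) (U : set 'rV[R]_n)
    (G : 'rV[R]_n -> 'I_n -> 'M[R]_n) (g : 'rV[R]_n -> 'M[R]_n) : Prop := MetricChart {
  mc_open : open U;
  mc_G : forall k, smooth_mx U (fun x => G x k);
  mc_g : smooth_mx U g;
  mc_Gsym : forall x u v, U x -> chr (G x) u v = chr (G x) v u;
  mc_gsym : forall x, U x -> (g x)^T = g x;
  mc_pos : forall x v, U x -> v != 0 -> 0 < bilin (g x) v v;
  mc_compat : forall x w u v, U x ->
    bilin (dmx g w x) u v = bilin (g x) (chr (G x) w u) v + bilin (g x) u (chr (G x) w v) }.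

(** * The Lagrangian and its first variation *)

Section Jets.
Variables (R : realType) (n : nat).
Variables (G : 'rV[R]_n -> 'I_n -> 'M[R]_n) (g : 'rV[R]_n -> 'M[R]_n).
Implicit Types (y h : 'rV[R]_n).

Definition ddG w v y k := dmx (dmx (fun z => G z k) w) v y.

(* Coordinate expressions of the covariant acceleration, of its time derivative
   and of the second covariant derivative of the velocity in terms of the jet
   of a curve. *)
Definition acc y y1 y2 := y2 + chr (G y) y1 y1.
Definition acc' y y1 y2 y3 :=
  y3 + (chr (dG G y1 y) y1 y1 + chr (G y) y2 y1 + chr (G y) y1 y2).
Definition jerk y y1 y2 y3 := acc' y y1 y2 y3 + chr (G y) y1 (acc y y1 y2).

(* The variation of [acc] and [acc'] in the direction of a field with jet h, h1, h2, h3. *)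
Definition vacc y y1 h h1 h2 :=
  h2 + (chr (dG G h y) y1 y1 + chr (G y) h1 y1 + chr (G y) y1 h1).
Definition vacc' y y1 y2 h h1 h2 h3 :=
  h3 + ((chr (ddG y1 h y) y1 y1 + chr (dG G h1 y) y1 y1 + chr (dG G y1 y) h1 y1
         + chr (dG G y1 y) y1 h1)
    + (chr (dG G h y) y2 y1 + chr (G y) h2 y1 + chr (G y) y2 h1)
    + (chr (dG G h y) y1 y2 + chr (G y) h1 y2 + chr (G y) y1 h2)).
Definition vjerk y y1 y2 h h1 h2 h3 := vacc' y y1 y2 h h1 h2 h3 +
  (chr (dG G h y) y1 (acc y y1 y2) + chr (G y) h1 (acc y y1 y2)
   + chr (G y) y1 (vacc y y1 h h1 h2)).

(* Covariant variations: the covariant derivatives along the variation of the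
   velocity, of the acceleration and of the jerk. *)
Definition cvel y y1 h h1 := h1 + chr (G y) y1 h.
Definition cacc y y1 y2 h h1 h2 := vacc y y1 h h1 h2 + chr (G y) h (acc y y1 y2).
Definition cjerk y y1 y2 y3 h h1 h2 h3 :=
  vjerk y y1 y2 h h1 h2 h3 + chr (G y) h (jerk y y1 y2 y3).

Definition lagr e1 e2 y y1 y2 y3 : R :=
  e1 * bilin (g y) y1 y1 + e2 * bilin (g y) (acc y y1 y2) (acc y y1 y2)
  + bilin (g y) (jerk y y1 y2 y3) (jerk y y1 y2 y3).
(** Half the variation of [lagr]: metric compatibility absorbs the derivative of [g] into the
    covariant variations, and symmetry of [g] gives the factor 2 of [uexp_lagr]. *)
Definition vlagr e1 e2 y y1 y2 y3 h h1 h2 h3 : R :=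
  e1 * bilin (g y) (cvel y y1 h h1) y1
  + e2 * bilin (g y) (cacc y y1 y2 h h1 h2) (acc y y1 y2)
  + bilin (g y) (cjerk y y1 y2 y3 h h1 h2 h3) (jerk y y1 y2 y3).

(* Chosen so that vlagr = <E, h> + d/dt bdry, see [is_dw_bdry]; here v3 and v4 are
   the third and fourth covariant derivatives of the velocity. *)
Definition bdry e1 e2 y y1 y2 y3 v3 v4 h h1 h2 : R :=
  e1 * bilin (g y) h y1
  + e2 * (bilin (g y) (cvel y y1 h h1) (acc y y1 y2) - bilin (g y) h (jerk y y1 y2 y3))
  + bilin (g y) (cacc y y1 y2 h h1 h2) (jerk y y1 y2 y3)
  - bilin (g y) (cvel y y1 h h1) v3 + bilin (g y) h v4.

(** Right side minus left side of the equation, with [e1] and [e2] standing for the squares of the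
    tension parameters. *)
Definition euler e1 e2 y (v0 v1 v2 v3 v5 : 'rV[R]_n) :=
  e2 *: v3 + e2 *: Rm G y v1 v0 v0 - e1 *: v1
  - (v5 + Rm G y v1 v2 v0 + Rm G y v3 v0 v0).

End Jets.

Section Boundary.
Variables (R : realType) (n : nat) (U : set 'rV[R]_n).
Variables (G : 'rV[R]_n -> 'I_n -> 'M[R]_n) (g : 'rV[R]_n -> 'M[R]_n).
Hypothesis H : metric_chart U G g.
Variables (a b : R) (x x1 x2 x3 h h1 h2 h3 : R -> 'rV[R]_n).
Hypothesis xU : forall t, a <= t <= b -> U (x t).
Variable t : R.
Hypothesis tab : a <= t <= b.
Hypotheses (dx : is_dw a b x t (x1 t)) (dx1 : is_dw a b x1 t (x2 t))
  (dx2 : is_dw a b x2 t (x3 t)).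
Hypotheses (dh : is_dw a b h t (h1 t)) (dh1 : is_dw a b h1 t (h2 t))
  (dh2 : is_dw a b h2 t (h3 t)).

Let oU := mc_open H.
Let Ux : U (x t) := xU tab.

Lemma is_dw_G k i j : is_dw a b (fun s => G (x s) k i j : R^o) t (dG G (x1 t) (x t) k i j).
Proof. rewrite /dG; have := is_dw_mx oU (mc_G H k) Ux dx; exact. Qed.

Lemma is_dw_chrG u v u' v' : is_dw a b u t u' -> is_dw a b v t v' ->
  is_dw a b (fun s => chr (G (x s)) (u s) (v s)) t
   (chr (dG G (x1 t) (x t)) (u t) (v t) + chr (G (x t)) u' (v t) + chr (G (x t)) (u t) v').
Proof. by move=> hu hv; exact: is_dw_chr is_dw_G hu hv. Qed.

Lemma is_dw_chrdG w u v w' u' v' : is_dw a b w t w' -> is_dw a b u t u' -> is_dw a b v t v' ->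
  is_dw a b (fun s => chr (dG G (w s) (x s)) (u s) (v s)) t
   (chr (ddG G (w t) (x1 t) (x t)) (u t) (v t) + chr (dG G w' (x t)) (u t) (v t)
    + chr (dG G (w t) (x t)) u' (v t) + chr (dG G (w t) (x t)) (u t) v').
Proof.
move=> hw hu hv; rewrite -chrDm; apply: is_dw_chr hu hv => k i j.
exact: (is_dw_dmx oU (mc_G H k) tab xU dx hw).
Qed.

Lemma is_dw_g u v u' v' : is_dw a b u t u' -> is_dw a b v t v' ->
  is_dw a b (fun s => bilin (g (x s)) (u s) (v s) : R^o) t
   (bilin (g (x t)) (u' + chr (G (x t)) (x1 t) (u t)) (v t) +
    bilin (g (x t)) (u t) (v' + chr (G (x t)) (x1 t) (v t))).
Proof.
move=> hu hv.
have := is_dw_bilin (fun i j => is_dw_mx oU (mc_g H) Ux dx) hu hv.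
rewrite (mc_compat H _ _ _ Ux) bilinDl bilinDr.
by congr is_dw; ring.
Qed.

Lemma is_dw_acc : is_dw a b (fun s => acc G (x s) (x1 s) (x2 s)) t
  (acc' G (x t) (x1 t) (x2 t) (x3 t)).
Proof. by apply: is_dwD => //; exact: is_dw_chrG. Qed.

Lemma is_dw_cvel : is_dw a b (fun s => cvel G (x s) (x1 s) (h s) (h1 s)) t
  (h2 t + (chr (dG G (x1 t) (x t)) (x1 t) (h t) + chr (G (x t)) (x2 t) (h t)
    + chr (G (x t)) (x1 t) (h1 t))).
Proof. by apply: is_dwD => //; exact: is_dw_chrG. Qed.

Lemma is_dw_vacc : is_dw a b (fun s => vacc G (x s) (x1 s) (h s) (h1 s) (h2 s)) t
  (vacc' G (x t) (x1 t) (x2 t) (h t) (h1 t) (h2 t) (h3 t)).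
Proof.
have := is_dwD dh2 (is_dwD (is_dwD (is_dw_chrdG dh dx1 dx1) (is_dw_chrG dh1 dx1))
  (is_dw_chrG dx1 dh1)).
congr is_dw; rewrite /vacc'.
(* The derivative in time of the variation and the variation of the derivative in time differ only
   in the order of the second derivatives of [G]. *)
have -> : chr (ddG G (h t) (x1 t) (x t)) (x1 t) (x1 t) =
          chr (ddG G (x1 t) (h t) (x t)) (x1 t) (x1 t).
  by congr chr; apply/funext => k; exact: (dmxC oU _ _ (mc_G H k) Ux).
by apply/rowP => k; rewrite !rv_entryE; ring.
Qed.

Lemma is_dw_cacc : is_dw a b (fun s => cacc G (x s) (x1 s) (x2 s) (h s) (h1 s) (h2 s)) t
  (vacc' G (x t) (x1 t) (x2 t) (h t) (h1 t) (h2 t) (h3 t) +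
   (chr (dG G (x1 t) (x t)) (h t) (acc G (x t) (x1 t) (x2 t)) +
    chr (G (x t)) (h1 t) (acc G (x t) (x1 t) (x2 t)) +
    chr (G (x t)) (h t) (acc' G (x t) (x1 t) (x2 t) (x3 t)))).
Proof. by apply: is_dwD; [exact: is_dw_vacc|exact: is_dw_chrG dh is_dw_acc]. Qed.

(* D_s D_t (velocity) = D_t D_s (velocity) + R(h, velocity) velocity *)
Lemma caccE : cacc G (x t) (x1 t) (x2 t) (h t) (h1 t) (h2 t) =
  h2 t + (chr (dG G (x1 t) (x t)) (x1 t) (h t) + chr (G (x t)) (x2 t) (h t)
    + chr (G (x t)) (x1 t) (h1 t)) +
  chr (G (x t)) (x1 t) (cvel G (x t) (x1 t) (h t) (h1 t)) +
  Rm G (x t) (h t) (x1 t) (x1 t).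
Proof.
rewrite /cacc /vacc /acc /cvel /Rm !chrDr.
rewrite (dG_sym oU (mc_G H) (mc_Gsym H) (x1 t) (h t) (x1 t) Ux).
rewrite (mc_Gsym H (h t) (x1 t) Ux) (mc_Gsym H (h t) (x2 t) Ux) (mc_Gsym H (h1 t) (x1 t) Ux).
by apply/rowP => k; rewrite !rv_entryE; ring.
Qed.

(* D_s D_t (acceleration) = D_t D_s (acceleration) + R(h, velocity) acceleration *)
Lemma cjerkE : cjerk G (x t) (x1 t) (x2 t) (x3 t) (h t) (h1 t) (h2 t) (h3 t) =
  vacc' G (x t) (x1 t) (x2 t) (h t) (h1 t) (h2 t) (h3 t) +
   (chr (dG G (x1 t) (x t)) (h t) (acc G (x t) (x1 t) (x2 t)) +
    chr (G (x t)) (h1 t) (acc G (x t) (x1 t) (x2 t)) +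
    chr (G (x t)) (h t) (acc' G (x t) (x1 t) (x2 t) (x3 t))) +
  chr (G (x t)) (x1 t) (cacc G (x t) (x1 t) (x2 t) (h t) (h1 t) (h2 t)) +
  Rm G (x t) (h t) (x1 t) (acc G (x t) (x1 t) (x2 t)).
Proof.
rewrite /cjerk /vjerk /jerk /cacc /Rm.
move: (vacc' _ _ _ _ _ _ _ _) (acc' _ _ _ _ _) (acc _ _ _ _) (vacc _ _ _ _ _ _) => p q r s.
rewrite !chrDr.
by apply/rowP => k; rewrite !rv_entryE; ring.
Qed.

Variables (e1 e2 : R) (v3 v4 v5 : R -> 'rV[R]_n) (j' v3' v4' : 'rV[R]_n).
Let j s := jerk G (x s) (x1 s) (x2 s) (x3 s).
Hypotheses (dj : is_dw a b j t j') (dv3 : is_dw a b v3 t v3') (dv4 : is_dw a b v4 t v4').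
Hypotheses (ev3 : v3 t = j' + chr (G (x t)) (x1 t) (j t))
  (ev4 : v4 t = v3' + chr (G (x t)) (x1 t) (v3 t))
  (ev5 : v5 t = v4' + chr (G (x t)) (x1 t) (v4 t)).

(** Each inner product in [bdry] is differentiated covariantly, and the intermediate terms cancel in
    pairs. What survives are the pairings of [h] with the covariant derivatives and the commutator
    terms of [caccE] and [cjerkE], in which [h] is an argument of the curvature; the symmetries of
    [Rm] make these pairings with [h] too. *)
Lemma is_dw_bdry :
  is_dw a b (fun s => bdry G g e1 e2 (x s) (x1 s) (x2 s) (x3 s) (v3 s) (v4 s)
     (h s) (h1 s) (h2 s) : R^o) t
    (vlagr G g e1 e2 (x t) (x1 t) (x2 t) (x3 t) (h t) (h1 t) (h2 t) (h3 t) -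
     bilin (g (x t)) (euler G e1 e2 (x t) (x1 t) (acc G (x t) (x1 t) (x2 t)) (j t)
       (v3 t) (v5 t)) (h t)).
Proof.
have d1 := is_dwZ (k := e1) (is_dw_g dh dx1).
have d2 := is_dwZ (k := e2) (is_dwB (is_dw_g is_dw_cvel is_dw_acc) (is_dw_g dh dj)).
have d3 := is_dw_g is_dw_cacc dj.
have d4 := is_dw_g is_dw_cvel dv3.
have d5 := is_dw_g dh dv4.
have := is_dwD (is_dwB (is_dwD (is_dwD d1 d2) d3) d4) d5.
rewrite -ev3 -ev4 -ev5.
have -> : acc' G (x t) (x1 t) (x2 t) (x3 t) + chr (G (x t)) (x1 t) (acc G (x t) (x1 t) (x2 t))
  = j t by [].
have -> : x2 t + chr (G (x t)) (x1 t) (x1 t) = acc G (x t) (x1 t) (x2 t) by [].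
have -> : h1 t + chr (G (x t)) (x1 t) (h t) = cvel G (x t) (x1 t) (h t) (h1 t) by [].
congr is_dw; rewrite /vlagr cjerkE -/(j t).
have C := caccE; move: C.
set w2 := h2 t + _ + chr _ _ (cvel _ _ _ _ _).
set dq := vacc' _ _ _ _ _ _ _ _ + _ + _.
set q := cacc _ _ _ _ _ _ _; set w1 := cvel _ _ _ _ _; set A := acc _ _ _ _ => C.
have pr w u v z := Rm_pair oU (mc_G H) (mc_g H) (mc_Gsym H) (mc_gsym H) (mc_compat H) w u v z Ux.
have ipC := bilinC _ _ (mc_gsym H Ux).
have P1 : bilin (g (x t)) (euler G e1 e2 (x t) (x1 t) A (j t) (v3 t) (v5 t)) (h t) =
  e2 * bilin (g (x t)) (v3 t) (h t) + e2 * bilin (g (x t)) (Rm G (x t) A (x1 t) (x1 t)) (h t)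
  - e1 * bilin (g (x t)) A (h t) - (bilin (g (x t)) (v5 t) (h t)
  + bilin (g (x t)) (Rm G (x t) A (j t) (x1 t)) (h t)
  + bilin (g (x t)) (Rm G (x t) (v3 t) (x1 t) (x1 t)) (h t)).
  by rewrite /euler !(bilinDl, bilinNl, bilinZl).
have P2 := pr A (x1 t) (x1 t) (h t).
(* Pair symmetry produces R(h, x') of the jerk against the acceleration. The commutator has these
   two exchanged, hence the extra skew-symmetry and its sign. *)
have P3 := pr A (j t) (x1 t) (h t).
rewrite (Rm_skew34 oU (mc_G H) (mc_g H) (mc_gsym H) (mc_compat H) (h t) _ _ _ Ux) in P3.
have P4 := pr (v3 t) (x1 t) (x1 t) (h t).
rewrite P1 P2 P3 P4 (ipC A (h t)) (ipC (v3 t) (h t)) (ipC (v5 t) (h t)).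
have E1 : bilin (g (x t)) q A = bilin (g (x t)) w2 A + bilin (g (x t)) (Rm G (x t) (h t) (x1 t) (x1 t)) A.
  by rewrite C bilinDl.
have E2 : bilin (g (x t)) q (v3 t) = bilin (g (x t)) w2 (v3 t) + bilin (g (x t)) (Rm G (x t) (h t) (x1 t) (x1 t)) (v3 t).
  by rewrite C bilinDl.
rewrite E1 E2 bilinDl -![_ *: _]/(_ * _).
by ring.
Qed.

End Boundary.

(** * Integrals of continuous functions on closed intervals *)

Section Integration.
Variable R : realType.
Implicit Types (a b t : R).

Lemma CkI0P (V : normedModType R) a b (f : R -> V) :
  CkI a b 0 f <-> {within `[a, b], continuous f}.
Proof.
split=> h; first by apply/subspace_continuousP => t; rewrite /= in_itv/=; exact: h.
by move/subspace_continuousP : h => h t tab; apply: h; rewrite /= in_itv.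
Qed.

Lemma CkI0_bounded a b (f : R -> R) : a <= b -> CkI a b 0 (f : R -> R^o) ->
  exists C, forall t, a <= t <= b -> `|f t| <= C.
Proof.
move=> ab h.
have h' : {within `[a, b], continuous (fun t => `|f t|)}.
  by apply/(@CkI0P R^o) => t tab; apply: cvg_norm; exact: h.
have [c _ hc] := EVT_max ab h'; exists `|f c| => t tab.
by apply: hc; rewrite in_itv.
Qed.

Lemma CkI0_integrable a b (f : R -> R) : CkI a b 0 (f : R -> R^o) ->
  (@lebesgue_measure R).-integrable `[a, b] (EFin \o f).
Proof.
by move=> /CkI0P h; apply: continuous_compact_integrable => //; exact: segment_compact.
Qed.

Lemma Rintegral_is_dw a b (F f : R -> R) : a < b ->
  (forall t, a <= t <= b -> is_dw a b (F : R -> R^o) t (f t)) ->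
  CkI a b 0 (f : R -> R^o) ->
  (\int[lebesgue_measure]_(t in `[a, b]) f t)%R = F b - F a.
Proof.
move=> ab hF hf.
have D t : a < t < b -> is_derive t (1:R) F (f t).
  by move=> tab; apply/(is_dw_is_derive _ _ tab); apply: hF; move/andP : tab => [? ?]; rewrite !ltW.
rewrite /Rintegral (@continuous_FTC2 _ f F)//; first exact/CkI0P.
- have cF : CkI a b 0 (F : R -> R^o) by move=> t /hF/is_dw_cvg.
  have /CkI0P/(continuous_within_itvP _ ab)[_ c1 c2] := cF; split => //.
  by move=> t; rewrite in_itv/= => /D[].
- by move=> t; rewrite in_itv/= derive1E => /D[].
Qed.

Lemma Rintegral_split a m b (f : R -> R) : a <= m -> m <= b ->
  (@lebesgue_measure R).-integrable `[a, b] (EFin \o f) ->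
  (\int[lebesgue_measure]_(t in `[a, b]) f t =
   \int[lebesgue_measure]_(t in `[a, m]) f t + \int[lebesgue_measure]_(t in `[m, b]) f t)%R.
Proof.
move=> am mb hf; apply/eqP; rewrite addrC -subr_eq; apply/eqP.
rewrite Rintegral_itvB ?bnd_simp//.
rewrite Rintegral_itv_obnd_cbnd//; apply: integrableS hf => //.
move=> t; rewrite /= !in_itv/= => /andP[t1 ->]; rewrite andbT.
by rewrite (le_trans am)// ltW.
Qed.

Lemma Rintegral_eq_itv a b (f g : R -> R) : (forall t, a <= t <= b -> f t = g t) ->
  (\int[lebesgue_measure]_(t in `[a, b]) f t = \int[lebesgue_measure]_(t in `[a, b]) g t)%R.
Proof. by move=> fg; apply: eq_Rintegral => t; rewrite inE/= in_itv/=; exact: fg. Qed.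

End Integration.

(** * Covariant derivatives along a coordinate curve and integration by parts *)

Section CovI.
Variables (R : realType) (n : nat).

(** Both derivatives are relative to [[a, b]], so two smooth pieces that meet at a corner have their
    own values there. *)
Definition covI a b (G : 'rV[R]_n -> 'I_n -> 'M[R]_n) (x V : R -> 'rV[R]_n) (t : R) :=
  derive_within a b V t + chr (G (x t)) (derive_within a b x t) (V t).

Definition cvI a b G (x : R -> 'rV[R]_n) k := iter k (covI a b G x) (derive_within a b x).

Variables (U : set 'rV[R]_n) (G : 'rV[R]_n -> 'I_n -> 'M[R]_n) (g : 'rV[R]_n -> 'M[R]_n).
Hypothesis H : metric_chart U G g.
Variables (a b : R).
Hypothesis ab : a < b.
Variable x : R -> 'rV[R]_n.
Hypothesis xU : forall t, a <= t <= b -> U (x t).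
Let oU := mc_open H.

Lemma CkI_chrG m u v : CkI a b m x -> CkI a b m u -> CkI a b m v ->
  CkI a b m (fun t => chr (G (x t)) (u t) (v t)).
Proof.
by move=> hx hu hv; apply: CkI_chr => // k i j; exact: (CkI_mx oU i j (mc_G H k)).
Qed.

Lemma CkI_g m u v : CkI a b m x -> CkI a b m u -> CkI a b m v ->
  CkI a b m (fun t => bilin (g (x t)) (u t) (v t) : R^o).
Proof.
by move=> hx hu hv; apply: CkI_bilin => // i j; exact: (CkI_mx oU i j (mc_g H)).
Qed.

Lemma CkI_chrdG m w u v : CkI a b m x -> CkI a b m w -> CkI a b m u -> CkI a b m v ->
  CkI a b m (fun t => chr (dG G (w t) (x t)) (u t) (v t)).
Proof.
by move=> hx hw hu hv; apply: CkI_chr => // k i j; exact: (CkI_dmx oU i j (mc_G H k)).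
Qed.

Lemma CkI_chrddG m w w' u v : CkI a b m x -> CkI a b m w -> CkI a b m w' ->
  CkI a b m u -> CkI a b m v ->
  CkI a b m (fun t => chr (ddG G (w t) (w' t) (x t)) (u t) (v t)).
Proof.
move=> hx hw hw' hu hv; apply: CkI_chr => // k i j.
(* Expanding [w] in the basis leaves one derivative, in the moving direction [w'], of matrix fields
   that no longer depend on time except through the point. *)
apply: (@CkI_eq _ _ _ _ _ (fun t => \sum_l w t 0 l *
    dmx (dmx (fun y => G y k) (delta_mx 0 l)) (w' t) (x t) i j : R^o)).
  move=> t /xU Ux; rewrite /ddG (dmxC oU _ _ (mc_G H k) Ux).
  rewrite (dmx_sum oU _ _ _ (dmx_smooth _ (mc_G H k)) Ux).
  by apply: eq_bigr => l _; rewrite (dmxC oU _ _ (mc_G H k) Ux).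
apply: (@CkI_sum _ R^o) => l _; apply: CkIM; first by move/CkI_rVP : hw; exact.
by apply: (CkI_dmx oU) => //; exact: dmx_smooth (mc_G H k).
Qed.

Lemma CkI_covI m V : CkI a b m.+1 x -> CkI a b m.+1 V -> CkI a b m (covI a b G x V).
Proof.
move=> hx hV; apply: CkID; first by case: (CkI_derive ab hV).
apply: CkI_chrG; [exact: CkI_le hx|by case: (CkI_derive ab hx)|exact: CkI_le hV].
Qed.

Lemma CkI_cvI m k : CkI a b (k + m).+1 x -> CkI a b m (cvI a b G x k).
Proof.
elim: k m => [|k IH] m hx /=; first by case: (CkI_derive ab hx).
apply: CkI_covI; first by apply: CkI_le hx; rewrite ltnS leq_addl.
by apply: IH; rewrite addnS.
Qed.

Let xs k := iter k (derive_within a b) x.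

Lemma cvI2E t : CkI a b 3 x -> a <= t <= b ->
  cvI a b G x 2 t = jerk G (x t) (xs 1 t) (xs 2 t) (xs 3 t).
Proof.
move=> hx tab; rewrite [LHS]/covI /jerk; congr (_ + _).
apply: is_dwE => //.
have d j : (j < 3)%N -> is_dw a b (xs j) t (xs j.+1 t).
  by move=> j3; exact: CkI_iter_dw hx j3 tab.
exact: (is_dw_acc H xU tab (d 0 isT) (d 1 isT) (d 2 isT)).
Qed.

Variables (e1 e2 : R) (h h1 h2 h3 : R -> 'rV[R]_n).
Hypotheses (dh : forall t, a <= t <= b -> is_dw a b h t (h1 t))
  (dh1 : forall t, a <= t <= b -> is_dw a b h1 t (h2 t))
  (dh2 : forall t, a <= t <= b -> is_dw a b h2 t (h3 t))
  (ch3 : CkI a b 0 h3).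

Let ch : [/\ CkI a b 0 h, CkI a b 0 h1 & CkI a b 0 h2].
Proof. by split; move=> t tab; [move: (dh tab)|move: (dh1 tab)|move: (dh2 tab)] => /is_dw_cvg. Qed.

Lemma CkI_acc x1 x2 : CkI a b 0 x -> CkI a b 0 x1 -> CkI a b 0 x2 ->
  CkI a b 0 (fun t => acc G (x t) (x1 t) (x2 t)).
Proof. by move=> c c1 c2; exact: (CkID c2 (CkI_chrG c c1 c1)). Qed.

Lemma CkI_acc' x1 x2 x3 : CkI a b 0 x -> CkI a b 0 x1 -> CkI a b 0 x2 -> CkI a b 0 x3 ->
  CkI a b 0 (fun t => acc' G (x t) (x1 t) (x2 t) (x3 t)).
Proof.
move=> c c1 c2 c3.
exact: (CkID c3 (CkID (CkID (CkI_chrdG c c1 c1 c1) (CkI_chrG c c2 c1)) (CkI_chrG c c1 c2))).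
Qed.

Lemma CkI_jerk x1 x2 x3 : CkI a b 0 x -> CkI a b 0 x1 -> CkI a b 0 x2 -> CkI a b 0 x3 ->
  CkI a b 0 (fun t => jerk G (x t) (x1 t) (x2 t) (x3 t)).
Proof.
move=> c c1 c2 c3; exact: (CkID (CkI_acc' c c1 c2 c3) (CkI_chrG c c1 (CkI_acc c c1 c2))).
Qed.

Lemma CkI_vacc x1 : CkI a b 0 x -> CkI a b 0 x1 ->
  CkI a b 0 (fun t => vacc G (x t) (x1 t) (h t) (h1 t) (h2 t)).
Proof.
move=> c c1; have [k0 k1 k2] := ch.
exact: (CkID k2 (CkID (CkID (CkI_chrdG c k0 c1 c1) (CkI_chrG c k1 c1)) (CkI_chrG c c1 k1))).
Qed.

Lemma CkI_vjerk x1 x2 : CkI a b 0 x -> CkI a b 0 x1 -> CkI a b 0 x2 ->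
  CkI a b 0 (fun t => vjerk G (x t) (x1 t) (x2 t) (h t) (h1 t) (h2 t) (h3 t)).
Proof.
move=> c c1 c2; have [k0 k1 k2] := ch; have cA := CkI_acc c c1 c2.
have t1 := CkID (CkID (CkID (CkI_chrddG c c1 k0 c1 c1) (CkI_chrdG c k1 c1 c1))
  (CkI_chrdG c c1 k1 c1)) (CkI_chrdG c c1 c1 k1).
have t2 := CkID (CkID (CkI_chrdG c k0 c2 c1) (CkI_chrG c k2 c1)) (CkI_chrG c c2 k1).
have t3 := CkID (CkID (CkI_chrdG c k0 c1 c2) (CkI_chrG c k1 c2)) (CkI_chrG c c1 k2).
have t4 := CkID (CkID (CkI_chrdG c k0 c1 cA) (CkI_chrG c k1 cA)) (CkI_chrG c c1 (CkI_vacc c c1)).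
exact: (CkID (CkID ch3 (CkID (CkID t1 t2) t3)) t4).
Qed.

Lemma CkI_vlagr x1 x2 x3 : CkI a b 0 x -> CkI a b 0 x1 -> CkI a b 0 x2 -> CkI a b 0 x3 ->
  CkI a b 0 (fun t => vlagr G g e1 e2 (x t) (x1 t) (x2 t) (x3 t)
    (h t) (h1 t) (h2 t) (h3 t) : R^o).
Proof.
move=> c c1 c2 c3; have [k0 k1 k2] := ch; have cA := CkI_acc c c1 c2.
have cJ := CkI_jerk c c1 c2 c3.
have cW : CkI a b 0 (fun t => cvel G (x t) (x1 t) (h t) (h1 t)).
  by apply: (CkID k1); exact: (CkI_chrG c c1 k0).
have cQ : CkI a b 0 (fun t => cacc G (x t) (x1 t) (x2 t) (h t) (h1 t) (h2 t)).
  by apply: (CkID (CkI_vacc c c1)); exact: (CkI_chrG c k0 cA).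
have cK : CkI a b 0 (fun t => cjerk G (x t) (x1 t) (x2 t) (x3 t) (h t) (h1 t) (h2 t) (h3 t)).
  by apply: (CkID (CkI_vjerk c c1 c2)); exact: (CkI_chrG c k0 cJ).
exact: (CkID (CkID (CkIZ e1 (CkI_g c cW c1)) (CkIZ e2 (CkI_g c cQ cA)))
  (CkI_g c cK cJ)).
Qed.

Lemma CkI_Rm u v w : CkI a b 0 x -> CkI a b 0 u -> CkI a b 0 v -> CkI a b 0 w ->
  CkI a b 0 (fun t => Rm G (x t) (u t) (v t) (w t)).
Proof.
move=> c c1 c2 c3.
exact: (CkIB (CkID (CkI_chrdG c c1 c2 c3) (CkI_chrG c c1 (CkI_chrG c c2 c3)))
  (CkID (CkI_chrdG c c2 c1 c3) (CkI_chrG c c2 (CkI_chrG c c1 c3)))).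
Qed.

Lemma CkI_euler v0 v1 v2 v3 v5 : CkI a b 0 x -> CkI a b 0 v0 -> CkI a b 0 v1 ->
  CkI a b 0 v2 -> CkI a b 0 v3 -> CkI a b 0 v5 ->
  CkI a b 0 (fun t => euler G e1 e2 (x t) (v0 t) (v1 t) (v2 t) (v3 t) (v5 t)).
Proof.
move=> c c0 c1 c2 c3 c5.
exact: (CkIB (CkIB (CkID (CkIZ e2 c3) (CkIZ e2 (CkI_Rm c c1 c0 c0)))
    (CkIZ e1 c1))
  (CkID (CkID c5 (CkI_Rm c c1 c2 c0)) (CkI_Rm c c3 c0 c0))).
Qed.

Definition eulerI a b e1 e2 y t := let V := cvI a b G y in
  euler G e1 e2 (y t) (V 0 t) (V 1 t) (V 2 t) (V 3 t) (V 5 t).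

Definition bdryI a b e1 e2 y (h h1 h2 : R -> 'rV[R]_n) t :=
  let D := fun k => iter k (derive_within a b) y in
  bdry G g e1 e2 (y t) (D 1 t) (D 2 t) (D 3 t) (cvI a b G y 3 t)
     (cvI a b G y 4 t) (h t) (h1 t) (h2 t).

Hypothesis hx : CkI a b 6 x.

Let cx k m : (k + m <= 6)%N -> CkI a b m (xs k).
Proof. by move=> km; apply: CkI_iter => //; exact: CkI_le hx. Qed.

Let cV k m : (k + m <= 5)%N -> CkI a b m (cvI a b G x k).
Proof. by move=> km; apply: CkI_cvI; exact: CkI_le hx. Qed.

Lemma CkI_eulerI : CkI a b 0 (eulerI a b e1 e2 x).
Proof.
exact: (CkI_euler (@cx 0 0 isT) (@cV 0 0 isT) (@cV 1 0 isT) (@cV 2 0 isT) (@cV 3 0 isT)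
  (@cV 5 0 isT)).
Qed.

(** [is_dw_bdry] is integrated. The boundary expression contains V_4, whose derivative takes six
    derivatives of [x]. *)
Lemma int_vlagr :
  (\int[lebesgue_measure]_(t in `[a, b]) vlagr G g e1 e2 (x t) (xs 1 t) (xs 2 t) (xs 3 t)
      (h t) (h1 t) (h2 t) (h3 t) =
   bdryI a b e1 e2 x h h1 h2 b - bdryI a b e1 e2 x h h1 h2 a +
   \int[lebesgue_measure]_(t in `[a, b]) bilin (g (x t)) (eulerI a b e1 e2 x t) (h t))%R.
Proof.
have [k0 k1 k2] := ch.
have cL : CkI a b 0 (fun t => vlagr G g e1 e2 (x t) (xs 1 t) (xs 2 t) (xs 3 t)
    (h t) (h1 t) (h2 t) (h3 t) : R^o).
  by apply: CkI_vlagr; [exact: (@cx 0 0)|exact: cx|exact: cx|exact: cx].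
have cE : CkI a b 0 (fun t => bilin (g (x t)) (eulerI a b e1 e2 x t) (h t) : R^o).
  by apply: CkI_g => //; [exact: (@cx 0 0)|exact: CkI_eulerI].
apply/eqP; rewrite -subr_eq -RintegralB//; last 2 first.
- exact: CkI0_integrable.
- exact: CkI0_integrable.
rewrite (Rintegral_is_dw (F := bdryI a b e1 e2 x h h1 h2) ab)//; last first.
  exact: (@CkIB _ R^o).
move=> t tab.
have d j : (j < 6)%N -> is_dw a b (xs j) t (xs j.+1 t).
  by move=> j6; exact: CkI_iter_dw hx j6 tab.
have dV k : (k <= 4)%N -> is_dw a b (cvI a b G x k) t (derive_within a b (cvI a b G x k) t).
  move=> k4; have cVk : CkI a b 1 (cvI a b G x k) by apply: cV; rewrite addn1 ltnS.
  by have [+ _] := CkI_derive ab cVk; apply.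
have J s : a <= s <= b -> cvI a b G x 2 s = jerk G (x s) (xs 1 s) (xs 2 s) (xs 3 s).
  by move=> sab; apply: cvI2E => //; exact: CkI_le hx.
have dJ : is_dw a b (fun s => jerk G (x s) (xs 1 s) (xs 2 s) (xs 3 s)) t
    (derive_within a b (cvI a b G x 2) t).
  by apply: is_dw_eq (dV 2 isT) => // s; rewrite in_itv; exact: J.
have := is_dw_bdry H xU tab (d 0 isT) (d 1 isT) (d 2 isT) (dh tab) (dh1 tab) (dh2 tab)
  (e1 := e1) (e2 := e2) (v5 := cvI a b G x 5) dJ (dV 3 isT) (dV 4 isT).
rewrite -!J//; apply => //.
Qed.

End CovI.

(** * Uniform first-order expansions *)

Section UExp.
Variables (R : realType) (a b : R).
Hypothesis ab : a <= b.

(** A single constant controls both coefficients and the remainder for all [t]. Bounding the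
    coefficients makes the notion stable under products, and uniformity lets the expansion be
    integrated. *)
Definition uexp (F : R -> R -> R) (F0 F1 : R -> R) := exists C,
  (forall t, a <= t <= b -> `|F0 t| <= C /\ `|F1 t| <= C) /\
  \forall s \near 0, forall t, a <= t <= b -> `|F s t - F0 t - s * F1 t| <= C * s ^+ 2.

Let bound_ge0 (f : R -> R) C : (forall t, a <= t <= b -> `|f t| <= C) -> 0 <= C.
Proof. by move=> h; apply: le_trans (h a _) => //; rewrite lexx. Qed.

Lemma uexp_eq (F G : R -> R -> R) F0 F1 G0 G1 :
  (\forall s \near 0, forall t, a <= t <= b -> F s t = G s t) ->
  (forall t, a <= t <= b -> F0 t = G0 t) -> (forall t, a <= t <= b -> F1 t = G1 t) ->
  uexp F F0 F1 -> uexp G G0 G1.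
Proof.
move=> h h0 h1 [C [c1 c2]]; exists C; split=> [t tab|].
  by rewrite -h0// -h1//; exact: c1.
by apply: filterS2 h c2 => s h c2 t tab; rewrite -h// -h0// -h1//; exact: c2.
Qed.

Lemma uexp_affine (x h : R -> R) : CkI a b 0 (x : R -> R^o) -> CkI a b 0 (h : R -> R^o) ->
  uexp (fun s t => x t + s * h t) x h.
Proof.
move=> /(CkI0_bounded ab)[C c] /(CkI0_bounded ab)[D d].
have C0 := bound_ge0 c; have D0 := bound_ge0 d.
exists (C + D); split=> [t tab|].
  by split; [rewrite (le_trans (c _ tab))// lerDl|rewrite (le_trans (d _ tab))// lerDr].
near=> s => t tab; rewrite (_ : _ - _ - _ = 0); last by ring.
by rewrite normr0 mulr_ge0 ?addr_ge0 ?sqr_ge0.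
Unshelve. all: by end_near. Qed.

Lemma uexpD F F0 F1 G G0 G1 : uexp F F0 F1 -> uexp G G0 G1 ->
  uexp (fun s t => F s t + G s t) (fun t => F0 t + G0 t) (fun t => F1 t + G1 t).
Proof.
move=> [C [c1 c2]] [D [d1 d2]]; exists (C + D); split=> [t tab|].
  by have [? ?] := c1 _ tab; have [? ?] := d1 _ tab; split;
    rewrite (le_trans (ler_normD _ _))// lerD.
apply: filterS2 c2 d2 => s c2 d2 t tab.
have -> : F s t + G s t - (F0 t + G0 t) - s * (F1 t + G1 t) =
  (F s t - F0 t - s * F1 t) + (G s t - G0 t - s * G1 t) by ring.
by rewrite (le_trans (ler_normD _ _))// mulrDl lerD ?c2 ?d2.
Qed.

Lemma uexpM F F0 F1 G G0 G1 : uexp F F0 F1 -> uexp G G0 G1 ->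
  uexp (fun s t => F s t * G s t) (fun t => F0 t * G0 t)
    (fun t => F1 t * G0 t + F0 t * G1 t).
Proof.
move=> [C [c1 c2]] [D [d1 d2]].
have C0 : 0 <= C by apply: (@bound_ge0 F0) => t /c1[].
have D0 : 0 <= D by apply: (@bound_ge0 G0) => t /d1[].
have CD : 0 <= C * D by rewrite mulr_ge0.
(* The remainder of a product splits into six terms, each at most [C * D * s ^+ 2] once [s] is at
   most 1 in absolute value. *)
exists (6 * (C * D)); split=> [t tab|].
  have [f0 f1] := c1 _ tab; have [g0 g1] := d1 _ tab; split.
    rewrite normrM (le_trans (ler_pM _ _ f0 g0))//; lra.
  rewrite (le_trans (ler_normD _ _))// !normrM.
  rewrite (le_trans (lerD (ler_pM _ _ f1 g0) (ler_pM _ _ f0 g1)))//; lra.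
have s1 : \forall s \near (0:R), `|s| <= 1.
  by apply/nbhs_ballP; exists 1 => //= s; rewrite /ball/= sub0r normrN => /ltW.
apply: filterS3 s1 c2 d2 => s s1 c2 d2 t tab.
have [f0 f1] := c1 _ tab; have [g0 g1] := d1 _ tab.
move: (c2 t tab) (d2 t tab); set r := F s t - _ - _; set q := G s t - _ - _ => hr hq.
have -> : F s t * G s t - F0 t * G0 t - s * (F1 t * G0 t + F0 t * G1 t) =
  s ^+ 2 * (F1 t * G1 t) + F0 t * q + G0 t * r + s * F1 t * q + s * G1 t * r + r * q.
  by rewrite /r /q; ring.
have s20 : 0 <= s ^+ 2 by exact: sqr_ge0.
have s21 : s ^+ 2 <= 1 by rewrite -[s ^+ 2]ger0_norm// normrX expr_le1.
have k1 : `|s ^+ 2 * (F1 t * G1 t)| <= C * D * s ^+ 2.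
  rewrite normrM (ger0_norm s20) [leRHS]mulrC ler_wpM2l// normrM.
  exact: ler_pM.
have k2 : `|F0 t * q| <= C * D * s ^+ 2 by rewrite normrM -mulrA ler_pM.
have k3 : `|G0 t * r| <= C * D * s ^+ 2.
  by rewrite normrM [C * D]mulrC -mulrA ler_pM.
have k4 : `|s * F1 t * q| <= C * D * s ^+ 2.
  by rewrite normrM -mulrA ler_pM// normrM -[C]mul1r ler_pM.
have k5 : `|s * G1 t * r| <= C * D * s ^+ 2.
  by rewrite normrM [C * D]mulrC -mulrA ler_pM// normrM -[D]mul1r ler_pM.
have k6 : `|r * q| <= C * D * s ^+ 2.
  rewrite normrM -mulrA ler_pM// (le_trans hr)//.
  by rewrite -[leRHS]mulr1 ler_wpM2l.
have := ler_normD (s ^+ 2 * (F1 t * G1 t) + F0 t * q + G0 t * r + s * F1 t * q + s * G1 t * r) (r * q).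
have := ler_normD (s ^+ 2 * (F1 t * G1 t) + F0 t * q + G0 t * r + s * F1 t * q) (s * G1 t * r).
have := ler_normD (s ^+ 2 * (F1 t * G1 t) + F0 t * q + G0 t * r) (s * F1 t * q).
have := ler_normD (s ^+ 2 * (F1 t * G1 t) + F0 t * q) (G0 t * r).
have := ler_normD (s ^+ 2 * (F1 t * G1 t)) (F0 t * q).
rewrite (_ : 6 * (C * D) * s ^+ 2 = 6 * (C * D * s ^+ 2)); last by ring.
clear - k1 k2 k3 k4 k5 k6; move: (C * D * s ^+ 2) k1 k2 k3 k4 k5 k6 => K; lra.
Qed.

Lemma uexp_cst (c : R) : uexp (fun _ _ => c) (fun=> c) (fun=> 0).
Proof.
exists `|c|; split=> [t _|]; first by rewrite normr0.
by near=> s => t _; rewrite subrr mulr0 subr0 normr0 mulr_ge0 ?sqr_ge0.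
Unshelve. all: by end_near. Qed.

Lemma uexp_sum (I : Type) (r : seq I) F F0 F1 : (forall i, uexp (F i) (F0 i) (F1 i)) ->
  uexp (fun s t => \sum_(i <- r) F i s t) (fun t => \sum_(i <- r) F0 i t)
    (fun t => \sum_(i <- r) F1 i t).
Proof.
move=> h; elim: r => [|i r IH].
  apply: uexp_eq (uexp_cst 0) => [|t _|t _]; rewrite ?big_nil//.
  by near=> s => t _; rewrite big_nil.
apply: uexp_eq (uexpD (h i) IH) => [|t _|t _]; rewrite ?big_cons//.
by near=> s => t _; rewrite big_cons.
Unshelve. all: by end_near. Qed.

Lemma uexpZ (c : R) F F0 F1 : uexp F F0 F1 ->
  uexp (fun s t => c * F s t) (fun t => c * F0 t) (fun t => c * F1 t).
Proof.
move=> h; apply: uexp_eq (uexpM (uexp_cst c) h) => [|//|t _]; last by rewrite mul0r add0r.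
by near=> s.
Unshelve. all: by end_near. Qed.

Variables (n : nat).

Definition uexpv (V : R -> R -> 'rV[R]_n) (V0 V1 : R -> 'rV[R]_n) := forall k, uexp (fun s t => V s t 0 k) (fun t => V0 t 0 k)
  (fun t => V1 t 0 k).

Lemma uexpvD V V0 V1 W W0 W1 : uexpv V V0 V1 -> uexpv W W0 W1 ->
  uexpv (fun s t => V s t + W s t) (fun t => V0 t + W0 t) (fun t => V1 t + W1 t).
Proof.
move=> h1 h2 k; apply: uexp_eq (uexpD (h1 k) (h2 k)) => [|t _|t _]; rewrite ?mxE//.
by near=> s => t _; rewrite mxE.
Unshelve. all: by end_near. Qed.

Lemma uexp_bilin (A : R -> R -> 'M[R]_n) (A0 A1 : R -> 'M[R]_n) V V0 V1 W W0 W1 :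
  (forall i j, uexp (fun s t => A s t i j) (fun t => A0 t i j) (fun t => A1 t i j)) ->
  uexpv V V0 V1 -> uexpv W W0 W1 ->
  uexp (fun s t => bilin (A s t) (V s t) (W s t)) (fun t => bilin (A0 t) (V0 t) (W0 t))
   (fun t => bilin (A1 t) (V0 t) (W0 t) + bilin (A0 t) (V1 t) (W0 t)
      + bilin (A0 t) (V0 t) (W1 t)).
Proof.
move=> hA hV hW.
apply: uexp_eq (uexp_sum (index_enum 'I_n) (fun j => uexpM (uexp_sum (index_enum 'I_n)
  (fun i => uexpM (hV i) (hA i j))) (hW j))) => [|t _|t _].
- by near=> s => t _; rewrite bilinE.
- by rewrite bilinE.
- rewrite !bilinE -!big_split/=; apply: eq_bigr => j _.
  by rewrite big_split/=; ring.
Unshelve. all: by end_near. Qed.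

Lemma uexp_chr (A : R -> R -> 'I_n -> 'M[R]_n) (A0 A1 : R -> 'I_n -> 'M[R]_n) V V0 V1 W W0 W1 :
  (forall k i j, uexp (fun s t => A s t k i j) (fun t => A0 t k i j) (fun t => A1 t k i j)) ->
  uexpv V V0 V1 -> uexpv W W0 W1 ->
  uexpv (fun s t => chr (A s t) (V s t) (W s t)) (fun t => chr (A0 t) (V0 t) (W0 t))
   (fun t => chr (A1 t) (V0 t) (W0 t) + chr (A0 t) (V1 t) (W0 t)
      + chr (A0 t) (V0 t) (W1 t)).
Proof.
move=> hA hV hW k.
apply: uexp_eq (uexp_bilin (hA k) hV hW) => [|t _|t _]; rewrite ?rv_entryE ?chrE//.
by near=> s => t _; rewrite chrE.
Unshelve. all: by end_near. Qed.

Variables (S : set 'rV[R]_n) (x h : R -> 'rV[R]_n).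
Hypotheses (oS : open S) (xS : forall t, a <= t <= b -> S (x t))
  (cx : CkI a b 0 x) (ch : CkI a b 0 h).

(** Compactness of [[a, b]] in its near-covering form, along the filter of pairs (s, C) with [s]
    near 0 and [C] near infinity. Having the bound as a variable of the filter makes one constant
    serve all times. *)
Lemma tube (phi : 'rV[R]_n -> R^o) : smooth_on S phi ->
  exists C, \forall s \near 0, forall t, a <= t <= b ->
    S (x t + s *: h t) /\ `|phi (x t + s *: h t)| <= C.
Proof.
move=> sphi.
have cpt : compact `[a, b] := @segment_compact _ a b.
have /compact_near_coveringP/near_covering_withinP cov := cpt.
pose F := filter_prod (nbhs (0:R)) (pinfty_nbhs R).
have : \forall p \near F, `[a, b]%classic `<=` (fun t => a <= t <= b ->
    S (x t + p.1 *: h t) /\ `|phi (x t + p.1 *: h t)| <= p.2).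
  apply: cov => t; rewrite /= in_itv/= => tab.
  have cphi : {for x t, continuous phi} := smooth_cvg sphi (xS tab).
  have N : nbhs (x t) (S `&` [set y | `|phi y| <= `|phi (x t)| + 1]).
    apply: filterI; first by apply: open_nbhs_nbhs; split => //; exact: xS.
    have /cvgrPdist_le/(_ 1 ltr01) := cphi.
    apply: filterS => y; rewrite distrC => hy /=.
    by rewrite -[phi y](subrK (phi (x t))) (le_trans (ler_normD _ _))// addrC lerD2l.
  move/nbhs_ballP : N => [d /= d0 hd].
  have d2 : 0 < d / 2 by lra.
  have m0 : 0 < `|h t| + 1 by rewrite ltr_wpDl.
  have nx : \forall t' \near t, a <= t' <= b -> `|x t - x t'| < d / 2 /\ `|h t'| <= `|h t| + 1.
    have /cvgrPdist_lt/(_ _ d2) := cx tab; rewrite near_withinE => n1.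
    have /cvgrPdist_lt/(_ _ ltr01) := ch tab; rewrite near_withinE => n2.
    apply: filterS2 n1 n2 => t' n1 n2 tab'; split; first by apply: n1; rewrite /= in_itv.
    have := n2 _; rewrite /= in_itv => /(_ tab') => k.
    rewrite -[h t'](subKr (h t)) (le_trans (ler_normB _ _))// lerD2l ltW//.
  have ns : \forall p \near F, `|p.1| < d / 2 / (`|h t| + 1) /\ `|phi (x t)| + 1 <= p.2.
    exists ([set s | `|s| < d / 2 / (`|h t| + 1)], [set C | `|phi (x t)| + 1 <= C]).
      split => /=; last by apply: nbhs_pinfty_ge; rewrite num_real.
      apply/nbhs_ballP; exists (d / 2 / (`|h t| + 1)) => /=; first by rewrite divr_gt0.
      by move=> s; rewrite /ball/= sub0r normrN.
    by move=> [s C] [].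
  near=> t' p => /= tI _.
  have tab' : a <= t' <= b by move: tI; rewrite in_itv.
  have [p1 p2] : `|p.1| < d / 2 / (`|h t| + 1) /\ `|phi (x t)| + 1 <= p.2 by near: p.
  have [x1 x2] : `|x t - x t'| < d / 2 /\ `|h t'| <= `|h t| + 1.
    by move: tab'; near: t'.
  have B : ball (x t) d (x t' + p.1 *: h t').
    rewrite -ball_normE /ball_/= opprD addrA (le_lt_trans (ler_normB _ _))//.
    rewrite (splitr d) ltrD// normrZ.
    apply: (@le_lt_trans _ _ (`|p.1| * (`|h t| + 1))); first by rewrite ler_wpM2l.
    by rewrite -ltr_pdivlMr.
  by have [B1 B2] := hd _ B; split => //; rewrite (le_trans B2).
case=> -[A B] /= [A0 B0] AB.
have [C BC] : exists C, B C by apply: filter_ex B0.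
exists C; apply: filterS A0 => s As t tab.
by apply: (AB (s, C)) => //=; rewrite in_itv.
Unshelve. all: by end_near. Qed.

Lemma h_bounded : exists2 D, 0 <= D & forall t k, a <= t <= b -> `|h t 0 k| <= D.
Proof.
have H k : exists C, forall t, a <= t <= b -> `|h t 0 k| <= C.
  by apply: CkI0_bounded => //; move/CkI_rVP : ch; exact.
pose C k := sval (cid (H k)).
have CP k t : a <= t <= b -> `|h t 0 k| <= C k := svalP (cid (H k)) t.
exists (\sum_k `|C k|); first by apply: sumr_ge0.
move=> t k tab; rewrite (le_trans (CP _ _ tab))// (bigD1 k)//=.
by rewrite (le_trans (ler_norm _))// lerDl sumr_ge0.
Qed.

Lemma derive2_sumE (phi : 'rV[R]_n -> R^o) v y : smooth_on S phi -> S y ->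
  'D_v ('D_v phi) y = \sum_k v 0 k * \sum_l v 0 l *
     'D_(delta_mx 0 l) ('D_(delta_mx 0 k) phi) y.
Proof.
move=> sphi Sy; rewrite (derive_sumE _ oS (smooth_derive v sphi) Sy).
apply: eq_bigr => k _; congr (_ * _).
rewrite (schwarz _ _ oS sphi Sy).
exact: (derive_sumE _ oS (smooth_derive _ sphi) Sy).
Qed.

(** Taylor's formula by two uses of the mean value theorem. The second derivative along [h t] is a
    combination of second partial derivatives, each bounded on a tube around the curve, which gives
    the uniform bound [K2]. *)
Lemma uexp_smooth (phi : 'rV[R]_n -> R^o) : smooth_on S phi ->
  uexp (fun s t => phi (x t + s *: h t)) (fun t => phi (x t))
    (fun t => 'D_(h t) phi (x t)).
Proof.
have arith (s r p1 p0 P P0 Z K : R) : 0 <= r <= 1 -> p1 - p0 = s * P ->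
    P - P0 = r * s * Z -> `|Z| <= K -> `|p1 - p0 - s * P0| <= K * s ^+ 2.
  move=> /andP[r0 r1] E1 E2 hZ.
  have -> : p1 - p0 - s * P0 = r * (s ^+ 2 * Z) by rewrite E1 -mulrBr E2; ring.
  have s2 : 0 <= s ^+ 2 by exact: sqr_ge0.
  rewrite normrM (ger0_norm r0) normrM (ger0_norm s2) [leRHS]mulrC.
  apply: (@le_trans _ _ (s ^+ 2 * `|Z|)); first by rewrite ler_piMl// mulr_ge0 ?sqr_ge0.
  by rewrite ler_wpM2l ?sqr_ge0.
move=> sphi.
have [D D0 hD] := h_bounded.
have [C0 c0] := tube sphi.
have [T1 hT1] : exists C : 'I_n -> R, forall k, \forall s \near (0:R), forall t,
    a <= t <= b -> S (x t + s *: h t) /\ `|'D_(delta_mx 0 k) phi (x t + s *: h t)| <= C k.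
  pose T k := cid (tube (smooth_derive (delta_mx 0 k) sphi)).
  by exists (fun k => sval (T k)) => k; exact: svalP (T k).
have [T2 hT2] : exists C : 'I_n -> 'I_n -> R, forall k l, \forall s \near (0:R), forall t,
    a <= t <= b -> S (x t + s *: h t) /\
    `|'D_(delta_mx 0 l) ('D_(delta_mx 0 k) phi) (x t + s *: h t)| <= C k l.
  pose T k l := cid (tube (smooth_derive (delta_mx 0 l) (smooth_derive (delta_mx 0 k) sphi))).
  by exists (fun k l => sval (T k l)) => k l; exact: svalP (T k l).
pose Q (k l : 'I_n) (s : R) : Prop := forall t, a <= t <= b -> S (x t + s *: h t) /\
   `|'D_(delta_mx 0 l) ('D_(delta_mx 0 k) phi) (x t + s *: h t)| <= T2 k l.
have Q2 k l : \forall s \near (0:R), Q k l s by exact: hT2.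
have FA (P : 'I_n -> R -> Prop) : (forall l, \forall s \near (0:R), P l s) ->
   \forall s \near (0:R), forall l, P l s by move=> hP; refine (@filter_forall R _ P (nbhs (0:R)) _ hP).
have Q1 k : \forall s \near (0:R), forall l, Q k l s := FA _ (Q2 k).
have c2 : \forall s \near (0:R), forall k l, Q k l s := FA _ Q1.
pose K1 := \sum_k D * `|T1 k|.
pose K2 := \sum_k D * \sum_l D * `|T2 k l|.
have K10 : 0 <= K1 by apply: sumr_ge0 => k _; rewrite mulr_ge0.
have K20 : 0 <= K2.
  by apply: sumr_ge0 => k _; rewrite mulr_ge0//; apply: sumr_ge0 => l _; rewrite mulr_ge0.
have x0 t : x t + 0 *: h t = x t by rewrite scale0r addr0.
exists (`|C0| + K1 + K2); split.
  move=> t tab; split.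
    have [_] := nbhs_singleton c0 t tab; rewrite x0 => /le_trans; apply.
    by rewrite (le_trans (ler_norm _))// -addrA lerDl addr_ge0.
  rewrite (derive_sumE _ oS sphi (xS tab)) (le_trans (ler_norm_sum _ _ _))//.
  apply: (@le_trans _ _ K1); last by rewrite [_ + K1]addrC -addrA lerDl addr_ge0.
  apply: ler_sum => k _; rewrite normrM ler_pM ?hD//.
  have [_] := nbhs_singleton (hT1 k) t tab; rewrite x0 => /le_trans; apply.
  exact: ler_norm.
have /nbhs_ballP[e /= e0 he] := c2.
apply/nbhs_ballP; exists e => //= s; rewrite /ball/= sub0r normrN => se t tab.
have inS r : 0 <= r <= 1 -> S (x t + (r * s) *: h t) /\
    `|'D_(h t) ('D_(h t) phi) (x t + (r * s) *: h t)| <= K2.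
  move=> /andP[r0 r1].
  have rs : ball (0:R) e (r * s).
    rewrite /ball/= sub0r normrN normrM ger0_norm//.
    by rewrite (le_lt_trans _ se)// ler_piMl.
  have Sr : S (x t + (r * s) *: h t).
    (* Membership in [S] is read off the bound for some second partial derivative, which takes an
       index; in dimension 0 the point is [x t] itself. *)
    have [i|i] := leqP n 0; last by have [] := he _ rs (Ordinal i) (Ordinal i) t tab.
    suff -> : x t + (r * s) *: h t = x t by exact: xS.
    by apply/rowP => -[m mn]; move: (leq_trans mn i).
  split=> //; rewrite derive2_sumE// (le_trans (ler_norm_sum _ _ _))//.
  apply: ler_sum => k _; rewrite normrM ler_pM ?hD//.
  rewrite (le_trans (ler_norm_sum _ _ _))//.
  apply: ler_sum => l _; rewrite normrM ler_pM ?hD//.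
  by have [_ /le_trans] := he _ rs k l t tab; apply; exact: ler_norm.
have D1 (r : R) : 0 <= r <= 1 -> is_derive (x t + r *: (s *: h t)) (s *: h t) phi
    (s * 'D_(h t) phi (x t + r *: (s *: h t))).
  move=> r01; apply: is_deriveZdir; apply: smooth_derivable sphi _.
  by rewrite scalerA; have [] := inS _ r01.
have [r r01] : exists2 r : R, 0 <= r <= 1 & phi (x t + s *: h t) - phi (x t) =
    'D_(s *: h t) phi (x t + r *: (s *: h t)).
  by apply: (@MVT_line _ _ phi (x t) (s *: h t)) => r r01; have [D2 _] := D1 r r01; exact: D2.
have [_ ->] := D1 _ r01 => E1.
have D2 (r' : R) : 0 <= r' <= 1 -> is_derive (x t + r' *: ((r * s) *: h t)) ((r * s) *: h t)
    ('D_(h t) phi) ((r * s) * 'D_(h t) ('D_(h t) phi) (x t + r' *: ((r * s) *: h t))).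
  move=> r'01; apply: is_deriveZdir; apply: smooth_derivable (smooth_derive _ sphi) _.
  have rr : 0 <= r' * r <= 1.
    by move/andP : r01 r'01 => [? ?] /andP[? ?]; rewrite mulr_ge0//= mulr_ile1.
  by rewrite scalerA mulrA; have [] := inS _ rr.
have [r' r'01] : exists2 r' : R, 0 <= r' <= 1 &
    'D_(h t) phi (x t + (r * s) *: h t) - 'D_(h t) phi (x t) =
    'D_((r * s) *: h t) ('D_(h t) phi) (x t + r' *: ((r * s) *: h t)).
  apply: (@MVT_line _ _ ('D_(h t) phi) (x t) ((r * s) *: h t)) => r' r'01.
  by have [D3 _] := D2 r' r'01; exact: D3.
have [_ ->] := D2 _ r'01; rewrite [_ *: (_ *: _)]scalerA mulrA => E2.
rewrite scalerA in E1.
have rr : 0 <= r' * r <= 1.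
  by move/andP : r01 r'01 => [? ?] /andP[? ?]; rewrite mulr_ge0//= mulr_ile1.
have [_ hQ] := inS _ rr.
apply: (le_trans (arith _ _ _ _ _ _ _ _ r01 E1 E2 hQ)).
by rewrite ler_wpM2r ?sqr_ge0// lerDr addr_ge0.
Qed.

End UExp.

(** * Expansion of the Lagrangian along a linear variation *)

Section UExpLagrangian.
Variables (R : realType) (n : nat) (U : set 'rV[R]_n).
Variables (G : 'rV[R]_n -> 'I_n -> 'M[R]_n) (g : 'rV[R]_n -> 'M[R]_n).
Hypothesis H : metric_chart U G g.
Variables (a b : R) (x x1 x2 x3 h h1 h2 h3 : R -> 'rV[R]_n).
Hypothesis ab : a <= b.
Hypothesis xU : forall t, a <= t <= b -> U (x t).
Hypotheses (cx : CkI a b 0 x) (cx1 : CkI a b 0 x1) (cx2 : CkI a b 0 x2) (cx3 : CkI a b 0 x3).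
Hypotheses (ch : CkI a b 0 h) (ch1 : CkI a b 0 h1) (ch2 : CkI a b 0 h2) (ch3 : CkI a b 0 h3).
Let oU := mc_open H.
Let X s t := x t + s *: h t.

(** [tube] is applied to an entry of [A]; in dimension 0 there is none, and the space is a point. *)
Lemma tube_in A : smooth_mx U A -> \forall s \near (0:R), forall t, a <= t <= b -> U (X s t).
Proof.
move=> sA; have [n0|n0] := leqP n 0.
  near=> s => t tab; suff -> : X s t = x t by exact: xU.
  by apply/rowP => -[m mn]; move: (leq_trans mn n0).
have [C hC] := tube oU xU cx ch (sA (Ordinal n0) (Ordinal n0)).
by apply: filterS hC => s hs t tab; have [] := hs t tab.
Unshelve. all: by end_near. Qed.

Lemma uexpv_affine (y k : R -> 'rV[R]_n) : CkI a b 0 y -> CkI a b 0 k ->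
  uexpv a b (fun s t => y t + s *: k t) y k.
Proof.
move=> /CkI_rVP cy /CkI_rVP ck j.
apply: uexp_eq (uexp_affine ab (cy j) (ck j)) => // [].
by near=> s => t _; rewrite !mxE.
Unshelve. all: by end_near. Qed.

Lemma uexp_mx A i j : smooth_mx U A ->
  uexp a b (fun s t => A (X s t) i j) (fun t => A (x t) i j) (fun t => dmx A (h t) (x t) i j).
Proof.
move=> sA; apply: uexp_eq (uexp_smooth ab oU xU cx ch (sA i j)) => // [|t _].
  by near=> s.
by rewrite dmxE.
Unshelve. all: by end_near. Qed.

Lemma uexp_dmx A W W0 W1 i j : smooth_mx U A -> uexpv a b W W0 W1 ->
  uexp a b (fun s t => dmx A (W s t) (X s t) i j) (fun t => dmx A (W0 t) (x t) i j)
    (fun t => (dmx (dmx A (W0 t)) (h t) (x t) + dmx A (W1 t) (x t)) i j).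
Proof.
move=> sA hW.
have T := tube_in sA.
apply: uexp_eq (uexp_sum (index_enum 'I_n) (fun k => uexpM ab (hW k)
  (uexp_mx i j (dmx_smooth (delta_mx 0 k) sA)))) => [|t tab|t tab].
- by apply: filterS T => s hs t tab; rewrite -(dmx_sum oU _ _ _ sA (hs t tab)).
- by rewrite -(dmx_sum oU _ _ _ sA (xU tab)).
- rewrite big_split/= -(dmx_sum oU _ _ _ sA (xU tab)) mxE addrC; congr (_ + _).
  rewrite (dmxC oU _ _ sA (xU tab)) (dmx_sum oU _ _ _ (dmx_smooth _ sA) (xU tab)).
  by apply: eq_bigr => k _; rewrite (dmxC oU _ _ sA (xU tab)).
Qed.

Lemma uexpv_eq (V : R -> R -> 'rV[R]_n) (V0 V1 W1 : R -> 'rV[R]_n) : (forall t, a <= t <= b -> V1 t = W1 t) ->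
  uexpv a b V V0 V1 -> uexpv a b V V0 W1.
Proof.
move=> e h' k; apply: uexp_eq (h' k) => // [|t tab]; first by near=> s.
by rewrite e.
Unshelve. all: by end_near. Qed.

Lemma uexp_chrG V V0 V1 W W0 W1 : uexpv a b V V0 V1 -> uexpv a b W W0 W1 ->
  uexpv a b (fun s t => chr (G (X s t)) (V s t) (W s t)) (fun t => chr (G (x t)) (V0 t) (W0 t))
   (fun t => chr (dG G (h t) (x t)) (V0 t) (W0 t) + chr (G (x t)) (V1 t) (W0 t)
      + chr (G (x t)) (V0 t) (W1 t)).
Proof. by move=> hV hW; apply: uexp_chr => // k i j; exact: uexp_mx (mc_G H k). Qed.

Lemma uexp_chrdG Z Z0 Z1 V V0 V1 W W0 W1 : uexpv a b Z Z0 Z1 ->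
  uexpv a b V V0 V1 -> uexpv a b W W0 W1 ->
  uexpv a b (fun s t => chr (dG G (Z s t) (X s t)) (V s t) (W s t))
   (fun t => chr (dG G (Z0 t) (x t)) (V0 t) (W0 t))
   (fun t => chr (ddG G (Z0 t) (h t) (x t)) (V0 t) (W0 t) + chr (dG G (Z1 t) (x t)) (V0 t) (W0 t)
      + chr (dG G (Z0 t) (x t)) (V1 t) (W0 t) + chr (dG G (Z0 t) (x t)) (V0 t) (W1 t)).
Proof.
move=> hZ hV hW.
apply: (uexpv_eq (V1 := fun t =>
     chr (fun k => ddG G (Z0 t) (h t) (x t) k + dG G (Z1 t) (x t) k) (V0 t) (W0 t)
      + chr (dG G (Z0 t) (x t)) (V1 t) (W0 t) + chr (dG G (Z0 t) (x t)) (V0 t) (W1 t))).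
  by move=> t _; rewrite chrDm.
by apply: uexp_chr => // k i j; exact: uexp_dmx (mc_G H k) hZ.
Qed.

Let X1 s t := x1 t + s *: h1 t.
Let X2 s t := x2 t + s *: h2 t.
Let X3 s t := x3 t + s *: h3 t.

Lemma uexp_acc : uexpv a b (fun s t => acc G (X s t) (X1 s t) (X2 s t))
  (fun t => acc G (x t) (x1 t) (x2 t)) (fun t => vacc G (x t) (x1 t) (h t) (h1 t) (h2 t)).
Proof.
have u1 := uexpv_affine cx1 ch1; have u2 := uexpv_affine cx2 ch2.
exact: (uexpvD u2 (uexp_chrG u1 u1)).
Qed.

Lemma uexp_jerk : uexpv a b (fun s t => jerk G (X s t) (X1 s t) (X2 s t) (X3 s t))
  (fun t => jerk G (x t) (x1 t) (x2 t) (x3 t))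
  (fun t => vjerk G (x t) (x1 t) (x2 t) (h t) (h1 t) (h2 t) (h3 t)).
Proof.
have u1 := uexpv_affine cx1 ch1; have u2 := uexpv_affine cx2 ch2.
have u3 := uexpv_affine cx3 ch3.
exact: (uexpvD (uexpvD u3 (uexpvD (uexpvD (uexp_chrdG u1 u1 u1) (uexp_chrG u2 u1))
  (uexp_chrG u1 u2))) (uexp_chrG u1 uexp_acc)).
Qed.

Lemma uexp_g V V0 V1 : uexpv a b V V0 V1 ->
  uexp a b (fun s t => bilin (g (X s t)) (V s t) (V s t)) (fun t => bilin (g (x t)) (V0 t) (V0 t))
   (fun t => 2 * bilin (g (x t)) (V1 t + chr (G (x t)) (h t) (V0 t)) (V0 t)).
Proof.
move=> hV.
have := uexp_bilin ab (fun i j => uexp_mx i j (mc_g H)) hV hV.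
apply: uexp_eq => // [|t tab]; first by near=> s.
have Ux := xU tab.
rewrite (mc_compat H _ _ _ Ux) bilinDl.
rewrite (bilinC _ (chr _ _ _) (mc_gsym H Ux)) (bilinC (V0 t) (V1 t) (mc_gsym H Ux)).
ring.
Unshelve. all: by end_near. Qed.

Variables (e1 e2 : R).

Lemma uexp_lagr : uexp a b
  (fun s t => lagr G g e1 e2 (X s t) (X1 s t) (X2 s t) (X3 s t))
  (fun t => lagr G g e1 e2 (x t) (x1 t) (x2 t) (x3 t))
  (fun t => 2 * vlagr G g e1 e2 (x t) (x1 t) (x2 t) (x3 t) (h t) (h1 t) (h2 t) (h3 t)).
Proof.
have u1 := uexpv_affine cx1 ch1.
have u := uexpD (uexpD (uexpZ ab e1 (uexp_g u1)) (uexpZ ab e2 (uexp_g uexp_acc)))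
  (uexp_g uexp_jerk).
apply: uexp_eq u => // [|t tab]; first by near=> s.
rewrite /vlagr /cvel /cacc /cjerk (mc_Gsym H (x1 t) (h t) (xU tab)); ring.
Unshelve. all: by end_near. Qed.

End UExpLagrangian.

Lemma CkI_lagr (R : realType) (n : nat) (U : set 'rV[R]_n) G g (H : metric_chart U G g)
    (a b e1 e2 : R) (x x1 x2 x3 : R -> 'rV[R]_n) : (forall t, a <= t <= b -> U (x t)) ->
  CkI a b 0 x -> CkI a b 0 x1 -> CkI a b 0 x2 -> CkI a b 0 x3 ->
  CkI a b 0 (fun t => lagr G g e1 e2 (x t) (x1 t) (x2 t) (x3 t) : R^o).
Proof.
move=> xU c c1 c2 c3; have cA := CkI_acc H xU c c1 c2; have cJ := CkI_jerk H xU c c1 c2 c3.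
exact: (CkID (CkID (CkIZ e1 (CkI_g H xU c c1 c1)) (CkIZ e2 (CkI_g H xU c cA cA)))
  (CkI_g H xU c cJ cJ)).
Qed.

Lemma Rintegral_le_bound (R : realType) (a b C : R) (f : R -> R) : a <= b ->
  CkI a b 0 (f : R -> R^o) -> (forall t, a <= t <= b -> f t <= C) ->
  (\int[lebesgue_measure]_(t in `[a, b]) f t <= C * (b - a))%R.
Proof.
move=> ab cf h.
have -> : C * (b - a) = (\int[lebesgue_measure]_(t in `[a, b]) (fun=> C) t)%R.
  rewrite Rintegral_cst//= lebesgue_measure_itv/= lte_fin.
  by move: ab; rewrite le_eqVlt => /predU1P[->|->]//=; rewrite ltxx subrr.
apply: le_Rintegral => //; first exact: CkI0_integrable.
by apply: CkI0_integrable; exact: CkI_cst.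
Qed.

(** Minimality gives [0 <= s * I1 + C * s ^+ 2 * (b - a)] for small [s] of either sign. If [I1] were
    nonzero, a small [s] of the opposite sign would contradict it. *)
Lemma uexp_critical (R : realType) (a b : R) F F0 F1 : a <= b -> uexp a b F F0 F1 ->
  (\forall s \near (0:R), CkI a b 0 (F s : R -> R^o)) ->
  CkI a b 0 (F0 : R -> R^o) -> CkI a b 0 (F1 : R -> R^o) ->
  (\forall s \near (0:R), \int[lebesgue_measure]_(t in `[a, b]) F0 t <=
     \int[lebesgue_measure]_(t in `[a, b]) F s t)%R ->
  (\int[lebesgue_measure]_(t in `[a, b]) F1 t = 0)%R.
Proof.
move=> ab [C [_ hC]] cF cF0 cF1 hmin.
set I1 := (\int[_]_(_ in _) F1 _)%R.
have key : \forall s \near (0:R), 0 <= s * I1 + C * s ^+ 2 * (b - a).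
  apply: filterS3 hC cF hmin => s hC cs hs.
  have iF := CkI0_integrable cs; have iF0 := CkI0_integrable cF0.
  have iF1 := CkI0_integrable cF1.
  have cd : CkI a b 0 (fun t => F s t - F0 t - s * F1 t : R^o).
    exact: (CkIB (CkIB cs cF0) (CkIZ s cF1)).
  have := Rintegral_le_bound ab cd (fun t tab => le_trans (ler_norm _) (hC t tab)).
  rewrite RintegralB//; last 2 first.
  - by apply: CkI0_integrable; exact: (CkIB cs cF0).
  - by apply: CkI0_integrable; exact: (CkIZ s cF1).
  rewrite RintegralB// RintegralZl// -/I1.
  move: hs; move: (\int[_]_(_ in _) F0 _)%R (\int[_]_(_ in _) F s _)%R => p q; lra.
have C0 : 0 <= `|C| * (b - a) by rewrite mulr_ge0// subr_ge0.
apply/eqP; rewrite -[_ == _]negbK; apply/negP => /eqP In0.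
have /nbhs_ballP[d /= d0 hd] := key.
have m0 : 0 < 2 * (`|C| * (b - a) + 1) by rewrite mulr_gt0// ltr_wpDl.
have mI : 0 < 2 * (`|I1| + 1) by rewrite mulr_gt0// ltr_wpDl.
(* The test value is [s = - (e * I1)]: the first bound keeps it in the ball of radius [d], the
   second makes [e * (C * (b - a))] at most 1/2, so that the linear term wins. *)
pose e := Num.min (d / (2 * (`|I1| + 1))) (1 / (2 * (`|C| * (b - a) + 1))).
have e0 : 0 < e by rewrite lt_min !divr_gt0.
have e1 : e * (2 * (`|I1| + 1)) <= d by rewrite -ler_pdivlMr// ge_min lexx.
have e2 : e * (2 * (`|C| * (b - a) + 1)) <= 1 by rewrite -ler_pdivlMr// ge_min lexx orbT.
have := hd (- (e * I1)).
rewrite /ball/= sub0r opprK normrM (gtr0_norm e0).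
have I0 : 0 <= `|I1| := normr_ge0 _.
have eI : e * `|I1| < d by apply: lt_le_trans e1; rewrite ltr_pM2l//; lra.
move=> /(_ eI).
have -> : - (e * I1) * I1 + C * (- (e * I1)) ^+ 2 * (b - a) =
   e * I1 ^+ 2 * (- 1 + e * (C * (b - a))) by ring.
rewrite pmulr_rge0; last by rewrite mulr_gt0// exprn_even_gt0//=; apply/eqP.
have CC : C * (b - a) <= `|C| * (b - a) by rewrite ler_wpM2r ?subr_ge0 ?ler_norm.
have : e * (C * (b - a)) <= e * (`|C| * (b - a)) by rewrite ler_pM2l.
move: e2 (ltW e0); clear.
move: (`|C| * (b - a)) (C * (b - a)) => p q; nra.
Qed.

(** * Truncated powers and cutoff functions *)

Section Bump.
Variable R : realType.

(** Differentiation lowers the exponent by one and keeps the shape, so regularity is counted by the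
    exponent. *)
Definition pospow (c d : R) k (u : R) : R := (Num.max 0 (c + d * u)) ^+ k.

Lemma is_dwX (a b : R) (f : R -> R) t l k : is_dw a b (f : R -> R^o) t l ->
  is_dw a b (fun u => f u ^+ k.+1 : R^o) t (k.+1%:R * f t ^+ k * l).
Proof.
move=> h; elim: k => [|k IH].
  by rewrite expr0 mulr1 mul1r; under eq_fun do rewrite expr1.
under eq_fun do rewrite exprS.
have := is_dwM h IH; congr is_dw; rewrite exprS -[k.+2]addn1 natrD; ring.
Qed.

Lemma is_dw_affine (a b c d : R) t : is_dw a b (fun u : R => c + d * u : R^o) t d.
Proof.
have := is_dwD (@is_dw_cst _ R^o a b c t) (is_dwZ (k := d) (is_dw_id a b t)).
by rewrite add0r -[_ *: _]/(_ * _) mulr1.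
Qed.

Lemma is_dw_pospow (a b c d : R) k t : `|d| <= 1 -> a <= t <= b ->
  is_dw a b (pospow c d k.+2 : R -> R^o) t (k.+2%:R * pospow c d k.+1 t * d).
Proof.
move=> d1 tab.
have cf : {for t, continuous (fun u : R => c + d * u)}.
  by apply: continuousD; [exact: cst_continuous|apply: scaler_continuous].
have [v0|v0|v0] := ltgtP 0 (c + d * t).
- rewrite {2}/pospow max_r ?(ltW v0)//.
  have L := is_dwX (k := k.+1) (@is_dw_affine a b c d t).
  apply: (is_dw_local tab _ L).
  have : \forall u \near t, 0 < c + d * u by apply: (cvgr_gt _ cf).
  by apply: filterS => u u0 uab; split => //; rewrite /pospow max_r// ltW.
- rewrite {2}/pospow max_l ?(ltW v0)// expr0n mulr0 mul0r.
  apply: (is_dw_local tab _ (@is_dw_cst _ R^o a b 0 t)).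
  have : \forall u \near t, c + d * u < 0 by apply: (cvgr_lt _ cf).
  by apply: filterS => u u0 uab; split => //; rewrite /pospow max_l ?(ltW u0)// expr0n.
(* At the break point the function is at most the power [k.+2] of the distance to [t], because the
   slope is at most 1, so its quotient tends to 0. *)
- rewrite {2}/pospow -v0 maxxx expr0n mulr0 mul0r.
  apply/is_dwP => e e0; apply/nbhs_ballP; exists (Num.min 1 e) => /=; first by rewrite lt_min ltr01.
  move=> u; rewrite /ball/= lt_min distrC => /andP[u1 ue] uab ut.
  rewrite /diff_quot /pospow -v0 maxxx expr0n/= subr0 sub0r normrN normrZ normfV.
  have B : `|Num.max 0 (c + d * u)| <= `|u - t|.
    have E : c + d * u = d * (u - t) by rewrite mulrBr; lra.
    apply: (@le_trans _ _ `|c + d * u|).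
      by rewrite /Num.max; case: ifP => // _; rewrite normr0.
    by rewrite E normrM ler_piMl.
  have ut0 : 0 < `|u - t| by rewrite normr_gt0 subr_eq0.
  rewrite mulrC ler_pdivrMr// normrX.
  apply: (@le_trans _ _ (`|u - t| ^+ k.+2)); first by rewrite lerXn2r// nnegrE.
  rewrite exprSr ler_wpM2r// exprS (le_trans _ (ltW ue))// ler_piMr// exprn_ile1//.
  exact: ltW.
Qed.

Lemma CkI_pospow (a b c d : R) k : `|d| <= 1 -> CkI a b k (pospow c d k.+1 : R -> R^o).
Proof.
move=> d1; elim: k => [|k IH] /=.
  move=> t tab; apply: cvg_within_filter.
  have cf : {for t, continuous (fun u : R => c + d * u)}.
    by apply: continuousD; [exact: cst_continuous|apply: scaler_continuous].
  have -> : pospow c d 1 = (fun u => (c + d * u + `|c + d * u|) * 2^-1).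
    apply/funext => u; rewrite /pospow expr1; have [v0|v0] := leP 0 (c + d * u).
      by rewrite ger0_norm//; lra.
    by rewrite ltr0_norm// subrr mul0r.
  by apply: cvgM; [apply: cvgD; [exact: cf|apply: cvg_norm; exact: cf]|exact: cvg_cst].
exists (fun t => k.+2%:R * pospow c d k.+1 t * d).
  by move=> t tab; exact: is_dw_pospow.
apply: (@CkIM _ _ _ _ (fun t => k.+2%:R * pospow c d k.+1 t) (fun=> d)); last exact: CkI_cst.
by apply: (@CkIM _ _ _ _ (fun=> k.+2%:R)); first exact: CkI_cst.
Qed.

(* Fourth powers make the cutoff C^3 on the line, as the curve space requires,
   and it is a polynomial on [a, b]. *)
Definition cutoff a b (u : R) := pospow (- a) 1 4 u * pospow b (- 1) 4 u.

Lemma cutoff_out a b u : (u <= a) || (b <= u) -> cutoff a b u = 0.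
Proof.
rewrite /cutoff /pospow => /orP[ua|bu].
  by rewrite max_l ?expr0n ?mul0r//; lra.
by rewrite [X in _ * X ^+ _]max_l ?expr0n ?mulr0//; lra.
Qed.

Lemma cutoff_gt0 a b u : a < u < b -> 0 < cutoff a b u.
Proof.
by move=> /andP[au ub]; rewrite /cutoff /pospow mulr_gt0// exprn_gt0// lt_max; apply/orP; right; lra.
Qed.

Lemma cutoff_ge0 a b u : 0 <= cutoff a b u.
Proof. by rewrite /cutoff /pospow mulr_ge0// exprn_ge0// le_max lexx. Qed.

Lemma CkI_cutoff a b c d : CkI c d 3 (cutoff a b : R -> R^o).
Proof. by apply: CkIM; apply: CkI_pospow; rewrite ?normrN normr1. Qed.

Lemma CkI_cutoff_in a b k : CkI a b k (cutoff a b : R -> R^o).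
Proof.
have aff (c d : R) : CkI a b k (fun u => (c + d * u) : R^o).
  exact: (CkID (CkI_cst a b k (c : R^o)) (CkIZ d (CkI_id a b k))).
have p4 (f : R -> R) : CkI a b k (f : R -> R^o) -> CkI a b k (fun u => f u ^+ 4 : R^o).
  by move=> hf; rewrite /=; apply: CkIM => //; apply: CkIM => //; apply: CkIM.
apply: CkI_eq (CkIM (p4 _ (aff (- a) 1)) (p4 _ (aff b (- 1)))) => u /andP[au ub].
by rewrite /cutoff /pospow !max_r//; lra.
Qed.

End Bump.

Lemma iter_derive_within_0 (R : realType) (V : normedModType R) (a b t : R) j : a < b ->
  a <= t <= b -> iter j (derive_within a b) (fun=> 0 : V) t = 0.
Proof.
move=> ab; elim: j t => [//|j IH] t tab /=.
rewrite (@derive_within_eq _ _ _ _ _ (fun=> 0 : V))//.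
by apply: is_dwE => //; exact: is_dw_cst.
Qed.

Lemma is_dwZv (R : realType) (n : nat) (a b t l : R) (f : R -> R) (u : 'rV[R]_n) :
  is_dw a b (f : R -> R^o) t l -> is_dw a b (fun s => f s *: u) t (l *: u).
Proof.
move=> h; apply/is_dw_rVP => k; rewrite mxE.
rewrite (_ : (fun s => _) = (fun s => f s * (fun=> u 0 k) s)); last first.
  by apply/funext => s; rewrite mxE.
have := is_dwM h (@is_dw_cst _ R^o a b (u 0 k) t).
by rewrite mulr0 addr0.
Qed.

Lemma CkIZv (R : realType) (n : nat) (a b : R) k (f : R -> R) (u : 'rV[R]_n) :
  CkI a b k (f : R -> R^o) -> CkI a b k (fun s => f s *: u).
Proof.
move=> h; apply/CkI_rVP => j.
by apply: CkI_eq (CkIM h (@CkI_cst _ R^o a b k (u 0 j))) => s _; rewrite mxE.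
Qed.

(** Strict positivity excludes the left end because the integrands of interest carry a cutoff that
    vanishes there. On the right half of the interval the minimum is positive. *)
Lemma Rintegral_gt0 (R : realType) (a b : R) (f : R -> R) : a < b ->
  CkI a b 0 (f : R -> R^o) -> (forall t, a <= t <= b -> 0 <= f t) ->
  (forall t, a < t <= b -> 0 < f t) -> (0 < \int[lebesgue_measure]_(t in `[a, b]) f t)%R.
Proof.
move=> ab cf f0 fp; pose m := (a + b) / 2.
have am : a < m by rewrite /m; lra.
have mb : m < b by rewrite /m; lra.
have am' := ltW am; have mb' := ltW mb.
rewrite (@Rintegral_split _ a m b)//; last exact: CkI0_integrable.
apply: ltr_wpDl.
  apply: Rintegral_ge0 => t; rewrite /= in_itv/= => /andP[t1 t2]; apply: f0.
  by rewrite t1 (le_trans t2).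
have cm : CkI m b 0 (f : R -> R^o) by apply: CkI_sub cf.
have cm' := (@CkI0P _ R^o m b f).1 cm.
have [c cmb hc] := EVT_min mb' cm'.
have fc : 0 < f c.
  by apply: fp; move: cmb; rewrite in_itv/= => /andP[/(lt_le_trans am) -> ->].
have cneg : CkI m b 0 (fun t => -1 * f t : R^o) := CkIZ (-1) cm.
have : (\int[lebesgue_measure]_(t in `[m, b]) (-1 * f t))%R <= - f c * (b - m).
  apply: Rintegral_le_bound => // t tmb; rewrite mulN1r lerN2; apply: hc.
  by rewrite in_itv.
rewrite RintegralZl ?mulN1r//; last exact: CkI0_integrable.
have : 0 < f c * (b - m) by rewrite mulr_gt0// subr_gt0.
move: (\int[_]_(_ in _) _)%R => I; rewrite mulNr; lra.
Qed.

(** * The first variation in a chart *)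

Section ChartLevel.
Variables (R : realType) (n : nat) (U : set 'rV[R]_n).
Variables (G : 'rV[R]_n -> 'I_n -> 'M[R]_n) (g : 'rV[R]_n -> 'M[R]_n).
Hypothesis H : metric_chart U G g.
Variables (e1 e2 : R).

Lemma cvIS a b x k t : cvI a b G x k.+1 t = derive_within a b (cvI a b G x k) t
  + chr (G (x t)) (derive_within a b x t) (cvI a b G x k t).
Proof. by []. Qed.

Lemma cvI_sub a b a' b' x k t : a < b -> (forall t, a <= t <= b -> U (x t)) ->
  CkI a b k.+1 x -> a <= a' -> b' <= b -> a' < b' -> a' <= t <= b' ->
  cvI a' b' G x k t = cvI a b G x k t.
Proof.
move=> ab xU hx aa bb ab'.
have sub u : a' <= u <= b' -> a <= u <= b.
  by move=> /andP[h1 h2]; rewrite (le_trans aa h1) (le_trans h2 bb).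
have D u : a' <= u <= b' -> derive_within a' b' x u = derive_within a b x u.
  by move=> uab; apply: (CkI_derive_sub (j := 1) hx).
elim: k hx t => [|k IH] hx t tab; first exact: D.
have E u : a' <= u <= b' -> cvI a' b' G x k u = cvI a b G x k u.
  by apply: IH; exact: CkI_le hx.
rewrite !cvIS (D _ tab) (E _ tab) (derive_within_eq tab E); congr (_ + _).
have c1 : CkI a b 1 (cvI a b G x k) by apply: (CkI_cvI H ab xU); rewrite addn1.
exact: (CkI_derive_sub (j := 1) c1 ab ab' aa bb isT tab).
Qed.

(** The profile [p] is 1 to prescribe the value of the field at a corner [tau], and [t - tau] to
    prescribe its derivative. *)
Definition bump_field (a b : R) (p : R -> R) (u : 'rV[R]_n) (t : R) := (cutoff a b t * p t) *: u.

Definition lagrI a b x t := let D := fun j => iter j (derive_within a b) x in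
  lagr G g e1 e2 (x t) (D 1 t) (D 2 t) (D 3 t).

(** The form in which global minimality reaches a chart. Energies are compared on the support of the
    field, while derivatives are relative to the larger interval, where the field extends by zero
    and is C^3. *)
Definition locally_minimal a0 b0 x := forall a b (p : R -> R) u,
  a0 < a -> a < b -> b < b0 -> (forall c d k, CkI c d k (p : R -> R^o)) ->
  \forall s \near (0:R), (\int[lebesgue_measure]_(t in `[a, b]) lagrI a0 b0 x t <=
    \int[lebesgue_measure]_(t in `[a, b])
       lagrI a0 b0 (fun t => x t + s *: bump_field a b p u t) t)%R.

Lemma dmx0 A x : dmx A 0 x = 0 :> 'M[R]_n.
Proof. by apply/matrixP => i j; rewrite dmxE mxE derive0. Qed.

Lemma bdry0 y y1 y2 y3 v3 v4 : bdry G g e1 e2 y y1 y2 y3 v3 v4 0 0 0 = 0.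
Proof.
have z : chr (dG G 0 y) y1 y1 = 0.
  by apply/rowP => k; rewrite chrE /dG dmx0 mxE /bilin mulmx0 mul0mx mxE.
rewrite /bdry /cacc /vacc /cvel z !(chr0l, chr0r, addr0, bilin0l); ring.
Qed.

Section Core.
Variables (a0 b0 a b tau : R) (x : R -> 'rV[R]_n) (p : R -> R) (u : 'rV[R]_n).
Hypotheses (a0a : a0 < a) (atau : a < tau) (taub : tau < b) (bb0 : b < b0).
Hypotheses (xU : forall t, a0 <= t <= b0 -> U (x t)).
Hypotheses (x3 : CkI a0 b0 3 x) (xl : CkI a tau 6 x) (xr : CkI tau b 6 x).
Hypothesis cp : forall c d k, CkI c d k (p : R -> R^o).
Hypothesis hmin : locally_minimal a0 b0 x.

Let h := bump_field a b p u.
Let hs j := iter j (derive_within a0 b0) h.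
Let xs j := iter j (derive_within a0 b0) x.
Let ab := lt_trans atau taub.
Let a0b0 := lt_trans a0a (lt_trans ab bb0).

Lemma CkI_bump_field c d : CkI c d 3 (bump_field a b p u).
Proof. by apply: CkIZv; apply: CkIM; [exact: CkI_cutoff|exact: cp]. Qed.

Lemma bump_field_out t : (t <= a) || (b <= t) -> bump_field a b p u t = 0.
Proof. by move=> tab; rewrite /bump_field cutoff_out// mul0r scale0r. Qed.

Let sub t : a <= t <= b -> a0 <= t <= b0.
Proof. by move=> /andP[h1 h2]; rewrite (le_trans (ltW a0a) h1) (le_trans h2 (ltW bb0)). Qed.

(** The field is C^3 across [a], so its derivatives there may be computed from the left, where it is
    zero. *)
Let hs_a j : (j <= 3)%N -> hs j a = 0.
Proof.
move=> j3; have h3 := CkI_bump_field a0 b0.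
have a0a' := ltW a0a; have E : a0 <= a <= a by rewrite a0a' lexx.
have ab0 : a <= b0 by rewrite ltW// (lt_trans ab).
rewrite -(iter_derive_within_0 'rV[R]_n j a0a E) /hs.
rewrite -(CkI_derive_sub h3 a0b0 a0a (lexx _) ab0 j3 E).
apply: iter_derive_within_eq => // t /andP[_ ta]; apply: bump_field_out.
by rewrite ta.
Qed.

Let hs_b j : (j <= 3)%N -> hs j b = 0.
Proof.
move=> j3; have h3 := CkI_bump_field a0 b0.
have bb0' := ltW bb0; have E : b <= b <= b0 by rewrite bb0' lexx.
have ab0 : a0 <= b by rewrite ltW// (lt_trans a0a).
rewrite -(iter_derive_within_0 'rV[R]_n j bb0 E) /hs.
rewrite -(CkI_derive_sub h3 a0b0 bb0 ab0 (lexx _) j3 E).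
apply: iter_derive_within_eq => // t /andP[bt _]; apply: bump_field_out.
by rewrite bt orbT.
Qed.

Let dhs j t : (j < 3)%N -> a0 <= t <= b0 -> is_dw a0 b0 (hs j) t (hs j.+1 t).
Proof. by move=> j3 tab; exact: CkI_iter_dw (CkI_bump_field a0 b0) j3 tab. Qed.

Let chs j : (j <= 3)%N -> CkI a0 b0 0 (hs j).
Proof.
by move=> j3; apply: CkI_iter => //; rewrite addn0; exact: CkI_le (CkI_bump_field a0 b0).
Qed.

Let cxs j : (j <= 3)%N -> CkI a0 b0 0 (xs j).
Proof. by move=> j3; apply: CkI_iter => //; rewrite addn0; exact: CkI_le x3. Qed.

Let F1 t := vlagr G g e1 e2 (x t) (xs 1 t) (xs 2 t) (xs 3 t)
   (hs 0 t) (hs 1 t) (hs 2 t) (hs 3 t).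

Lemma int_vlagr_eq0 : (\int[lebesgue_measure]_(t in `[a, b]) F1 t)%R = 0.
Proof.
have a0a' := ltW a0a; have bb0' := ltW bb0.
have xU' t : a <= t <= b -> U (x t) by move=> /sub; exact: xU.
have c j : (j <= 3)%N -> CkI a b 0 (xs j) by move=> /cxs; exact: CkI_sub.
have k j : (j <= 3)%N -> CkI a b 0 (hs j) by move=> /chs; exact: CkI_sub.
have u0 := uexp_lagr H (ltW ab) xU' (c 0 isT) (c 1 isT) (c 2 isT) (c 3 isT)
  (k 0 isT) (k 1 isT) (k 2 isT) (k 3 isT) e1 e2.
have cF1 : CkI a b 0 (F1 : R -> R^o).
  have d j t : (j < 3)%N -> a <= t <= b -> is_dw a b (hs j) t (hs j.+1 t).
    by move=> j3 tab; apply: (is_dw_sub a0a' bb0'); exact: dhs (sub tab).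
  have := CkI_vlagr H xU' (e1 := e1) (e2 := e2) (fun t => d 0 t isT) (fun t => d 1 t isT)
    (fun t => d 2 t isT) (k 3 isT) (c 0 isT) (c 1 isT) (c 2 isT) (c 3 isT).
  exact.
have c2F1 : CkI a b 0 (fun t => 2 * F1 t : R^o) by exact: (CkIZ 2 cF1).
have nearF : \forall s \near (0:R), CkI a b 0 (fun t => lagr G g e1 e2 (x t + s *: hs 0 t)
    (xs 1 t + s *: hs 1 t) (xs 2 t + s *: hs 2 t) (xs 3 t + s *: hs 3 t) : R^o).
  have := tube_in H xU' (c 0 isT) (k 0 isT) (mc_g H).
  apply: filterS => s hs'.
  have := CkI_lagr H (e1 := e1) (e2 := e2) hs' (CkID (c 0 isT) (CkIZ s (k 0 isT)))
    (CkID (c 1 isT) (CkIZ s (k 1 isT))) (CkID (c 2 isT) (CkIZ s (k 2 isT)))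
    (CkID (c 3 isT) (CkIZ s (k 3 isT))).
  exact.
have cF0 := CkI_lagr H (e1 := e1) (e2 := e2) xU' (c 0 isT) (c 1 isT) (c 2 isT) (c 3 isT).
have E : (\int[lebesgue_measure]_(t in `[a, b]) (2 * F1 t))%R = 0.
  apply: (uexp_critical (ltW ab) u0 nearF cF0 c2F1).
  have := hmin u a0a ab bb0 cp; apply: filterS => s hs'.
  have D j t' : (j <= 3)%N -> a0 <= t' <= b0 ->
      iter j (derive_within a0 b0) (fun t => x t + s *: h t) t' = xs j t' + s *: hs j t'.
    elim: j t' => [|j IH] t' j3 tab'; first by [].
    have E u' : a0 <= u' <= b0 ->
        iter j (derive_within a0 b0) (fun t => x t + s *: h t) u' = xs j u' + s *: hs j u'.
      by apply: IH; exact: ltnW.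
    rewrite iterS (derive_within_eq tab' E); apply: (is_dwE a0b0 tab').
    have dxj := CkI_iter_dw a0b0 x3 j3 tab'.
    exact: (is_dwD dxj (is_dwZ (k := s) (dhs j3 tab'))).
  have EQ t : a <= t <= b -> lagrI a0 b0 (fun t => x t + s *: h t) t =
      lagr G g e1 e2 (x t + s *: hs 0 t) (xs 1 t + s *: hs 1 t) (xs 2 t + s *: hs 2 t)
        (xs 3 t + s *: hs 3 t).
    move=> /sub tab; rewrite /lagrI.
    by rewrite (D 1%N t isT tab) (D 2%N t isT tab) (D 3%N t isT tab).
  have EI := Rintegral_eq_itv EQ.
  refine (le_trans hs' _); rewrite le_eqVlt; apply/orP; left; apply/eqP; exact: EI.
move: E; rewrite RintegralZl//; last exact: CkI0_integrable.
by move=> /eqP; rewrite mulf_eq0 pnatr_eq0/= => /eqP.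
Qed.

(** [x] is C^6 only on either side of [tau], so the integration by parts is done on the two pieces.
    The boundary terms at [a] and [b] vanish with [h] and its first two derivatives. *)
Lemma first_variation :
  bdryI G g a tau e1 e2 x h (hs 1) (hs 2) tau - bdryI G g tau b e1 e2 x h (hs 1) (hs 2) tau
  + ((\int[lebesgue_measure]_(t in `[a, tau]) bilin (g (x t)) (eulerI G a tau e1 e2 x t) (h t))
  + (\int[lebesgue_measure]_(t in `[tau, b]) bilin (g (x t)) (eulerI G tau b e1 e2 x t) (h t)))%R
  = 0.
Proof.
have arith (A B C D : R) : A - 0 + C + (0 - B + D) = 0 -> A - B + (C + D) = 0 by lra.
have a0a' := ltW a0a; have bb0' := ltW bb0; have atau' := ltW atau; have taub' := ltW taub.
have a0tau : a0 <= tau := le_trans a0a' atau'.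
have taub0 : tau <= b0 := le_trans taub' bb0'.
have subl t : a <= t <= tau -> a0 <= t <= b0.
  by move=> /andP[h1 h2]; rewrite (le_trans a0a' h1) (le_trans h2).
have subr t : tau <= t <= b -> a0 <= t <= b0.
  by move=> /andP[h1 h2]; rewrite (le_trans a0tau h1) (le_trans h2).
have xUl t : a <= t <= tau -> U (x t) by move=> /subl; exact: xU.
have xUr t : tau <= t <= b -> U (x t) by move=> /subr; exact: xU.
have dl j t : (j < 3)%N -> a <= t <= tau -> is_dw a tau (hs j) t (hs j.+1 t).
  by move=> j3 tab; apply: (is_dw_sub a0a' taub0); exact: dhs (subl _ tab).
have dr j t : (j < 3)%N -> tau <= t <= b -> is_dw tau b (hs j) t (hs j.+1 t).
  by move=> j3 tab; apply: (is_dw_sub a0tau bb0'); exact: dhs (subr _ tab).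
have cl : CkI a tau 0 (hs 3) by apply: CkI_sub (chs (leqnn 3)).
have cr : CkI tau b 0 (hs 3) by apply: CkI_sub (chs (leqnn 3)).
have Il := int_vlagr H atau xUl e1 e2 (fun t => dl 0 t isT) (fun t => dl 1 t isT)
  (fun t => dl 2 t isT) cl xl.
have Ir := int_vlagr H taub xUr e1 e2 (fun t => dr 0 t isT) (fun t => dr 1 t isT)
  (fun t => dr 2 t isT) cr xr.
have := int_vlagr_eq0.
rewrite (@Rintegral_split _ a tau b)//; last first.
  apply: CkI0_integrable.
  have c j : (j <= 3)%N -> CkI a b 0 (xs j) by move=> /cxs; exact: CkI_sub.
  have k j : (j <= 3)%N -> CkI a b 0 (hs j) by move=> /chs; exact: CkI_sub.
  have xU' t : a <= t <= b -> U (x t) by move=> /sub; exact: xU.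
  have d j t : (j < 3)%N -> a <= t <= b -> is_dw a b (hs j) t (hs j.+1 t).
    by move=> j3 tab; apply: (is_dw_sub a0a' bb0'); exact: dhs (sub tab).
  have := CkI_vlagr H xU' (e1 := e1) (e2 := e2) (fun t => d 0 t isT) (fun t => d 1 t isT)
    (fun t => d 2 t isT) (k 3 isT) (c 0 isT) (c 1 isT) (c 2 isT) (c 3 isT).
  exact.
rewrite (@Rintegral_eq_itv _ a tau F1 (fun t => vlagr G g e1 e2 (x t)
   (iter 1 (derive_within a tau) x t) (iter 2 (derive_within a tau) x t)
   (iter 3 (derive_within a tau) x t) (hs 0 t) (hs 1 t) (hs 2 t) (hs 3 t))); last first.
  move=> t tab; have D j (j3 : (j <= 3)%N) := CkI_derive_sub x3 a0b0 atau a0a' taub0 j3 tab.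
  by rewrite (D 1%N isT) (D 2%N isT) (D 3%N isT).
rewrite (@Rintegral_eq_itv _ tau b F1 (fun t => vlagr G g e1 e2 (x t)
   (iter 1 (derive_within tau b) x t) (iter 2 (derive_within tau b) x t)
   (iter 3 (derive_within tau b) x t) (hs 0 t) (hs 1 t) (hs 2 t) (hs 3 t))); last first.
  move=> t tab; have D j (j3 : (j <= 3)%N) := CkI_derive_sub x3 a0b0 taub a0tau bb0' j3 tab.
  by rewrite (D 1%N isT) (D 2%N isT) (D 3%N isT).
rewrite Il Ir.
have -> : bdryI G g a tau e1 e2 x (hs 0) (hs 1) (hs 2) a = 0.
  by rewrite /bdryI !hs_a// bdry0.
have -> : bdryI G g tau b e1 e2 x (hs 0) (hs 1) (hs 2) b = 0.
  by rewrite /bdryI !hs_b// bdry0.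
exact: arith.
Qed.

End Core.
End ChartLevel.

Lemma is_dw_piecewise (R : realType) (V : normedModType R) (a m b : R) (f f' : R -> V) :
  a < m -> m < b -> (forall t, a <= t <= m -> is_dw a m f t (f' t)) ->
  (forall t, m <= t <= b -> is_dw m b f t (f' t)) ->
  forall t, a <= t <= b -> is_dw a b f t (f' t).
Proof.
move=> am mb d1 d2 t /andP[t1 t2]; have am' := ltW am; have mb' := ltW mb.
have [tm|mt|tm] := ltgtP t m.
- have tam : a <= t <= m by rewrite t1 ltW.
  apply: (is_dw_rnb _ (d1 t tam)); split => //.
  have : \forall u \near t, u < m by exact: lt_nbhsl.
  by apply: filterS => u um /andP[-> _]; rewrite ltW.
- have tmb : m <= t <= b by rewrite t2 ltW.
  apply: (is_dw_rnb _ (d2 t tmb)); split => //.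
  have : \forall u \near t, m < u by exact: lt_nbhsr.
  by apply: filterS => u um /andP[_ ->]; rewrite ltW.
- subst t; apply: is_dw_glue => //; first by apply: d1; rewrite lexx am'.
  by apply: d2; rewrite lexx mb'.
Qed.

Lemma CkI0_piecewise (R : realType) (V : normedModType R) (a m b : R) (f : R -> V) :
  a < m -> m < b -> CkI a m 0 f -> CkI m b 0 f -> CkI a b 0 f.
Proof. by move=> am mb h1 h2; apply: (CkI_glue am mb h1 h2) => j; rewrite leqn0 => /eqP ->. Qed.

(** * Stationary curves in a chart *)

Section ChartConclusion.
Variables (R : realType) (n : nat) (U : set 'rV[R]_n).
Variables (G : 'rV[R]_n -> 'I_n -> 'M[R]_n) (g : 'rV[R]_n -> 'M[R]_n).
Hypothesis H : metric_chart U G g.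
Variables (e1 e2 : R).

Variables (a0 b0 tau : R) (x : R -> 'rV[R]_n).
Hypotheses (a0tau : a0 < tau) (taub0 : tau < b0).
Hypothesis xU : forall t, a0 <= t <= b0 -> U (x t).
Hypothesis hmin : locally_minimal G g e1 e2 a0 b0 x.
Let a0b0 := lt_trans a0tau taub0.
Let Itau : a0 <= tau <= b0. Proof. by rewrite !ltW. Qed.
Let a0tau' := ltW a0tau.
Let taub0' := ltW taub0.

Let one_p c d k : CkI c d k ((fun=> 1) : R -> R^o).
Proof. exact: CkI_cst. Qed.

(** Fundamental lemma of the calculus of variations, tested on a field whose constant direction is
    the value of [eulerI] at [tau]: by continuity the pairing stays positive near [tau]. The curve
    is C^6 across [tau], so the boundary terms of the two sides cancel. *)
Lemma euler_eq0 : CkI a0 b0 6 x -> eulerI G a0 b0 e1 e2 x tau = 0.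
Proof.
move=> x6; apply/eqP; apply: contraT => En0.
pose u := eulerI G a0 b0 e1 e2 x tau.
pose phi t := bilin (g (x t)) (eulerI G a0 b0 e1 e2 x t) u.
have x0 : CkI a0 b0 0 x by exact: CkI_le x6.
have x3 : CkI a0 b0 3 x by exact: CkI_le x6.
have cphi : CkI a0 b0 0 (phi : R -> R^o).
  exact: (CkI_g H xU x0 (CkI_eulerI H a0b0 xU x6) (CkI_cst _ _ _ u)).
have phi0 : 0 < phi tau by exact: (mc_pos H (xU Itau) En0).
have near_pos : \forall t \near tau, a0 <= t <= b0 -> 0 < phi t.
  have /cvgrPdist_lt/(_ _ phi0) := cphi tau Itau; rewrite near_withinE.
  apply: filterS => t ht tab; have := ht _; rewrite /= in_itv => /(_ tab).
  by rewrite ltr_norml => /andP[_]; rewrite ltrBlDr ltrDl.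
have /nbhs_ballP[e /= e0 he] := near_pos.
(* The halves keep the closed support inside the ball where [phi] is positive and strictly inside
   [[a0, b0]]. *)
pose d := Num.min (e / 2) (Num.min ((tau - a0) / 2) ((b0 - tau) / 2)).
have d0 : 0 < d by rewrite !lt_min !divr_gt0 ?subr_gt0.
have de : d <= e / 2 by rewrite ge_min lexx.
have da : d <= (tau - a0) / 2 by rewrite !ge_min lexx orbT.
have db : d <= (b0 - tau) / 2 by rewrite !ge_min lexx !orbT.
pose a := tau - d; pose b := tau + d.
have a0a : a0 < a by rewrite /a; lra.
have atau : a < tau by rewrite /a; lra.
have taub : tau < b by rewrite /b; lra.
have bb0 : b < b0 by rewrite /b; lra.
have a0a' := ltW a0a; have bb0' := ltW bb0; have atau' := ltW atau; have taub' := ltW taub.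
have pos t : a <= t <= b -> 0 < phi t.
  rewrite /a /b => /andP[t1 t2]; apply: he; last by apply/andP; split; lra.
  by rewrite /ball/= ltr_norml; apply/andP; split; lra.
have xl : CkI a tau 6 x by apply: CkI_sub x6.
have xr : CkI tau b 6 x by apply: CkI_sub x6.
have := first_variation H u a0a atau taub bb0 xU x3 xl xr one_p hmin.
have ITl : a <= tau <= tau by rewrite atau' lexx.
have ITr : tau <= tau <= b by rewrite taub' lexx.
have Vl k t : (k < 6)%N -> a <= t <= tau -> cvI a tau G x k t = cvI a0 b0 G x k t.
  by move=> k6; apply: (cvI_sub H a0b0 xU) => //; exact: CkI_le x6.
have Vr k t : (k < 6)%N -> tau <= t <= b -> cvI tau b G x k t = cvI a0 b0 G x k t.
  by move=> k6; apply: (cvI_sub H a0b0 xU) => //; exact: CkI_le x6.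
have Dl j (j6 : (j <= 6)%N) := CkI_derive_sub x6 a0b0 atau a0a' taub0' j6 ITl.
have Dr j (j6 : (j <= 6)%N) := CkI_derive_sub x6 a0b0 taub a0tau' bb0' j6 ITr.
rewrite /bdryI (Dl 1%N isT) (Dl 2%N isT) (Dl 3%N isT) (Dr 1%N isT) (Dr 2%N isT) (Dr 3%N isT).
rewrite (Vl 3%N tau isT ITl) (Vl 4%N tau isT ITl) (Vr 3%N tau isT ITr) (Vr 4%N tau isT ITr).
rewrite subrr add0r.
have El t : a <= t <= tau ->
    bilin (g (x t)) (eulerI G a tau e1 e2 x t) (bump_field a b (fun=> 1) u t) =
    cutoff a b t * phi t.
  move=> tab; rewrite /eulerI (Vl 0%N t isT tab) (Vl 1%N t isT tab) (Vl 2%N t isT tab).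
  rewrite (Vl 3%N t isT tab) (Vl 5%N t isT tab).
  by rewrite /bump_field mulr1 bilinZr.
have Er t : tau <= t <= b ->
    bilin (g (x t)) (eulerI G tau b e1 e2 x t) (bump_field a b (fun=> 1) u t) =
    cutoff a b t * phi t.
  move=> tab; rewrite /eulerI (Vr 0%N t isT tab) (Vr 1%N t isT tab) (Vr 2%N t isT tab).
  rewrite (Vr 3%N t isT tab) (Vr 5%N t isT tab).
  by rewrite /bump_field mulr1 bilinZr.
rewrite (Rintegral_eq_itv El) (Rintegral_eq_itv Er) => E0.
have cbl : CkI a tau 0 (fun t => cutoff a b t * phi t : R^o).
  apply: CkIM; last by apply: CkI_sub cphi.
  exact: CkI_le (CkI_cutoff a b a tau).
have I1 : (0 < \int[lebesgue_measure]_(t in `[a, tau]) (cutoff a b t * phi t))%R.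
  apply: (Rintegral_gt0 atau cbl) => t /andP[t1 t2].
    apply: mulr_ge0; first exact: cutoff_ge0.
    by apply/ltW/pos; rewrite t1 (le_trans t2 taub').
  apply: mulr_gt0; first by apply: cutoff_gt0; rewrite t1 (le_lt_trans t2 taub).
  by apply: pos; rewrite (ltW t1) (le_trans t2 taub').
have I2 : (0 <= \int[lebesgue_measure]_(t in `[tau, b]) (cutoff a b t * phi t))%R.
  apply: Rintegral_ge0 => t; rewrite /= in_itv/= => /andP[t1 t2].
  apply: mulr_ge0; first exact: cutoff_ge0.
  by apply/ltW/pos; rewrite t2 (le_trans atau' t1).
by move: (ltr_wpDr I2 I1); rewrite E0 ltxx.
Qed.

Hypotheses (x3 : CkI a0 b0 3 x) (xl : CkI a0 tau 6 x) (xr : CkI tau b0 6 x).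
Hypotheses (El : forall t, a0 <= t <= tau -> eulerI G a0 tau e1 e2 x t = 0)
  (Er : forall t, tau <= t <= b0 -> eulerI G tau b0 e1 e2 x t = 0).

Let a := (a0 + tau) / 2.
Let b := (tau + b0) / 2.
Let a0a : a0 < a. Proof. by have [] := midf_lt a0tau. Qed.
Let atau : a < tau. Proof. by have [] := midf_lt a0tau. Qed.
Let taub : tau < b. Proof. by have [] := midf_lt taub0. Qed.
Let bb0 : b < b0. Proof. by have [] := midf_lt taub0. Qed.

Let xUl t : a0 <= t <= tau -> U (x t).
Proof. by move=> /andP[t1 t2]; apply: xU; rewrite t1 (le_trans t2). Qed.
Let xUr t : tau <= t <= b0 -> U (x t).
Proof. by move=> /andP[t1 t2]; apply: xU; rewrite t2 (le_trans a0tau'). Qed.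
Let xs j := iter j (derive_within a0 b0) x.

Lemma bdry_diff y y1 y2 y3 v3 v4 v3' v4' h h1 h2 :
  bdry G g e1 e2 y y1 y2 y3 v3 v4 h h1 h2 - bdry G g e1 e2 y y1 y2 y3 v3' v4' h h1 h2 =
  - bilin (g y) (cvel G y y1 h h1) (v3 - v3') + bilin (g y) h (v4 - v4').
Proof. by rewrite /bdry !(bilinDr, bilinNr); ring. Qed.

Lemma boundary_jump (p : R -> R) (u : 'rV[R]_n) : (forall c d k, CkI c d k (p : R -> R^o)) ->
  let h := bump_field a b p u in let h1 := derive_within a0 b0 h in
  - bilin (g (x tau)) (cvel G (x tau) (xs 1 tau) (h tau) (h1 tau))
      (cvI a0 tau G x 3 tau - cvI tau b0 G x 3 tau)
  + bilin (g (x tau)) (h tau) (cvI a0 tau G x 4 tau - cvI tau b0 G x 4 tau) = 0.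
Proof.
move=> cp h h1.
have a0a' := ltW a0a; have bb0' := ltW bb0; have atau' := ltW atau; have taub' := ltW taub.
have ITl : a <= tau <= tau by rewrite atau' lexx.
have ITr : tau <= tau <= b by rewrite taub' lexx.
have xl' : CkI a tau 6 x by apply: CkI_sub xl.
have xr' : CkI tau b 6 x by apply: CkI_sub xr.
have := first_variation H u a0a atau taub bb0 xU x3 xl' xr' cp hmin.
have Vl k t : (k < 6)%N -> a <= t <= tau -> cvI a tau G x k t = cvI a0 tau G x k t.
  by move=> k6; apply: (cvI_sub H a0tau xUl) => //; exact: CkI_le xl.
have Vr k t : (k < 6)%N -> tau <= t <= b -> cvI tau b G x k t = cvI tau b0 G x k t.
  by move=> k6; apply: (cvI_sub H taub0 xUr) => //; exact: CkI_le xr.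
have Dl j (j6 : (j <= 3)%N) := CkI_derive_sub x3 a0b0 atau a0a' taub0' j6 ITl.
have Dr j (j6 : (j <= 3)%N) := CkI_derive_sub x3 a0b0 taub a0tau' bb0' j6 ITr.
rewrite /bdryI (Dl 1%N isT) (Dl 2%N isT) (Dl 3%N isT) (Dr 1%N isT) (Dr 2%N isT) (Dr 3%N isT).
rewrite (Vl 3%N tau isT ITl) (Vl 4%N tau isT ITl) (Vr 3%N tau isT ITr) (Vr 4%N tau isT ITr).
have El' t : a <= t <= tau -> bilin (g (x t)) (eulerI G a tau e1 e2 x t) (h t) = 0.
  move=> tab; rewrite /eulerI (Vl 0%N t isT tab) (Vl 1%N t isT tab) (Vl 2%N t isT tab).
  rewrite (Vl 3%N t isT tab) (Vl 5%N t isT tab) -/(eulerI G a0 tau e1 e2 x t) El ?bilin0l//.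
  by move/andP : tab => [t1 ->]; rewrite (le_trans a0a').
have Er' t : tau <= t <= b -> bilin (g (x t)) (eulerI G tau b e1 e2 x t) (h t) = 0.
  move=> tab; rewrite /eulerI (Vr 0%N t isT tab) (Vr 1%N t isT tab) (Vr 2%N t isT tab).
  rewrite (Vr 3%N t isT tab) (Vr 5%N t isT tab) -/(eulerI G tau b0 e1 e2 x t) Er ?bilin0l//.
  by move/andP : tab => [-> t2]; rewrite (le_trans t2).
rewrite -/h (Rintegral_eq_itv El') (Rintegral_eq_itv Er') !Rintegral_cst//= !mul0r !addr0.
by rewrite bdry_diff; exact.
Qed.

Let ct : 0 < cutoff a b tau.
Proof. by apply: cutoff_gt0; rewrite atau taub. Qed.

Lemma jump3 : cvI a0 tau G x 3 tau = cvI tau b0 G x 3 tau.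
Proof.
apply/eqP; rewrite -subr_eq0; apply: contraT => n0.
set u := _ - _ in n0.
(* With this profile the field vanishes at [tau], and its derivative there is a positive multiple of
   the jump [u] itself. *)
have cp c d k : CkI c d k ((fun t => t - tau) : R -> R^o).
  exact: (CkIB (CkI_id c d k) (CkI_cst c d k (tau : R^o))).
have := boundary_jump u cp.
have dc : is_dw a0 b0 (cutoff a b : R -> R^o) tau (derive_within a0 b0 (cutoff a b : R -> R^o) tau).
  by have [+ _] := CkI_derive a0b0 (CkI_le (isT : (1 <= 3)%N) (CkI_cutoff a b a0 b0)); apply.
have dp : is_dw a0 b0 ((fun t => t - tau) : R -> R^o) tau 1.
  have := is_dwB (is_dw_id a0 b0 tau) (is_dw_cst a0 b0 (tau : R^o) tau).
  by rewrite subr0.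
have dh : derive_within a0 b0 (bump_field a b (fun t => t - tau) u) tau = cutoff a b tau *: u.
  have := is_dwZv (u := u) (is_dwM dc dp); rewrite subrr mulr0 add0r mulr1.
  exact: is_dwE.
have h0 : bump_field a b (fun t => t - tau) u tau = 0.
  by rewrite /bump_field subrr mulr0 scale0r.
rewrite /= dh h0 bilin0l addr0 /cvel chr0r addr0 bilinZl -/u => /eqP.
by rewrite oppr_eq0 mulf_eq0 (gt_eqF ct) (gt_eqF (mc_pos H (xU Itau) n0)).
Qed.

Lemma jump4 : cvI a0 tau G x 4 tau = cvI tau b0 G x 4 tau.
Proof.
apply/eqP; rewrite -subr_eq0; apply: contraT => n0.
set u := _ - _ in n0.
have := boundary_jump u one_p.
rewrite jump3 subrr /= bilin0r oppr0 add0r -/u /bump_field mulr1 bilinZl => /eqP.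
by rewrite mulf_eq0 (gt_eqF ct) (gt_eqF (mc_pos H (xU Itau) n0)).
Qed.

Lemma jump_low k : (k <= 2)%N -> cvI a0 tau G x k tau = cvI tau b0 G x k tau.
Proof.
move=> k2; have ITl : a0 <= tau <= tau by rewrite a0tau' lexx.
have ITr : tau <= tau <= b0 by rewrite taub0' lexx.
have xk : CkI a0 b0 k.+1 x by apply: CkI_le x3.
rewrite (cvI_sub H a0b0 xU xk (lexx _) taub0' a0tau ITl).
by rewrite (cvI_sub H a0b0 xU xk a0tau' (lexx _) taub0 ITr).
Qed.

Lemma jump5 : cvI a0 tau G x 5 tau = cvI tau b0 G x 5 tau.
Proof.
have arith (A B C p q : 'rV[R]_n) : A - (p + B + C) = A - (q + B + C) -> p = q.
  by move=> /addrI/oppr_inj/addIr/addIr.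
have ITl : a0 <= tau <= tau by rewrite a0tau' lexx.
have ITr : tau <= tau <= b0 by rewrite taub0' lexx.
have := Er ITr; rewrite -(El ITl) /eulerI /euler jump3.
rewrite (jump_low (isT : (0 <= 2)%N)) (jump_low (isT : (1 <= 2)%N)) (jump_low (isT : (2 <= 2)%N)).
by move=> /arith/esym.
Qed.

Lemma jump_le5 k : (k <= 5)%N -> cvI a0 tau G x k tau = cvI tau b0 G x k tau.
Proof.
rewrite leq_eqVlt => /predU1P[->|]; first exact jump5.
rewrite ltnS leq_eqVlt => /predU1P[->|]; first exact jump4.
rewrite ltnS leq_eqVlt => /predU1P[->|]; first exact jump3.
by rewrite ltnS => k2; exact (jump_low k2).
Qed.

(** The candidate for V_k on the whole interval, defined before [x] is known to be regular enough
    across [tau]; up to order 5, [jump_le5] makes the choice at [tau] immaterial. *)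
Let W k t := if t <= tau then cvI a0 tau G x k t else cvI tau b0 G x k t.

Let Wl k t : a0 <= t <= tau -> cvI a0 tau G x k t = W k t.
Proof. by move=> /andP[_ tt]; rewrite /W tt. Qed.

Let Wr k t : (k <= 5)%N -> tau <= t <= b0 -> cvI tau b0 G x k t = W k t.
Proof.
move=> k5 /andP[tt _]; rewrite /W; case: ifPn => [tt'|_]; last by [].
have -> : t = tau by apply/le_anti; rewrite tt tt'.
by rewrite jump_le5.
Qed.

Let W0 k : (k <= 5)%N -> CkI a0 b0 0 (W k).
Proof.
move=> k5; have kx : (k < 6)%N by [].
apply: (CkI0_piecewise a0tau taub0).
  apply: CkI_eq (Wl k) _; apply: (CkI_cvI H a0tau xUl); rewrite addn0.
  exact: CkI_le xl.
apply: CkI_eq (fun t => Wr k5) _; apply: (CkI_cvI H taub0 xUr); rewrite addn0.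
exact: CkI_le xr.
Qed.

Let dx : forall t, a0 <= t <= b0 -> is_dw a0 b0 x t (W 0 t).
Proof.
apply: (is_dw_piecewise a0tau taub0) => t tab.
  rewrite -(Wl 0 tab); have [+ _] := CkI_derive a0tau (CkI_le (isT : (1 <= 6)%N) xl).
  exact.
rewrite -(Wr (isT : (0 <= 5)%N) tab).
have [+ _] := CkI_derive taub0 (CkI_le (isT : (1 <= 6)%N) xr).
exact.
Qed.

Let dW k : (k < 5)%N -> forall t, a0 <= t <= b0 ->
  is_dw a0 b0 (W k) t (W k.+1 t - chr (G (x t)) (W 0 t) (W k t)).
Proof.
move=> k5; apply: (is_dw_piecewise a0tau taub0) => t tab.
  rewrite -!(Wl _ tab) cvIS -[derive_within a0 tau x t]/(cvI a0 tau G x 0 t) addrK.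
  have ck : CkI a0 tau 1 (cvI a0 tau G x k).
    by apply: (CkI_cvI H a0tau xUl); apply: CkI_le xl; rewrite addn1.
  have [+ _] := CkI_derive a0tau ck => /(_ t tab).
  by apply: is_dw_eq => // s; rewrite in_itv; exact: Wl.
rewrite -(Wr k5 tab) -(Wr (ltnW k5) tab) -(Wr (isT : (0 <= 5)%N) tab).
rewrite cvIS -[derive_within tau b0 x t]/(cvI tau b0 G x 0 t) addrK.
have ck : CkI tau b0 1 (cvI tau b0 G x k).
  by apply: (CkI_cvI H taub0 xUr); apply: CkI_le xr; rewrite addn1.
have [+ _] := CkI_derive taub0 ck => /(_ t tab).
by apply: is_dw_eq => // s; rewrite in_itv; apply: Wr; exact: ltnW.
Qed.

(* W (k+1) is the covariant derivative of W k, so every derivative gained by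
   W (k+1) is gained by W k and, through W 0 = x', by x. *)
Let W_CkI j : (j <= 5)%N -> CkI a0 b0 j.+1 x /\ forall k, (k + j <= 5)%N -> CkI a0 b0 j (W k).
Proof.
elim: j => [|j IH] j5.
  split; first by exists (W 0) => //; exact: (W0 (isT : (0 <= 5)%N)).
  by move=> k; rewrite addn0; exact: W0.
have [cxj cW] := IH (ltnW j5).
have cW' k : (k + j.+1 <= 5)%N -> CkI a0 b0 j.+1 (W k).
  rewrite addnS => kj.
  exists (fun t => W k.+1 t - chr (G (x t)) (W 0 t) (W k t)).
    by apply: dW; rewrite (leq_ltn_trans _ kj)// leq_addr.
  have c1 : CkI a0 b0 j (W k.+1) by apply: cW; rewrite addSn.
  have c2 : CkI a0 b0 j (W k) by apply: cW; exact: ltnW.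
  have c3 : CkI a0 b0 j (W 0) by apply: cW; rewrite add0n ltnW.
  exact: (CkIB c1 (CkI_chrG H xU (CkI_le (leqnSn _) cxj) c3 c2)).
split=> //; exists (W 0); first exact: dx.
exact: (cW' 0).
Qed.

Lemma CkI6 : CkI a0 b0 6 x.
Proof. by case: (W_CkI (leqnn 5)). Qed.

Lemma euler_at : eulerI G a0 b0 e1 e2 x tau = 0.
Proof. exact: euler_eq0 CkI6. Qed.

End ChartConclusion.

(** * Changes of charts *)

Section SmoothVector.
Variables (R : realType).

Lemma Ck_on_eq (V W : normedModType R) (U : set V) k (f g : V -> W) : open U ->
  (forall x, U x -> f x = g x) -> Ck_on k U f -> Ck_on k U g.
Proof.
move=> oU; elim: k f g => [|k IH] f g fg /=.
  move=> [h _]; split => // x Ux; rewrite /prop_for /continuous_at -(fg x Ux).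
  apply: cvg_trans (h x Ux); apply: near_eq_cvg.
  have : nbhs x U by apply: open_nbhs_nbhs.
  by apply: filterS => y; exact: fg.
move=> [h d]; split.
  move=> x Ux; rewrite /prop_for /continuous_at -(fg x Ux).
  apply: cvg_trans (h x Ux); apply: near_eq_cvg.
  have : nbhs x U by apply: open_nbhs_nbhs.
  by apply: filterS => y; exact: fg.
have near_fg x : U x -> \near x, f x = g x.
  move=> Ux; have : nbhs x U by apply: open_nbhs_nbhs.
  by apply: filterS => y; exact: fg.
move=> v; have [d1 d2] := d v; split.
  by move=> x Ux; exact: near_eq_derivable (near_fg x Ux) (d1 x Ux).
by apply: IH d2 => x Ux; exact: near_eq_derive (near_fg x Ux).
Qed.

Lemma derive_coord (V : normedModType R) m (f : V -> 'rV[R]_m) x v j :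
  derivable f x v -> ('D_v f x) 0 j = 'D_v (fun y => f y 0 j : R^o) x.
Proof. by move=> h; rewrite derive_mx// mxE. Qed.

Lemma smooth_coord (V : normedModType R) m (U : set V) (f : V -> 'rV[R]_m) j : open U ->
  smooth_on U f -> smooth_on U (fun x => f x 0 j : R^o).
Proof.
move=> oU hf k; have {hf} := hf k.
have C (h : V -> 'rV[R]_m) x : {for x, continuous h} ->
    {for x, continuous (fun y => h y 0 j : R^o)}.
  by move=> /cvg_rVP; exact.
elim: k f => [|k IH] f /= [h1 h2].
  by split => // x Ux; apply: C; exact: h1.
split; first by move=> x Ux; apply: C; exact: h1.
move=> v; have [d1 d2] := h2 v; split.
  by move=> x Ux; have /derivable_mxP := d1 x Ux; exact.
by apply: Ck_on_eq (IH _ d2) => // x Ux; rewrite derive_coord//; exact: d1.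
Qed.

Lemma smooth_cst (V W : normedModType R) (U : set V) (w : W) : smooth_on U (fun=> w).
Proof.
move=> k; elim: k w => [|k IH] w; split => //; try by move=> x _; exact: cst_continuous.
move=> v; split; first by move=> x _; exact: derivable_cst.
rewrite (_ : (fun x => 'D_v (fun=> w) x) = fun=> 0); first exact: IH.
by apply/funext => x; rewrite derive_cst.
Qed.

End SmoothVector.

Section VectorMap.
Variables (R : realType) (n m : nat) (U : set 'rV[R]_n) (f : 'rV[R]_n -> 'rV[R]_m).
Hypotheses (oU : open U) (sf : smooth_on U f).

Lemma vec_deriveD x v w : U x -> 'D_(v + w) f x = 'D_v f x + 'D_w f x.
Proof.
move=> Ux; have d u : derivable f x u by exact: smooth_derivable sf Ux.
apply/rowP => j; rewrite mxE (derive_coord j (d (v + w))) (derive_coord j (d v)) (derive_coord j (d w)).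
have sj := smooth_coord j oU sf.
rewrite (derive_sumE (v + w) oU sj Ux) (derive_sumE v oU sj Ux) (derive_sumE w oU sj Ux).
by rewrite -big_split/=; apply: eq_bigr => k _; rewrite mxE mulrDl.
Qed.

Lemma vec_chain a b (c : R -> 'rV[R]_n) t l : U (c t) -> is_dw a b c t l ->
  is_dw a b (f \o c) t ('D_l f (c t)).
Proof.
move=> Ux hc; apply/is_dw_rVP => j; rewrite derive_coord; last exact: smooth_derivable sf Ux.
exact: (chain oU (smooth_coord j oU sf) Ux hc).
Qed.

(** Point and direction both move, so the direction is expanded in the basis. Symmetry of second
    derivatives then gives the order that appears in [christoffel_transition]. *)
Lemma vec_chain2 a b (c w : R -> 'rV[R]_n) t c' w' : a <= t <= b ->
  (forall t, a <= t <= b -> U (c t)) -> is_dw a b c t c' -> is_dw a b w t w' ->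
  is_dw a b (fun s => 'D_(w s) f (c s)) t
    ('D_c' (fun y => 'D_(w t) f y) (c t) + 'D_w' f (c t)).
Proof.
move=> tab hU hc hw; have Ux := hU t tab; apply/is_dw_rVP => j.
have sj := smooth_coord j oU sf.
pose f' := (fun y => f y 0 j) : 'rV[R]_n -> R^o.
have /is_dw_rVP hwk := hw.
have D k := chain oU (smooth_derive (delta_mx 0 k) sj) Ux hc.
have S := @is_dw_sum _ R^o a b _ (index_enum 'I_n) predT _ t _ (fun k _ => is_dwM (hwk k) (D k)).
have S' : is_dw a b (fun s => ('D_(w s) f (c s)) 0 j : R^o) t
   (\sum_k (w' 0 k * 'D_(delta_mx 0 k) f' (c t) +
            w t 0 k * 'D_c' ('D_(delta_mx 0 k) f') (c t))).
  apply: is_dw_eq S => // s; rewrite in_itv/= => /hU Us.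
  rewrite derive_coord; last exact: smooth_derivable sf Us.
  by rewrite (derive_sumE _ oU sj Us).
move: S'; congr is_dw; rewrite mxE big_split/= addrC; congr (_ + _).
  rewrite derive_coord; last exact: smooth_derivable (smooth_derive _ sf) Ux.
  have -> : 'D_c' (fun y => ('D_(w t) f y) 0 j : R^o) (c t) = 'D_c' ('D_(w t) f') (c t).
    apply: near_eq_derive; have : nbhs (c t) U by apply: open_nbhs_nbhs.
    by apply: filterS => y Uy; rewrite derive_coord//; exact: smooth_derivable sf Uy.
  rewrite (schwarz _ _ oU sj Ux) (derive_sumE _ oU (smooth_derive _ sj) Ux).
  by apply: eq_bigr => k _; rewrite (schwarz _ _ oU sj Ux).
rewrite derive_coord; last exact: smooth_derivable sf Ux.
by rewrite (derive_sumE _ oU sj Ux).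
Qed.

Lemma vec_CkI_comp a b k (c : R -> 'rV[R]_n) : (forall t, a <= t <= b -> U (c t)) ->
  CkI a b k c -> CkI a b k (f \o c).
Proof.
by move=> hU hc; apply/CkI_rVP => j; exact: (CkI_comp oU (smooth_coord j oU sf) hU hc).
Qed.

End VectorMap.

Section Geometry.
Variables (R : realType) (n : nat) (M : smoothManifold R n).
Variables (g : riemannianMetric M) (nabla : affineConnection M).
Hypothesis hnabla : levi_civita g nabla.

Lemma img_open (i : chart M) : open (img i). Proof. exact: phi_open. Qed.

Lemma img_dom (i : chart M) x : img i x -> dom i (psi i x) /\ phi i (psi i x) = x.
Proof. by move=> [p hp <-]; rewrite phiK. Qed.

Lemma overlap_open (i j : chart M) : open (overlap i j).
Proof.
rewrite openE => x [p [pi pj] <-]; rewrite /interior.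
have Ix : img i (phi i p) by exists p.
have h1 : nbhs (phi i p) (img i) by apply: open_nbhs_nbhs; split => //; exact: img_open.
have h2 : nbhs (phi i p) (psi i @^-1` dom j).
  apply: (psi_continuous Ix); rewrite phiK//.
  by apply: open_nbhs_nbhs; split => //; exact: dom_open.
apply: filterS2 h1 h2 => y [r ri <-] /=; rewrite phiK// => rj.
by exists r.
Qed.

Lemma smooth_transition (i j : chart M) : smooth_on (overlap i j) (transition i j).
Proof. exact: transition_smooth. Qed.

(** On fields with constant components, absence of torsion becomes the symmetry of the Christoffel
    symbols, and compatibility the formula for the derivative of the metric. *)
Lemma chart_geometry (i : chart M) :
  metric_chart (img i) (christoffel nabla i) (metric_mx g i).
Proof.
have [tf mc] := hnabla.
split.
- exact: img_open.
- by move=> k; exact: christoffel_smooth.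
- exact: metric_smooth.
- move=> x u v Ix.
  have := tf i (fun=> u) (fun=> v) (smooth_cst _ _) (smooth_cst _ _) x Ix.
  rewrite /cov_deriv /lie_bracket !derive_cst !add0r oppr0 => /eqP.
  by rewrite subr_eq0 => /eqP.
- by move=> x Ix; apply: (Defs.metric_sym g (a := i)); exact: Ix.
- by move=> x v Ix; apply: (metric_posdef g (a := i)); exact: Ix.
- move=> x w u v Ix.
  have := mc i (fun=> w) (fun=> u) (fun=> v) (smooth_cst _ _) (smooth_cst _ _)
    (smooth_cst _ _) x Ix.
  rewrite /cov_deriv !derive_cst !add0r.
  by have [_ ->] := derive_bilin (@img_open i) w u v (@metric_smooth _ _ _ g i) Ix.
Qed.

Lemma derive_christoffel (i : chart M) u v w x : img i x ->
  'D_u (fun y => christoffel_apply (christoffel nabla i y) v w) x =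
  chr (dG (christoffel nabla i) u x) v w.
Proof.
move=> Ix.
have H := chart_geometry i.
have D k := derive_bilin (mc_open H) u v w (mc_G H k) Ix.
have E k : (fun y => (christoffel_apply (christoffel nabla i y) v w) 0 k : R^o) =
    (fun y => bilin (christoffel nabla i y k) v w : R^o).
  by apply/funext => y; rewrite mxE.
rewrite derive_mx; last first.
  apply/derivable_mxP => r k; rewrite (ord1 r) E.
  by have [] := D k.
by apply/rowP => k; rewrite mxE E chrE; have [_ ->] := D k.
Qed.

Lemma curvatureE (i : chart M) x u v w : img i x ->
  curvature nabla i x u v w = Rm (christoffel nabla i) x u v w.
Proof.
move=> Ix.
have cd p q y : cov_deriv nabla i (fun=> p) (fun=> q) y =
    christoffel_apply (christoffel nabla i y) p q.
  by rewrite /cov_deriv derive_cst add0r.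
have cd2 p q r : cov_deriv nabla i (fun=> p) (cov_deriv nabla i (fun=> q) (fun=> r)) x =
    chr (dG (christoffel nabla i) p x) q r +
    chr (christoffel nabla i x) p (chr (christoffel nabla i x) q r).
  rewrite {1}/cov_deriv cd; congr (_ + _).
  rewrite -(derive_christoffel p q r Ix); congr ('D_p _ x).
  by apply/funext => y; exact: cd.
rewrite /curvature /curvature_field !cd2.
have -> : lie_bracket (fun=> u) (fun=> v) = (fun=> 0) :> ('rV[R]_n -> 'rV[R]_n).
  by apply/funext => y; rewrite /lie_bracket !derive_cst subrr.
by rewrite cd -/(chr _ 0 w) chr0l subr0.
Qed.

Section Transfer.
Variables (a b : R) (c : R -> M) (i j : chart M).
Hypothesis ab : a < b.
Hypotheses (ci : forall t, a <= t <= b -> dom i (c t))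
  (cj : forall t, a <= t <= b -> dom j (c t)).
Let x := Defs.coord i c.
Let y := Defs.coord j c.
Let tr := transition i j.

Lemma coord_img t : a <= t <= b -> img i (x t).
Proof. by move=> tab; exists (c t) => //; exact: ci. Qed.

Lemma coord_overlap t : a <= t <= b -> overlap i j (x t).
Proof. by move=> tab; exists (c t) => //; split; [exact: ci|exact: cj]. Qed.

Lemma coord_transition t : a <= t <= b -> (tr \o x) t = y t.
Proof. by move=> tab; rewrite /tr /transition /= /x /y /Defs.coord /= phiK//; exact: ci. Qed.

Lemma CkI_transfer k : CkI a b k x -> CkI a b k y.
Proof.
move=> cx; apply: CkI_eq coord_transition _.
exact: (vec_CkI_comp (@overlap_open i j) (@smooth_transition i j) coord_overlap cx).
Qed.

(** Differentiating the transformed vector along the curve produces a second derivative of the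
    transition map, which the transformation law of the Christoffel symbols accounts for. *)
Lemma cvI_transfer k t : CkI a b k.+1 x -> a <= t <= b ->
  cvI a b (christoffel nabla j) y k t =
  'D_(cvI a b (christoffel nabla i) x k t) tr (x t).
Proof.
have oO := @overlap_open i j; have sT := @smooth_transition i j.
have vel s : CkI a b 1 x -> a <= s <= b -> derive_within a b y s = 'D_(derive_within a b x s) tr (x s).
  move=> cx sab; have [+ _] := CkI_derive ab cx => /(_ s sab) dx.
  apply: (is_dwE ab sab); have := vec_chain oO sT (coord_overlap sab) dx.
  by apply: (is_dw_eq sab) => r; rewrite in_itv; exact: coord_transition.
elim: k t => [|k IH] t cx tab; first exact: vel.
have cx1 : CkI a b 1 x by apply: CkI_le cx.
have cxk : CkI a b k.+1 x by apply: CkI_le cx.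
rewrite !cvIS IH// (vel t cx1 tab) -(coord_transition tab).
have H := chart_geometry i.
have cV : CkI a b 1 (cvI a b (christoffel nabla i) x k).
  by apply: (CkI_cvI H ab coord_img); rewrite addn1.
have [+ _] := CkI_derive ab cV => /(_ t tab) dV.
have [+ _] := CkI_derive ab cx1 => /(_ t tab) dx.
have D := vec_chain2 oO sT tab coord_overlap dx dV.
have -> : derive_within a b (cvI a b (christoffel nabla j) y k) t =
   'D_(derive_within a b x t) (fun z => 'D_(cvI a b (christoffel nabla i) x k t) tr z) (x t) +
   'D_(derive_within a b (cvI a b (christoffel nabla i) x k) t) tr (x t).
  apply: (is_dwE ab tab); apply: (is_dw_eq tab _ D) => s; rewrite in_itv => sab.
  by rewrite -IH.
rewrite (vec_deriveD oO sT _ _ (coord_overlap tab)).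
rewrite [in RHS](christoffel_transition nabla _ _ (coord_overlap tab)).
by rewrite [X in X + _ = _]addrC -addrA; congr (_ + _).
Qed.

Lemma inner_transfer k t : CkI a b k.+1 x -> a <= t <= b ->
  inner g i (x t) (cvI a b (christoffel nabla i) x k t) (cvI a b (christoffel nabla i) x k t) =
  inner g j (y t) (cvI a b (christoffel nabla j) y k t) (cvI a b (christoffel nabla j) y k t).
Proof.
move=> cx tab; rewrite /inner (metric_transition g _ _ (coord_overlap tab)).
by rewrite -(coord_transition tab) cvI_transfer.
Qed.

End Transfer.

End Geometry.

Section CvILocal.
Variables (R : realType) (n : nat) (G : 'rV[R]_n -> 'I_n -> 'M[R]_n).

Lemma cvI_rnb a b a' b' (x : R -> 'rV[R]_n) k t : rnb a b a' b' t ->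
  cvI a b G x k t = cvI a' b' G x k t.
Proof.
elim: k t => [|k IH] t h; first exact: (iter_derive_rnb x 1 h).
rewrite !cvIS (IH t h).
have E : derive_within a b x t = derive_within a' b' x t := iter_derive_rnb x 1 h.
rewrite E.
have [aa bb ab' tab near_t] := h.
have F : derive_within a b (cvI a b G x k) t = derive_within a' b' (cvI a' b' G x k) t.
  apply: (derive_within_local aa bb (rnb_in h)).
  have := rnb_near h; apply: filterS => u H uab; have hu := H uab.
  by split; [have [_ _ _ r _] := hu; exact: r|exact: IH hu].
by rewrite F.
Qed.

Lemma cvI_eq a b (x y : R -> 'rV[R]_n) k t : (forall u, a <= u <= b -> x u = y u) ->
  a <= t <= b -> cvI a b G x k t = cvI a b G y k t.
Proof.
move=> xy; have D u : a <= u <= b -> derive_within a b x u = derive_within a b y u.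
  by move=> uab; exact: derive_within_eq uab xy.
elim: k t => [|k IH] t tab; first exact: D.
by rewrite !cvIS (derive_within_eq tab IH) (xy _ tab) (D _ tab) (IH _ tab).
Qed.

End CvILocal.

(** * Curves on the manifold *)

Section Curves.
Variables (R : realType) (n : nat) (M : smoothManifold R n).
Implicit Types (c : R -> M) (i j : chart M) (a b t : R).

Lemma near_dom a b c j t : a <= t <= b ->
  c u @[u --> within `[a, b] (nbhs t)] --> c t -> dom j (c t) ->
  \forall u \near t, a <= u <= b -> dom j (c u).
Proof.
move=> tab cc jt.
have H : \forall u \near within `[a, b] (nbhs t), dom j (c u).
  by apply: cc; apply: open_nbhs_nbhs; split => //; exact: dom_open.
move: H; rewrite near_withinE; apply: filterS => u hu uab; apply: hu.
by rewrite /= in_itv.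
Qed.

(** [Ck_curve] quantifies over every chart around each point, whereas one chart is enough because
    transition maps are smooth. Continuity of the curve comes from that of [psi]. *)
Lemma curve_of_charts a b k c : a < b ->
  (forall t, a <= t <= b -> exists a' b' i, [/\ rnb a b a' b' t,
     (forall u, a' <= u <= b' -> dom i (c u)) & CkI a' b' k (Defs.coord i c)]) ->
  Ck_curve a b k c.
Proof.
move=> ab h.
have cc t : a <= t <= b -> c u @[u --> within `[a, b] (nbhs t)] --> c t.
  move=> tab; have [a' [b' [i [rt di ci]]]] := h t tab.
  have [aa bb ab' tab' nt] := rt.
  have [_ /(_ 0 (leq0n _))/= cx] := CkI_rnb rt ci.
  have It : img i (Defs.coord i c t) by exists (c t) => //; exact: di.
  have E : psi i (Defs.coord i c t) = c t := phiK (di t tab').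
  have pc : psi i y @[y --> Defs.coord i c t] --> c t.
    by rewrite -[X in _ --> X]E; exact: psi_continuous It.
  have H : (psi i \o Defs.coord i c) u @[u --> within `[a, b] (nbhs t)] --> c t.
    exact: (cvg_comp _ _ cx pc).
  apply: cvg_trans H; apply: near_eq_cvg; rewrite near_withinE.
  apply: filterS nt => u hu; rewrite /= in_itv/= => uab.
  by rewrite /Defs.coord /= phiK//; apply: di; exact: hu.
split; first by apply/subspace_continuousP => t; rewrite /= in_itv/=; exact: cc.
move=> j t tab jt D.
have [a' [b' [i [rt di ci]]]] := h t tab.
have [aa bb ab' tab' nt] := rt.
have nj := near_dom tab (cc t tab) jt.
have nP : \forall u \near t, a <= u <= b -> a' <= u <= b' /\ dom j (c u).
  by apply: filterS2 nt nj => u h1 h2 uab; split; [exact: h1|exact: h2].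
have [a2 [b2 [r2 P2]]] := rnb_ex ab tab nP.
have [_ _ ab2 tab2 _] := r2.
have a2' : a' <= a2.
  have [/andP[]] : a' <= a2 <= b' /\ dom j (c a2) by apply: P2; rewrite lexx ltW.
  by [].
have b2' : b2 <= b'.
  have [/andP[]] : a' <= b2 <= b' /\ dom j (c b2) by apply: P2; rewrite lexx ltW.
  by [].
have cj : CkI a2 b2 k (Defs.coord j c).
  apply: (CkI_transfer (i := i)).
  - by move=> u /P2[ua _]; exact: di.
  - by move=> u /P2[].
  - exact: CkI_sub ci.
exact: CkI_rnb r2 cj.
Qed.

Lemma curve_continuous a b k c t : Ck_curve a b k c -> a <= t <= b ->
  c u @[u --> within `[a, b] (nbhs t)] --> c t.
Proof.
by move=> [/subspace_continuousP h _] tab; apply: h; rewrite /= in_itv.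
Qed.

Lemma chart_of_curve a b a' b' k c i : Ck_curve a b k c -> a <= a' -> b' <= b ->
  (forall u, a' <= u <= b' -> dom i (c u)) -> CkI a' b' k (Defs.coord i c).
Proof.
move=> [_ h] aa bb di.
have sub u : a' <= u <= b' -> a <= u <= b.
  by move=> /andP[h1 h2]; rewrite (le_trans aa h1) (le_trans h2 bb).
apply: (CkI_of_derivable aa bb) => u j uab jk.
  by have [h1 _] := h i u (sub u uab) (di u uab); exact: h1.
by have [_ h1] := h i u (sub u uab) (di u uab); exact: h1.
Qed.

Lemma chart_nbhd a b k c i t : a < b -> Ck_curve a b k c -> a <= t <= b -> dom i (c t) ->
  exists a' b', rnb a b a' b' t /\ forall u, a' <= u <= b' -> dom i (c u).
Proof.
by move=> ab hc tab it; apply: (rnb_ex ab tab); exact: near_dom tab (curve_continuous hc tab) it.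
Qed.

Lemma Ck_curve_sub a b a' b' k c : Ck_curve a b k c -> a <= a' -> b' <= b -> a' < b' ->
  Ck_curve a' b' k c.
Proof.
move=> hc aa bb ab'; apply: (curve_of_charts ab') => t tab'.
have sub u : a' <= u <= b' -> a <= u <= b.
  by move=> /andP[h1 h2]; rewrite (le_trans aa h1) (le_trans h2 bb).
have it := chart_atP (c t).
have nj := near_dom (sub t tab') (curve_continuous hc (sub t tab')) it.
have nP : \forall u \near t, a' <= u <= b' -> dom (chart_at (c t)) (c u).
  by apply: filterS nj => u hu uab; exact: hu (sub u uab).
have [a2 [b2 [r2 P2]]] := rnb_ex ab' tab' nP.
exists a2, b2, (chart_at (c t)); split => //.
have [a2' b2' _ _ _] := r2.
exact: chart_of_curve hc (le_trans aa a2') (le_trans b2' bb) P2.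
Qed.

Lemma Ck_curve_eq a b k c c' : a < b -> (forall u, a <= u <= b -> c u = c' u) ->
  Ck_curve a b k c -> Ck_curve a b k c'.
Proof.
move=> ab cc' hc; apply: (curve_of_charts ab) => t tab.
have [a2 [b2 [r2 P2]]] := chart_nbhd ab hc tab (chart_atP (c t)).
have [a2' b2' _ _ _] := r2.
have sub u : a2 <= u <= b2 -> a <= u <= b.
  by move=> /andP[h1 h2]; rewrite (le_trans a2' h1) (le_trans h2 b2').
exists a2, b2, (chart_at (c t)); split => //.
  by move=> u uab; rewrite -cc'; [exact: P2|exact: sub].
apply: CkI_eq (chart_of_curve hc a2' b2' P2) => u uab.
by rewrite /Defs.coord /= (cc' u (sub u uab)).
Qed.

Lemma pw_nil a c : piecewise_smooth a a c.
Proof. by exists [::] => //; split => //=. Qed.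

Lemma pw_cons a m b c : a < m -> smooth_curve a m c -> piecewise_smooth m b c ->
  piecewise_smooth a b c.
Proof.
move=> am hc [s [s1 s2] hs]; exists (m :: s).
  by split => //=; rewrite am.
by case=> [|j] /= js //; exact: hs.
Qed.

Lemma pw_ind b c (P : R -> Prop) : P b ->
  (forall a m, a < m -> m <= b -> smooth_curve a m c -> P m -> P a) ->
  forall a, piecewise_smooth a b c -> P a.
Proof.
move=> Pb Pstep a [s]; elim: s a => [|m s IH] a hs hsm.
  by rewrite (itv_partition_nil hs).
have hs' := itv_partition_cons hs.
have am : a < m by case: hs => /= /andP[].
apply: (Pstep a m am).
- exact: itv_partition_le hs'.
- exact: (hsm 0).
- by apply: IH => // j js; exact: (hsm j.+1).
Qed.

Lemma smooth_curve_sub a b a' b' c : smooth_curve a b c -> a <= a' -> b' <= b -> a' < b' ->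
  smooth_curve a' b' c.
Proof. by move=> hc aa bb ab k; exact: Ck_curve_sub (hc k) aa bb ab. Qed.

Lemma pw_sub_l a b c a' : piecewise_smooth a b c -> a <= a' <= b -> piecewise_smooth a' b c.
Proof.
move=> h; move: a h a'; apply: pw_ind.
  by move=> a' /le_anti <-; exact: pw_nil.
move=> a m am mb hc IH a' /andP[aa a'b]; have [ma|a'm] := leP m a'.
  by apply: IH; rewrite ma.
apply: (pw_cons a'm); first exact: smooth_curve_sub hc aa (lexx _) a'm.
by apply: IH; rewrite lexx.
Qed.

Lemma pw_sub_r a b c b' : piecewise_smooth a b c -> a <= b' <= b -> piecewise_smooth a b' c.
Proof.
move=> h; move: a h b'; apply: pw_ind.
  by move=> b' /le_anti <-; exact: pw_nil.
move=> a m am mb hc IH b' /andP[ab bb]; have [mb'|b'm] := leP m b'.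
  by apply: (pw_cons am hc); apply: IH; rewrite mb'.
move: ab; rewrite le_eqVlt => /predU1P[->|ab]; first exact: pw_nil.
apply: (pw_cons ab); last exact: pw_nil.
exact: smooth_curve_sub hc (lexx _) (ltW b'm) ab.
Qed.

Lemma pw_cat a m b c : piecewise_smooth a m c -> piecewise_smooth m b c ->
  piecewise_smooth a b c.
Proof.
move=> h hb; move: a h; apply: pw_ind => // a m' am _ hc; exact: pw_cons.
Qed.

Lemma pw_eq a b c c' : (forall u, a <= u <= b -> c u = c' u) ->
  piecewise_smooth a b c -> piecewise_smooth a b c'.
Proof.
move=> + h; move: a h; apply: pw_ind; first by move=> _; exact: pw_nil.
move=> a m am mb hc IH cc'; apply: (pw_cons am).
  move=> k; apply: Ck_curve_eq (hc k) => // u /andP[u1 u2]; apply: cc'.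
  by rewrite u1 (le_trans u2).
by apply: IH => u /andP[u1 u2]; apply: cc'; rewrite u2 (le_trans (ltW am)).
Qed.

Lemma pw_right a b c t : piecewise_smooth a b c -> a <= t -> t < b ->
  exists d, [/\ t < d, d <= b & smooth_curve t d c].
Proof.
move=> h at_ tb; have := pw_sub_l (a' := t) h; rewrite at_ ltW// => /(_ isT) {}h.
move: t h {at_} tb; apply: pw_ind; first by rewrite ltxx.
by move=> t m tm mb hc _ _; exists m.
Qed.

Lemma pw_left a b c t : piecewise_smooth a b c -> a < t -> t <= b ->
  exists d, [/\ a <= d, d < t & smooth_curve d t c].
Proof.
move=> h; move: a h t; apply: pw_ind => [t|a m am mb hc IH t at_ tb].
  by move=> bt; rewrite leNgt bt.
have [tm|mt] := leP t m.
  by exists a; split => //; exact: smooth_curve_sub hc (lexx _) tm at_.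
have [d [md dt hd]] := IH t mt tb.
by exists d; split => //; rewrite (le_trans (ltW am)).
Qed.

(** A single chart contains the whole arc, so on each smooth piece the new curve has coordinates
    given by a sum of two smooth functions. *)
Lemma pw_chart_field a b c c' i (h : R -> 'rV[R]_n) : piecewise_smooth a b c ->
  (forall u, a <= u <= b -> dom i (c u)) -> (forall k, CkI a b k h) ->
  (forall u, a <= u <= b -> img i (Defs.coord i c u + h u)) ->
  (forall u, a <= u <= b -> c' u = psi i (Defs.coord i c u + h u)) ->
  piecewise_smooth a b c'.
Proof.
move=> p; move: a p; apply: pw_ind; first by move=> *; exact: pw_nil.
move=> a m am mb hc IH di ch hU E.
have sub u : a <= u <= m -> a <= u <= b.
  by move=> /andP[-> u2]; rewrite (le_trans u2).
have sub' u : m <= u <= b -> a <= u <= b.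
  by move=> /andP[u1 ->]; rewrite (le_trans (ltW am)).
apply: (pw_cons am).
  move=> k; apply: (curve_of_charts am) => t tam; exists a, m, i; split.
  - by split => //; near=> u.
  - move=> u /sub uab; rewrite (E u uab).
    by have [] := img_dom (hU u uab).
  - have cx : CkI a m k (Defs.coord i c).
      by apply: (chart_of_curve (hc k) (lexx _) (lexx _)) => u /sub; exact: di.
    apply: CkI_eq (CkID cx (CkI_sub (lexx _) mb (ch k))) => u /sub uab.
    rewrite /Defs.coord /= (E u uab).
    by have [] := img_dom (hU u uab).
apply: IH.
- by move=> u /sub'; exact: di.
- by move=> k; apply: CkI_sub (ch k) => //; exact: ltW.
- by move=> u /sub'; exact: hU.
- by move=> u /sub'; exact: E.
Unshelve. all: by end_near. Qed.

End Curves.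

(** * The energy density in a fixed chart *)

Section Density.
Variables (R : realType) (n : nat) (M : smoothManifold R n).
Variables (g : riemannianMetric M) (nabla : affineConnection M).
Hypothesis hnabla : levi_civita g nabla.
Variables (eps1 eps2 T : R).
Hypothesis T0 : 0 < T.

Definition density (c : R -> M) (t : R) : R :=
  eps1 ^+ 2 * cov_velocity_norm g nabla T c 0 t ^+ 2 +
  eps2 ^+ 2 * cov_velocity_norm g nabla T c 1 t ^+ 2 +
  cov_velocity_norm g nabla T c 2 t ^+ 2.

Lemma inner_ge0 (i : chart M) x v : img i x -> 0 <= inner g i x v v.
Proof.
move=> Ix; have [->|v0] := eqVneq v 0; first by rewrite /inner bilin0l.
by rewrite ltW// /inner; exact: metric_posdef.
Qed.

(** [cov_velocity_norm] reads the norm in the chart [chart_at (c t)], which may change arbitrarily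
    with [t]; the transformation laws bring it to a chart that is fixed on an interval. *)
Lemma cov_velocity_normE c k t a b (i : chart M) : Ck_curve 0 T 3 c -> (k <= 2)%N ->
  rnb 0 T a b t -> (forall u, a <= u <= b -> dom i (c u)) ->
  cov_velocity_norm g nabla T c k t ^+ 2 =
  inner g i (Defs.coord i c t) (cvI a b (christoffel nabla i) (Defs.coord i c) k t)
    (cvI a b (christoffel nabla i) (Defs.coord i c) k t).
Proof.
move=> hc k2 rt di; have [aa bb ab tab nt] := rt; have tT := rnb_in rt.
set j := chart_at (c t).
have jt : dom j (c t) := chart_atP (c t).
rewrite /cov_velocity_norm -/j /gnorm sqr_sqrtr; last first.
  by apply: inner_ge0; exists (c t).
have nj := near_dom tT (curve_continuous hc tT) jt.
have nP : \forall u \near t, 0 <= u <= T -> a <= u <= b /\ dom j (c u).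
  by apply: filterS2 nt nj => u h1 h2 uab; split; [exact: h1|exact: h2].
have [a2 [b2 [r2 P2]]] := rnb_ex T0 tT nP.
have [a2' b2' ab2 tab2 _] := r2.
have di2 u : a2 <= u <= b2 -> dom i (c u) by move=> /P2[/di].
have dj2 u : a2 <= u <= b2 -> dom j (c u) by move=> /P2[].
have ci : CkI a2 b2 k.+1 (Defs.coord i c).
  exact: CkI_le (chart_of_curve hc a2' b2' di2).
have := inner_transfer hnabla ab2 di2 dj2 ci tab2.
rewrite -(cvI_rnb _ _ _ r2) -(cvI_rnb _ _ _ r2) => E.
rewrite -(cvI_rnb _ _ _ rt) E.
by [].
Qed.

Lemma density_lagr c t a b (i : chart M) : Ck_curve 0 T 3 c ->
  rnb 0 T a b t -> (forall u, a <= u <= b -> dom i (c u)) ->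
  density c t = lagrI (christoffel nabla i) (metric_mx g i) (eps1 ^+ 2) (eps2 ^+ 2) a b
    (Defs.coord i c) t.
Proof.
move=> hc rt di; have [aa bb ab tab nt] := rt.
have H := chart_geometry hnabla i.
have cx : CkI a b 3 (Defs.coord i c) by exact: chart_of_curve hc aa bb di.
have xU u : a <= u <= b -> img i (Defs.coord i c u) by move=> uab; exists (c u) => //; exact: di.
rewrite /density (cov_velocity_normE hc (isT : (0 <= 2)%N) rt di).
rewrite (cov_velocity_normE hc (isT : (1 <= 2)%N) rt di).
rewrite (cov_velocity_normE hc (isT : (2 <= 2)%N) rt di).
rewrite (cvI2E H ab xU cx tab).
by [].
Qed.

Lemma CkI_density c : Ck_curve 0 T 3 c -> CkI 0 T 0 (density c : R -> R^o).
Proof.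
move=> hc t tT.
have [a [b [rt di]]] := chart_nbhd T0 hc tT (chart_atP (c t)).
set i := chart_at (c t) in di; have [aa bb ab tab nt] := rt.
have H := chart_geometry hnabla i.
have cx : CkI a b 3 (Defs.coord i c) by exact: chart_of_curve hc aa bb di.
have xU u : a <= u <= b -> img i (Defs.coord i c u) by move=> uab; exists (c u) => //; exact: di.
have cj j : (j <= 3)%N -> CkI a b 0 (iter j (derive_within a b) (Defs.coord i c)).
  by move=> j3; apply: CkI_iter => //; rewrite addn0; exact: CkI_le cx.
have cL := CkI_lagr H (e1 := eps1 ^+ 2) (e2 := eps2 ^+ 2) xU (cj 0 isT) (cj 1 isT) (cj 2 isT) (cj 3 isT).
have [_ /(_ 0 isT) cv] := CkI_rnb rt cL.
rewrite (density_lagr hc rt di).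
apply: cvg_trans cv; apply: near_eq_cvg; rewrite near_withinE.
have := rnb_near rt; apply: filterS => u ru; rewrite /= in_itv/= => uT.
by rewrite (density_lagr hc (ru uT) di).
Qed.

End Density.

(** Extends to the ends of a piece what variations supported in its interior establish: where [f] is
    nonzero it is so on a relative neighbourhood, which contains an interior point. *)
Lemma CkI0_closure (R : realType) (V : normedModType R) (a b : R) (f : R -> V) : a < b ->
  CkI a b 0 f -> (forall t, a < t < b -> f t = 0) -> forall t, a <= t <= b -> f t = 0.
Proof.
move=> ab cf f0 t tab; apply/eqP; apply/negPn/negP => ft.
have near_ft : \forall y \near f t, y != 0.
  apply/nbhs_ballP; exists `|f t|; first by rewrite /= normr_gt0.
  by move=> y; rewrite -ball_normE /=; apply: contraTneq => ->; rewrite subr0 ltxx.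
have : \forall u \near within `[a, b] (nbhs t), f u != 0 := cf t tab _ near_ft.
rewrite near_withinE => nf.
have nP : \forall u \near t, a <= u <= b -> f u != 0.
  by apply: filterS nf => u hu uab; apply: hu; rewrite /= in_itv.
have [a' [b' [[aa bb ab' _ _] P]]] := rnb_ex ab tab nP.
have m1 : a < (a' + b') / 2 < b by lra.
have m2 : a' <= (a' + b') / 2 <= b' by lra.
by have := P _ m2; rewrite (f0 _ m1) eqxx.
Qed.

Lemma rnb_shrink (R : realType) (a b c d c' d' t : R) : rnb a b c d t -> c <= c' -> d' <= d ->
  c' < d' -> c' <= t <= d' -> (c' == c) || (c' < t) -> (d' == d) || (t < d') ->
  rnb a b c' d' t.
Proof.
move=> [aa bb cd tcd nt] cc dd cd' tcd' h1 h2; split => //.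
- exact: le_trans aa cc.
- exact: le_trans dd bb.
have n1 : \forall u \near t, c <= u -> c' <= u.
  move: h1 => /orP[/eqP->|h1]; first by near=> u.
  by have := lt_le_nbhsr h1; apply: filterS => u + _.
have n2 : \forall u \near t, u <= d -> u <= d'.
  move: h2 => /orP[/eqP->|h2]; first by near=> u.
  by have := lt_le_nbhsl h2; apply: filterS => u + _.
apply: filterS3 nt n1 n2 => u k k1 k2 /k /andP[/k1 -> /k2 ->] //.
Unshelve. all: by end_near. Qed.

(** * Admissible variations of a minimizer and its equation *)

Section Minimizer.
Variables (R : realType) (n : nat) (M : smoothManifold R n).
Variables (g : riemannianMetric M) (nabla : affineConnection M).
Hypothesis hnabla : levi_civita g nabla.
Variables (eps1 eps2 T : R).
Hypothesis hT : 0 < T.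

Lemma cov_velocity_local c c' k i a b t : rnb 0 T a b t ->
  (forall u, a <= u <= b -> c u = c' u) ->
  cov_velocity nabla T c k i t = cov_velocity nabla T c' k i t.
Proof.
move=> rt cc'; have [_ _ _ tab _] := rt.
have E : cvI a b (christoffel nabla i) (Defs.coord i c) k t =
    cvI a b (christoffel nabla i) (Defs.coord i c') k t.
  by apply: cvI_eq tab => u uab; rewrite /Defs.coord /= cc'.
have E1 := cvI_rnb (christoffel nabla i) (Defs.coord i c) k rt.
have E2 := cvI_rnb (christoffel nabla i) (Defs.coord i c') k rt.
exact: etrans E1 (etrans E (esym E2)).
Qed.

Lemma density_local c c' a b t : rnb 0 T a b t -> (forall u, a <= u <= b -> c u = c' u) ->
  density g nabla eps1 eps2 T c t = density g nabla eps1 eps2 T c' t.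
Proof.
move=> rt cc'; have [_ _ _ tab _] := rt.
have E k : cov_velocity_norm g nabla T c k t = cov_velocity_norm g nabla T c' k t.
  by rewrite /cov_velocity_norm (cov_velocity_local k _ rt cc') /Defs.coord /= (cc' t tab).
by rewrite /density !E.
Qed.

Variables (p0 : M) (v0 w0 : tangent p0) (p1 : M) (v1 w1 : tangent p1) (q : R -> M).
Hypothesis hq : in_curve_space nabla T v0 w0 v1 w1 q.

Section Variation.
Variables (i : chart M) (c d a b s : R) (h : R -> 'rV[R]_n).
Hypotheses (c0 : 0 <= c) (ca : c < a) (ab : a < b) (bd : b < d) (dT : d <= T).
Hypothesis di : forall u, c <= u <= d -> dom i (q u).
Hypothesis h_out : forall u, (u <= a) || (b <= u) -> h u = 0.
Hypothesis ch3 : CkI c d 3 h.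
Hypothesis ch : forall k, CkI a b k h.
Let x := Defs.coord i q.
Hypothesis hU : forall u, c <= u <= d -> img i (x u + h u).

(** On the margins [[c, a]] and [[b, d]] the field is zero and both formulas give [q]. Hence every
    time has a relative neighbourhood on which a single formula holds. *)
Definition vary t : M := if c <= t <= d then psi i (x t + h t) else q t.

Lemma vary_out t : (t <= a) || (b <= t) -> vary t = q t.
Proof.
move=> tab; rewrite /vary; case: ifP => // tcd.
by rewrite (h_out tab) addr0 /x /Defs.coord /= phiK//; exact: di.
Qed.

Lemma vary_in t : c <= t <= d -> dom i (vary t) /\ Defs.coord i vary t = x t + h t.
Proof. by move=> tcd; rewrite /Defs.coord /= /vary tcd; exact: img_dom (hU tcd). Qed.

Lemma vary_rnb_mid t : a <= t <= b -> rnb 0 T c d t.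
Proof.
move=> /andP[at_ tb].
have ct := lt_le_trans ca at_; have td := le_lt_trans tb bd.
split => //; first exact: lt_trans ct td.
  by rewrite !ltW.
have n1 := lt_le_nbhsr ct; have n2 := lt_le_nbhsl td.
by apply: filterS2 n1 n2 => u -> ->.
Qed.

Lemma near_out t : (t < a) || (b < t) -> \forall u \near t, (u <= a) || (b <= u).
Proof.
move=> /orP[ta|bt].
  by have := lt_le_nbhsl ta; apply: filterS => u ->.
by have := lt_le_nbhsr bt; apply: filterS => u ->; rewrite orbT.
Qed.

Lemma vary_rnb_out t : 0 <= t <= T -> (t < a) || (b < t) ->
  exists a' b', rnb 0 T a' b' t /\ forall u, a' <= u <= b' -> vary u = q u.
Proof.
move=> tT tab; apply: (rnb_ex hT tT).
by have := near_out tab; apply: filterS => u uab _; exact: vary_out.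
Qed.

Lemma Ck_curve_vary : Ck_curve 0 T 3 vary.
Proof.
have hq3 := curve_C3 hq.
have x3 : CkI c d 3 x := chart_of_curve hq3 c0 dT di.
apply: (curve_of_charts hT) => t tT.
have [tab|] := boolP ((t < a) || (b < t)); last first.
  rewrite negb_or -!leNgt => tab; exists c, d, i; split.
  - exact: vary_rnb_mid.
  - by move=> u /vary_in[].
  - by apply: CkI_eq (CkID x3 ch3) => u /vary_in[].
have it := chart_atP (q t).
have nj := near_dom tT (curve_continuous hq3 tT) it.
have nP : \forall u \near t, 0 <= u <= T -> vary u = q u /\ dom (chart_at (q t)) (q u).
  apply: filterS2 nj (near_out tab) => u h1 h2 uT; split; last exact: h1.
  exact: vary_out.
have [a' [b' [rt P]]] := rnb_ex hT tT nP; have [aa bb _ _ _] := rt.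
exists a', b', (chart_at (q t)); split => //.
  by move=> u /P[-> ].
have cx : CkI a' b' 3 (Defs.coord (chart_at (q t)) q).
  by apply: (chart_of_curve hq3 aa bb) => u /P[].
by apply: CkI_eq cx => u /P[E _]; rewrite /Defs.coord /= E.
Qed.

(** [a] and [b] are added to the partition, since [h] is assumed smooth on [[a, b]] but only C^3
    across its ends. *)
Lemma piecewise_smooth_vary : piecewise_smooth 0 T vary.
Proof.
have p := curve_piecewise_smooth hq.
have a0 : 0 < a := le_lt_trans c0 ca; have bT : b < T := lt_le_trans bd dT.
have tE t : a <= t <= b -> c <= t <= d.
  by move=> /andP[at_ tb]; rewrite (le_trans (ltW ca) at_) (le_trans tb (ltW bd)).
have pa : piecewise_smooth 0 a q.
  by apply: (pw_sub_r p); rewrite ltW// ltW// (lt_trans ab).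
have pab : piecewise_smooth a b q.
  have pb : piecewise_smooth 0 b q.
    by apply: (pw_sub_r p); rewrite ltW ?(lt_trans a0)// ltW.
  by apply: (pw_sub_l pb); rewrite !ltW.
have pT : piecewise_smooth b T q.
  by apply: (pw_sub_l p); rewrite ltW ?(lt_trans a0)// ltW.
apply: (pw_cat (m := a)).
  by apply: pw_eq pa => u /andP[_ ua]; rewrite vary_out// ua.
apply: (pw_cat (m := b)); last first.
  by apply: pw_eq pT => u /andP[bu _]; rewrite vary_out// bu orbT.
apply: (pw_chart_field pab (i := i) (h := h)) => //.
- by move=> u /tE; exact: di.
- by move=> u /tE; exact: hU.
- by move=> u /tE ucd; rewrite /vary ucd.
Qed.

Lemma in_curve_space_vary : in_curve_space nabla T v0 w0 v1 w1 vary.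
Proof.
have a0 : 0 < a := le_lt_trans c0 ca; have bT : b < T := lt_le_trans bd dT.
have T0 : (0:R) <= 0 <= T by rewrite lexx ltW.
have TT : 0 <= T <= T by rewrite lexx ltW.
have h0 : ((0:R) < a) || (b < 0) by rewrite a0.
have h1 : (T < a) || (b < T) by rewrite bT orbT.
have [a1 [b1 [r1 e1]]] := vary_rnb_out T0 h0.
have [a2 [b2 [r2 e2]]] := vary_rnb_out TT h1.
have q0 : vary 0 = q 0 by apply: vary_out; rewrite ltW.
have qT : vary T = q T by apply: vary_out; rewrite (ltW bT) orbT.
case: hq => _ _ s1 s2 s3 s4 s5 s6; split.
- exact: Ck_curve_vary.
- exact: piecewise_smooth_vary.
- by rewrite q0.
- by move=> j hj; rewrite -(s2 j hj); exact: (cov_velocity_local 0 j r1 e1).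
- by move=> j hj; rewrite -(s3 j hj); exact: (cov_velocity_local 1 j r1 e1).
- by rewrite qT.
- by move=> j hj; rewrite -(s5 j hj); exact: (cov_velocity_local 0 j r2 e2).
- by move=> j hj; rewrite -(s6 j hj); exact: (cov_velocity_local 1 j r2 e2).
Qed.

(** Strictly outside [[a, b]] the two curves agree near each time. At [a] and [b] they agree on one
    side only, and equality follows from continuity of both densities. *)
Lemma density_vary_out a' b' t : 0 <= a' -> a' < b' -> b' <= T -> (b' <= a) || (b <= a') ->
  a' <= t <= b' ->
  density g nabla eps1 eps2 T q t = density g nabla eps1 eps2 T vary t.
Proof.
move=> aa ab' bb out tab.
have cv := CkI_sub aa bb (CkI_density hnabla hT Ck_curve_vary (eps1 := eps1) (eps2 := eps2)).
have cq := CkI_sub aa bb (CkI_density hnabla hT (curve_C3 hq) (eps1 := eps1) (eps2 := eps2)).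
apply/eqP; rewrite -subr_eq0; apply/eqP.
apply: (CkI0_closure ab' (CkIB cq cv)) tab => u /andP[au ub].
have uT : 0 <= u <= T by rewrite (le_trans aa (ltW au)) (le_trans (ltW ub) bb).
have uo : (u < a) || (b < u).
  move: out => /orP[b'a|ba']; first by rewrite (lt_le_trans ub).
  by rewrite (le_lt_trans ba') ?orbT.
have [a1 [b1 [r1 e1]]] := vary_rnb_out uT uo.
by rewrite (density_local r1 e1) subrr.
Qed.

Lemma energy_vary :
  tension_energy g nabla eps1 eps2 T q <= tension_energy g nabla eps1 eps2 T vary ->
  (\int[lebesgue_measure]_(t in `[a, b])
     lagrI (christoffel nabla i) (metric_mx g i) (eps1 ^+ 2) (eps2 ^+ 2) c d x t <=
   \int[lebesgue_measure]_(t in `[a, b])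
     lagrI (christoffel nabla i) (metric_mx g i) (eps1 ^+ 2) (eps2 ^+ 2) c d
       (fun t => x t + h t) t)%R.
Proof.
have cancel (A B C A' B' C' : R) : A = A' -> C = C' -> A + (B + C) <= A' + (B' + C') -> B <= B'.
  by move=> -> ->; rewrite lerD2l lerD2r.
have le_eq (A B A' B' : R) : A = A' -> B = B' -> A <= B -> A' <= B' by move=> -> ->.
have a0 : 0 < a := le_lt_trans c0 ca; have bT : b < T := lt_le_trans bd dT.
have a0' := ltW a0; have bT' := ltW bT; have ab' := ltW ab.
have aT' := ltW (lt_trans ab bT).
have split_energy cu : Ck_curve 0 T 3 cu -> tension_energy g nabla eps1 eps2 T cu =
    (\int[lebesgue_measure]_(t in `[0%R, a]) density g nabla eps1 eps2 T cu t +
     (\int[lebesgue_measure]_(t in `[a, b]) density g nabla eps1 eps2 T cu t +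
     \int[lebesgue_measure]_(t in `[b, T]) density g nabla eps1 eps2 T cu t))%R.
  move=> hc; have cd := CkI_density hnabla hT hc (eps1 := eps1) (eps2 := eps2).
  rewrite -(@Rintegral_split _ a b T (density g nabla eps1 eps2 T cu) ab' bT').
    apply: (@Rintegral_split _ 0 a T (density g nabla eps1 eps2 T cu) a0' aT').
    exact: CkI0_integrable cd.
  exact: CkI0_integrable (CkI_sub a0' (lexx _) cd).
rewrite (split_energy q (curve_C3 hq)) (split_energy vary Ck_curve_vary).
have E1 : (\int[lebesgue_measure]_(t in `[0%R, a]) density g nabla eps1 eps2 T q t =
  \int[lebesgue_measure]_(t in `[0%R, a]) density g nabla eps1 eps2 T vary t)%R.
  apply: Rintegral_eq_itv => t tab.
  by apply: (density_vary_out (lexx _) a0 aT' _ tab); rewrite lexx.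
have E3 : (\int[lebesgue_measure]_(t in `[b, T]) density g nabla eps1 eps2 T q t =
  \int[lebesgue_measure]_(t in `[b, T]) density g nabla eps1 eps2 T vary t)%R.
  apply: Rintegral_eq_itv => t tab.
  by apply: (density_vary_out (ltW (lt_trans a0 ab)) bT (lexx _) _ tab); rewrite lexx orbT.
move=> /(cancel _ _ _ _ _ _ E1 E3).
have E2 (cu : R -> M) (y : R -> 'rV[R]_n) : Ck_curve 0 T 3 cu ->
    (forall u, c <= u <= d -> dom i (cu u)) ->
    (forall u, c <= u <= d -> Defs.coord i cu u = y u) ->
    (\int[lebesgue_measure]_(t in `[a, b]) density g nabla eps1 eps2 T cu t =
     \int[lebesgue_measure]_(t in `[a, b])
     lagrI (christoffel nabla i) (metric_mx g i) (eps1 ^+ 2) (eps2 ^+ 2) c d y t)%R.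
  move=> hc dc Ey; apply: Rintegral_eq_itv => t tab.
  have rt := vary_rnb_mid tab; have [_ _ _ tcd _] := rt.
  rewrite (density_lagr hnabla eps1 eps2 hT hc rt dc) /lagrI (Ey t tcd).
  have F j := iter_derive_within_eq j tcd Ey.
  by rewrite (F 1) (F 2) (F 3).
have F1 := E2 q x (curve_C3 hq) di (fun _ _ => erefl _).
have F2 := E2 vary (fun t => x t + h t) Ck_curve_vary (fun u hu => (vary_in hu).1)
  (fun u hu => (vary_in hu).2).
exact: le_eq _ _ _ _ F1 F2.
Qed.

End Variation.

Hypothesis hmin : forall c : R -> M, in_curve_space nabla T v0 w0 v1 w1 c ->
  tension_energy g nabla eps1 eps2 T q <= tension_energy g nabla eps1 eps2 T c.

Lemma minimizer_locally_minimal i c d : 0 <= c -> c < d -> d <= T ->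
  (forall u, c <= u <= d -> dom i (q u)) ->
  locally_minimal (christoffel nabla i) (metric_mx g i) (eps1 ^+ 2) (eps2 ^+ 2) c d
    (Defs.coord i q).
Proof.
move=> c0 cd dT di a b p u ca ab bd cp.
have H := chart_geometry hnabla i.
have xU t : c <= t <= d -> img i (Defs.coord i q t).
  by move=> tcd; exists (q t) => //; exact: di.
have x3 : CkI c d 3 (Defs.coord i q) := chart_of_curve (curve_C3 hq) c0 dT di.
have b3 := CkI_bump_field a b u cp c d.
have tub := tube_in H xU (CkI_le (leq0n _) x3) (CkI_le (leq0n _) b3) (mc_g H).
apply: filterS tub => s hs.
have ch3 : CkI c d 3 (fun t => s *: bump_field a b p u t) := CkIZ s b3.
have ch k : CkI a b k (fun t => s *: bump_field a b p u t).
  by apply: CkIZ; apply: CkIZv; apply: CkIM; [exact: CkI_cutoff_in|exact: cp].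
have h_out t : (t <= a) || (b <= t) -> s *: bump_field a b p u t = 0.
  by move=> tab; rewrite bump_field_out ?scaler0.
apply: (energy_vary c0 ca ab bd dT di h_out ch3 hs); apply: hmin.
exact: in_curve_space_vary c0 ca ab bd dT di h_out ch3 ch hs.
Qed.

Lemma euler_smooth_piece i c d : 0 <= c -> c < d -> d <= T ->
  (forall u, c <= u <= d -> dom i (q u)) -> CkI c d 6 (Defs.coord i q) ->
  forall t, c <= t <= d ->
  eulerI (christoffel nabla i) c d (eps1 ^+ 2) (eps2 ^+ 2) (Defs.coord i q) t = 0.
Proof.
move=> c0 cd dT di x6.
have H := chart_geometry hnabla i.
have xU t : c <= t <= d -> img i (Defs.coord i q t).
  by move=> tcd; exists (q t) => //; exact: di.
have lm := minimizer_locally_minimal c0 cd dT di.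
have cE := CkI_eulerI H cd xU x6 (e1 := eps1 ^+ 2) (e2 := eps2 ^+ 2).
apply: (CkI0_closure cd cE) => t /andP[ct td].
exact: (euler_eq0 H ct td xU lm x6).
Qed.

(** Every interior time is treated as a possible corner, with a smooth piece on either side;
    piecewise smoothness provides such pieces at all times. *)
Lemma euler_chart i t : 0 <= t <= T -> dom i (q t) -> exists c d,
  [/\ rnb 0 T c d t, forall u, c <= u <= d -> dom i (q u), CkI c d 6 (Defs.coord i q) &
    eulerI (christoffel nabla i) c d (eps1 ^+ 2) (eps2 ^+ 2) (Defs.coord i q) t = 0].
Proof.
move=> tT it; have hq3 := curve_C3 hq; have pq := curve_piecewise_smooth hq.
have H := chart_geometry hnabla i.
have [c [d [rt di]]] := chart_nbhd hT hq3 tT it; have [c0 dT cd /andP[ct td] _] := rt.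
have L : c < t -> exists c', [/\ c <= c', c' < t & CkI c' t 6 (Defs.coord i q)].
  move=> ct'; have [e [e0 et he]] := pw_left pq (le_lt_trans c0 ct') (le_trans td dT).
  exists (Num.max c e); split; first by rewrite le_max lexx.
    by rewrite gt_max ct' et.
  apply: (chart_of_curve (he 6) _ (lexx _)); first by rewrite le_max lexx orbT.
  by move=> u /andP[]; rewrite ge_max => /andP[cu _] ut; apply: di; rewrite cu (le_trans ut).
have L' : t < d -> exists d', [/\ d' <= d, t < d' & CkI t d' 6 (Defs.coord i q)].
  move=> td'; have [e [te eT he]] := pw_right pq (le_trans c0 ct) (lt_le_trans td' dT).
  exists (Num.min d e); split; first by rewrite ge_min lexx.
    by rewrite lt_min td' te.
  apply: (chart_of_curve (he 6) (lexx _)); first by rewrite ge_min lexx orbT.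
  by move=> u /andP[tu]; rewrite le_min => /andP[ud _]; apply: di; rewrite ud (le_trans ct).
have sub c' d' : c <= c' -> d' <= d -> forall u, c' <= u <= d' -> dom i (q u).
  move=> cc dd u /andP[cu ud]; apply: di.
  by rewrite (le_trans cc cu) (le_trans ud dd).
(* A relative neighbourhood has [t] as an end only when [t] is that end of [[0, T]]; then there is
   one piece and nothing to match. *)
have [tc|ct'] := leP t c.
  have tc' : t = c by apply/le_anti; rewrite tc ct.
  have [d' [dd td' x6]] := L' (le_lt_trans tc cd).
  have t0 : 0 <= t by rewrite tc'.
  have rt' : rnb 0 T t d' t.
    by apply: (rnb_shrink rt) => //; rewrite ?lexx ?ltW// ?tc' ?eqxx// -tc' td' orbT.
  exists t, d'; split => //; first exact: sub.
  apply: (euler_smooth_piece t0 td' (le_trans dd dT) (sub _ _ ct dd) x6).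
  by rewrite lexx ltW.
have [c' [cc ct2 xl]] := L ct'.
have c'0 := le_trans c0 cc.
have [dt|td'] := leP d t.
  have dt' : t = d by apply/le_anti; rewrite dt td.
  have rt' : rnb 0 T c' t t.
    by apply: (rnb_shrink rt) => //; rewrite ?lexx ?ltW// ?dt' ?eqxx// -dt' ct2 orbT.
  exists c', t; split => //; first exact: sub.
  apply: (euler_smooth_piece c'0 ct2 (le_trans td dT) (sub _ _ cc td) xl).
  by rewrite lexx ltW.
have [d' [dd td2 xr]] := L' td'.
have d'T := le_trans dd dT; have cd' := lt_trans ct2 td2.
have rt' : rnb 0 T c' d' t.
  by apply: (rnb_shrink rt) => //; rewrite ?ct2 ?td2 ?orbT// !ltW.
have sub' := sub _ _ cc dd.
have xU u : c' <= u <= d' -> img i (Defs.coord i q u).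
  by move=> uab; exists (q u) => //; exact: sub'.
have lm := minimizer_locally_minimal c'0 cd' d'T sub'.
have x3 : CkI c' d' 3 (Defs.coord i q) := chart_of_curve hq3 c'0 d'T sub'.
have El := euler_smooth_piece c'0 ct2 (le_trans td dT) (sub _ _ cc td) xl.
have Er := euler_smooth_piece (le_trans c0 ct) td2 d'T (sub _ _ ct dd) xr.
exists c', d'; split => //.
  exact: (CkI6 H ct2 td2 xU lm x3 xl xr El Er).
exact: (euler_at H ct2 td2 xU lm x3 xl xr El Er).
Qed.

Lemma minimizer_quintic : quintic_in_tension nabla eps1 eps2 T q.
Proof.
split.
  apply: (curve_of_charts hT) => t tT.
  have [c [d [rt di x6 _]]] := euler_chart tT (chart_atP (q t)).
  by exists c, d, (chart_at (q t)).
move=> i t tT it D Rm0.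
have [c [d [rt di x6 E]]] := euler_chart tT it.
have Ix : img i (Defs.coord i q t) by exists (q t).
have DE k : D k = cvI c d (christoffel nabla i) (Defs.coord i q) k t.
  exact: (cvI_rnb (christoffel nabla i) (Defs.coord i q) k rt).
have RE u v w : Rm0 u v w = Rm (christoffel nabla i) (Defs.coord i q t) u v w.
  exact: (curvatureE hnabla).
rewrite !RE !DE; apply/esym/eqP; rewrite -subr_eq0; apply/eqP.
exact: E.
Qed.

End Minimizer.

Theorem mainTheorem4 (R : realType) (n : nat) (M : smoothManifold R n)
    (g : riemannianMetric M) (nabla : affineConnection M)
    (hnabla : levi_civita g nabla)
    (eps1 eps2 T : R) (heps1 : 0 < eps1) (heps2 : 0 < eps2) (hT : 0 < T)
    (p0 : M) (v0 w0 : tangent p0) (p1 : M) (v1 w1 : tangent p1)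
    (q : R -> M)
    (hq : in_curve_space nabla T v0 w0 v1 w1 q)
    (hmin : forall c : R -> M, in_curve_space nabla T v0 w0 v1 w1 c ->
      tension_energy g nabla eps1 eps2 T q <=
      tension_energy g nabla eps1 eps2 T c) :
  quintic_in_tension nabla eps1 eps2 T q.
Proof. exact: (minimizer_quintic hnabla hT hq hmin). Qed.
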